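(* Let $\xi$ be a real random variable with $\mathbb{E} e^{\xi}=\tfrac12$, $\mathbb{E}\,\xi e^{\xi}=0$ and $\mathbb{E}|\xi|^3e^{\xi}<\infty$. Let $\beta\in(0,1)$ and $\gamma\in(0,1/2)$, and let $\mu_\beta$ be the associated subcritical Mandelbrot cascade measure on $[0,1]$. Put $\widetilde\phi(s)=1+\log_2\mathbb{E}(e^{s\xi})$. Suppose that there exists $q_\beta>1$ such that $\widetilde\phi(\beta q_\beta)-q_\beta\widetilde\phi(\beta)=0$ (in that case $q_\beta$ is unique), and suppose also that $\mathbb{E}\max(0,\xi)e^{\beta q_\beta\xi}<\infty$. Then there is a random constant $C(\omega)$, finite almost surely, such that for all subintervals $I\subset[0,1]$ $$\mu_\beta(I)\le C(\omega)\,|I|^{\widetilde\phi(\beta)}\left(\log\left(1+\frac1{|I|}\right)\right)^{-\gamma\beta}.$$ In the Gaussian case (i.e. $\xi\sim N(-2\log2,2\log2)$), $\widetilde\phi(\beta)=(1-\beta)^2$ and $q_\beta=1/\beta^2$.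
   Context: Notation: $|I|$ is the length of $I$. $\Sigma_n=\{0,1\}^n$, $\Sigma=\bigcup_{n\ge1}\Sigma_n$. Let $(\xi_\sigma)_{\sigma\in\Sigma}$ be independent copies of $\xi$; for $\sigma=\sigma_1\cdots\sigma_n\in\Sigma_n$ put $X_\sigma=\xi_{\sigma_1}+\xi_{\sigma_1\sigma_2}+\cdots+\xi_{\sigma_1\sigma_2\cdots\sigma_n}$, and let $I_\sigma\subset[0,1]$ be the dyadic interval of length $2^{-n}$ with left endpoint $\sum_{k=1}^n\sigma_k2^{-k}$. Subcritical measure: for $\beta\in(0,1)$ let $Z_{\beta,n}=\sum_{\sigma\in\Sigma_n}e^{\beta X_\sigma}$, so $\mathbb{E}Z_{\beta,n}=2^{n\widetilde\phi(\beta)}$. Let $\mu_{\beta,n}$ be the random measure on $[0,1]$ whose density with respect to Lebesgue measure is constant on each $I_\sigma$, $\sigma\in\Sigma_n$, with $\mu_{\beta,n}(I_\sigma)=(\mathbb{E}Z_{\beta,n})^{-1}e^{\beta X_\sigma}$. It is known that, almost surely, $\mu_{\beta,n}$ converges weakly as $n\to\infty$ to a random finite measure $\mu_\beta$, whose total mass $Y_\beta=\lim_n(\mathbb{E}Z_{\beta,n})^{-1}Z_{\beta,n}$ is almost surely positive. For every $n$, $(\mu_\beta(I_\sigma))_{\sigma\in\Sigma_n}$ has the law of $(2^{-n\widetilde\phi(\beta)}e^{\beta X_\sigma}Y_\beta^{(\sigma)})_{\sigma\in\Sigma_n}$ with $(Y_\beta^{(\sigma)})$ independent copies of $Y_\beta$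 independent of $(X_\sigma)_{\sigma\in\Sigma_n}$. The condition defining $q_\beta$ amounts to saying that for $q>0$ one has $\mathbb{E}Y_\beta^q<\infty$ if and only if $q<q_\beta$. *)

(* Defs.v *)
From HB Require Import structures.
From mathcomp Require Import all_boot all_order all_algebra.
From mathcomp Require Import all_classical all_reals all_analysis measurable_realfun.

Set Implicit Arguments.
Unset Strict Implicit.
Unset Printing Implicit Defensive.

Import Order.TTheory GRing.Theory Num.Def Num.Theory.
Import numFieldNormedType.Exports.

Local Open Scope classical_set_scope.
Local Open Scope ring_scope.

Section exponent.
Context d (T : measurableType d) (R : realType) (P : probability T R).
Variable xi : {RV P >-> R}.

(* Extended-real valued: +oo exactly where the exponential moment is infinite. *)
Definition phi_tilde (s : R) : \bar R :=
  (1 + lne 'E_P[fun t => expR (s * xi t)%R] * ((ln 2)^-1)%:E)%E.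

(* As phi_tilde takes the value +oo, the equation forces phi_tilde (beta * q)
   to be finite as soon as phi_tilde beta is. *)
Definition is_q_beta (beta q : R) : Prop :=
  1 < q /\ (phi_tilde (beta * q) - q%:E * phi_tilde beta = 0)%E.

Definition critical_normalization : Prop :=
  [/\ ('E_P[fun t => expR (xi t)] = (2^-1)%:E)%E,
      ('E_P[(fun t => xi t * expR (xi t))%R] = 0)%E &
      ('E_P[(fun t => `|xi t| ^+ 3 * expR (xi t))%R] < +oo)%E].

(* The second argument of normal_prob is the standard deviation. *)
Definition gaussian_case : Prop :=
  forall B : set R, measurable B ->
    distribution P xi B = normal_prob (- 2 * ln 2) (Num.sqrt (2 * ln 2)) B.

End exponent.

Section independence.
Context d (T : measurableType d) (R : realType) (P : probability T R).

Definition mutually_independent (J : eqType) (D : pred J)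
    (X : J -> {RV P >-> R}) : Prop :=
  forall (r : seq J) (B : J -> set R), uniq r -> all D r ->
    (forall j, measurable (B j)) ->
    P (\bigcap_(j in [set` r]) (X j @^-1` B j)) =
    (\prod_(j <- r) P (X j @^-1` B j))%E.

(* Nodes of the binary tree are words on {0,1}; the root [::] carries no
   variable, so Xi [::] is unconstrained. *)
Definition independent_copies d0 (T0 : measurableType d0)
    (P0 : probability T0 R) (xi : {RV P0 >-> R})
    (Xi : seq bool -> {RV P >-> R}) : Prop :=
  (forall (s : seq bool) (B : set R), s != [::] -> measurable B ->
     distribution P (Xi s) B = distribution P0 xi B) /\
  mutually_independent (fun s => s != [::]) Xi.

End independence.

Section dyadic.
Context (R : realType).

Definition dyadic_left (s : seq bool) : R :=
  \sum_(k < size s) (nth false s k)%:R * 2 ^- k.+1.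

Definition dyadic_cell (s : seq bool) : set R :=
  `[dyadic_left s, dyadic_left s + 2 ^- size s[.

End dyadic.
Arguments dyadic_cell : clear implicits.

Section cascade.
Context d (T : measurableType d) (R : realType) (P : probability T R).
Variables (Xi : seq bool -> {RV P >-> R}) (beta : R).

Definition walk (s : seq bool) (w : T) : R :=
  \sum_(1 <= k < (size s).+1) Xi (take k s) w.

Definition partition_function (n : nat) (w : T) : R :=
  \sum_(s : n.-tuple bool) expR (beta * walk s w).

(* The factor 2 ^+ n is the inverse length of the dyadic interval, so that
   dyadic_cell s gets mass e^{beta X_s} / E Z_n. *)
Definition cascade_density (n : nat) (w : T) (x : R) : R :=
  \sum_(s : n.-tuple bool)
    2 ^+ n * ((fine 'E_P[partition_function n]%E)^-1 * expR (beta * walk s w))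
      * \1_(dyadic_cell R s) x.

(* A measure on [0,1] is seen as a measure on R carried by [0,1]. *)
Definition cascade_measure (n : nat) (w : T) (A : set R) : \bar R :=
  (\int[@lebesgue_measure R]_(x in A) (cascade_density n w x)%:E)%E.

Lemma cascade_density_ge0 n w x : 0 <= cascade_density n w x.
Proof.
apply: sumr_ge0 => s _; rewrite !mulr_ge0 ?exprn_ge0 ?expR_ge0 ?invr_ge0//.
apply: fine_ge0; rewrite unlock; apply: integral_ge0 => t _.
by rewrite lee_fin; apply: sumr_ge0 => u _; exact: expR_ge0.
Qed.

Lemma measurable_cascade_density n w :
  measurable_fun [set: R] (cascade_density n w).
Proof.
apply: measurable_sum => s; apply: measurable_funM => //.
by apply: measurable_indic; exact: measurable_itv.
Qed.

Let cascade_measure0 n w : cascade_measure n w set0 = 0%E.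
Proof. exact: integral_set0. Qed.

Let cascade_measure_ge0 n w A : (0 <= cascade_measure n w A)%E.
Proof. by apply: integral_ge0 => x _; rewrite lee_fin cascade_density_ge0. Qed.

Let cascade_measure_sigma_additive n w :
  semi_sigma_additive (cascade_measure n w).
Proof.
move=> F mF tF mUF; rewrite /cascade_measure ge0_integral_bigcup//=.
- apply: is_cvg_ereal_nneg_natsum_cond => k _ _.
  exact: cascade_measure_ge0.
- apply: measurable_funTS.
  by apply/measurable_EFinP; exact: measurable_cascade_density.
- by move=> x _; rewrite lee_fin cascade_density_ge0.
Qed.

HB.instance Definition _ n w := isMeasure.Build _ _ _ (cascade_measure n w)
  (cascade_measure0 n w) (cascade_measure_ge0 n w)
  (@cascade_measure_sigma_additive n w).

End cascade.

Section weak_limit.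
Context (R : realType).

Definition weak_cvg (m_ : nat -> {measure set R -> \bar R})
    (m : {measure set R -> \bar R}) : Prop :=
  forall f : R -> R, continuous f -> (exists M : R, forall x, `|f x| <= M) ->
    (\int[m_ n]_x (f x)%:E @[n --> \oo] --> \int[m]_x (f x)%:E)%E.

(* A random finite measure is a finite transition kernel; weak limits being
   unique, the predicate determines mu almost surely. *)
Definition is_subcritical_cascade d (T : measurableType d)
    (P : probability T R) (Xi : seq bool -> {RV P >-> R}) (beta : R)
    (mu : R.-ftker T ~> R) : Prop :=
  {ae P, forall w, weak_cvg (fun n => cascade_measure Xi beta n w) (mu w)}.

End weak_limit.

Definition itv_length (R : realType) (I : interval R) : R :=
  fine (@lebesgue_measure R [set` I]).

(* Main.v *)
(** Tilting each step by 2 e^xi turns a sum over the 2^n nodes of generation n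
    into an expectation over a single centred random walk S (many-to-one).  The
    mass W below a node has a bounded p-th moment for every p < q_beta, and
    q_beta > 1 / beta by convexity of the exponent, so some such p satisfies
    p beta > 1.  Hence the probability that e^{beta X_s} W_s > n^{- gamma beta}
    for some node s of generation n is at most n^gamma times the probability
    that S_k <= 3 log n for all k <= n and S_n >= - A log n, up to summable
    errors.  The latter event has probability n^{- 3/2 + eps}: the first and the
    last third of the walk stay on one side of a nearly horizontal barrier, at a
    total cost n^{- 1 + eps} (decompose a walk at its maximum), and the middle
    third has to end in a window of logarithmic size, at a cost n^{- 1/2 + eps}.
    As gamma < 1/2 these probabilities are summable; by Borel-Cantelli the
    dyadic cells of generation n have mass at most of order
    2^{- n phi} n^{- gamma beta}, and two consecutive cells cover any interval of
    comparable length. *)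

Require Import Defs.
From HB Require Import structures.
From mathcomp Require Import all_boot all_order all_algebra.
From mathcomp Require Import all_classical all_reals all_analysis measurable_realfun.
From mathcomp Require Import ring lra.

Set Implicit Arguments.
Unset Strict Implicit.
Unset Printing Implicit Defensive.

Import Order.TTheory GRing.Theory Num.Def Num.Theory.
Import numFieldNormedType.Exports.
Local Open Scope classical_set_scope.
Local Open Scope ring_scope.

(** * Independent families *)

(** The measure [mu] is given only as a weak limit, so its law is never computed. All estimates
    concern the cascade stopped at level n + m and are uniform in the depth m; they reach [mu]
    through continuous test functions. For fixed n the bad events vary with m without being nested,
    so no union over m is affordable. But the integrals of a test function converge along the full
    sequence, hence infinitely many good m suffice, and the event that all large m are bad keeps the
    bound of a single m.

    The strict inequality gamma < 1/2 leaves room for a loss n^eps in every walk estimate. A barrier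
    of height K may therefore cost C e^{eps K} instead of a sharp linear factor, and this crude cost
    follows from integrability, centring, two-sided tails and a square-root concentration bound,
    with no local limit theorem and no renewal theory.

    The density 2^N e^{S_N} depends on the horizon N, so the walk is studied under a family of
    probabilities [Q N], one for each horizon, all on the space of the cascade. *)

Section env.
Context {J : eqType} {R : realType}.

Definition cylinders (A : set J) : set (set (J -> R)) :=
  [set S | exists2 j, A j & exists2 B, measurable B & S = (fun x => x j) @^-1` B].

(* Real families indexed by J, measured through the coordinates in A only. *)
Definition env (A : set J) := g_sigma_algebraType (cylinders A).

Lemma measurable_coord (A : set J) j : A j ->
  measurable_fun [set: env A] (fun x : env A => x j).
Proof.
move=> Aj _ B mB; rewrite setTI.
by apply: sub_sigma_algebra; exists j => //; exists B.
Qed.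

Lemma measurable_envP d (T : measurableType d) (A : set J) (f : T -> env A) :
  (forall j, A j -> measurable_fun [set: T] (fun w => f w j)) ->
  measurable_fun [set: T] f.
Proof.
move=> mf; apply: (@measurability _ _ _ (env A) _ _ (cylinders A)) => //.
move=> _ [_ [j Aj [B mB ->]] <-]; rewrite setTI -[X in measurable X]setTI.
exact: mf.
Qed.

(** Cylinders generate the sigma-algebra but are not stable under intersection; boxes constrain
    finitely many coordinates at once and form the pi-system needed for uniqueness of measures. *)
Definition boxes (A : set J) : set (set (J -> R)) :=
  [set S | exists2 r : seq J, uniq r /\ (forall j, j \in r -> A j) &
    exists2 B : J -> set R, (forall j, measurable (B j)) &
      S = [set x | forall j, j \in r -> B j (x j)]].

Lemma boxes_setI (A : set J) : setI_closed (boxes A).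
Proof.
move=> _ _ [r [ur rA] [B mB ->]] [s [us sA] [C mC ->]].
exists (undup (r ++ s)).
  split; first exact: undup_uniq.
  by move=> j; rewrite mem_undup mem_cat => /orP[/rA|/sA].
exists (fun j => (if j \in r then B j else setT) `&`
                 (if j \in s then C j else setT)).
  by move=> j; apply: measurableI; case: ifP.
apply/seteqP; split=> x /=.
  by move=> [xr xs] j _; split; case: ifPn => // ?; [apply: xr|apply: xs].
move=> H; split=> j jr.
  have /H : j \in undup (r ++ s) by rewrite mem_undup mem_cat jr.
  by rewrite jr => -[].
have /H : j \in undup (r ++ s) by rewrite mem_undup mem_cat jr orbT.
by rewrite jr => -[].
Qed.

Lemma measurable_boxes (A : set J) : @measurable _ (env A) = <<s boxes A >>.
Proof.
apply/seteqP; split.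
  apply: smallest_sub; first exact: smallest_sigma_algebra.
  move=> _ [j Aj [B mB ->]]; apply: sub_sigma_algebra.
  exists [:: j]; first by split => // k; rewrite inE => /eqP ->.
  exists (fun=> B) => //; apply/seteqP; split=> x /=.
    by move=> xB k; rewrite inE => /eqP ->.
  by move=> /(_ j); rewrite inE eqxx; apply.
apply: smallest_sub; first exact: sigma_algebra_measurable.
move=> _ [r [ur rA] [B mB ->]].
rewrite (_ : [set x | _] =
    \bigcap_(j in [set` r]) ((fun x : env A => x j) @^-1` B j)); last first.
  by apply/seteqP; split=> x /=.
apply: fin_bigcap_measurable => // j /= /rA Aj.
by rewrite -[X in measurable X]setTI; exact: measurable_coord.
Qed.

End env.
Arguments env {J} R A.

Section iid.
Context {J : eqType} {R : realType} (nu : set R -> \bar R).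

(** Common law and independence are packed into one product formula on boxes, which is the form that
    uniqueness of measures consumes. Every [X j] is measurable, also outside [A], so that one family
    can be restricted to any smaller index set. *)
Definition iid_on d (T : measurableType d) (P : probability T R)
    (X : J -> T -> R) (A : set J) :=
  (forall j, measurable_fun [set: T] (X j)) /\
  forall (r : seq J) (B : J -> set R), uniq r -> (forall j, j \in r -> A j) ->
    (forall j, measurable (B j)) ->
    P [set w | forall j, j \in r -> B j (X j w)] = (\prod_(j <- r) nu (B j))%E.

Lemma iid_onS d (T : measurableType d) (P : probability T R)
    (X : J -> T -> R) (A B : set J) :
  B `<=` A -> iid_on P X A -> iid_on P X B.
Proof. by move=> BA [mX XE]; split => // r C ur rB mC; apply: XE => // j /rB/BA. Qed.

Lemma measure_env_unique (A : set J) (m1 m2 : {measure set (env R A) -> \bar R}) :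
  (m1 setT < +oo)%E ->
  (forall (r : seq J) (B : J -> set R), uniq r -> (forall j, j \in r -> A j) ->
    (forall j, measurable (B j)) ->
    m1 [set x | forall j, j \in r -> B j (x j)] =
    m2 [set x | forall j, j \in r -> B j (x j)]) ->
  forall S, measurable S -> m1 S = m2 S.
Proof.
move=> m1y m12 S mS.
have E0 : setT = [set x : J -> R | forall j, j \in [::] -> setT (x j)].
  by apply/seteqP; split.
apply: (@measure_unique _ _ (env R A) (boxes A) (fun=> setT)) => //.
- exact: measurable_boxes.
- exact: boxes_setI.
- by move=> _; exists [::] => //; exists (fun=> setT).
- by apply/seteqP; split=> // x _; exists 0%N.
- by move=> _ [r [ur rA] [B mB ->]]; exact: m12.
Qed.

End iid.

Section sample.
Context {J : eqType} {R : realType} d (T : measurableType d).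

(** The measurability proof is an argument so that the canonical structure of measurable function
    below can be attached to [sample]. *)
Definition sample (A : set J) (X : J -> T -> R)
  (mX : forall j, measurable_fun [set: T] (X j)) : T -> env R A := fun w => X ^~ w.

Variables (A : set J) (X : J -> T -> R) (mX : forall j, measurable_fun [set: T] (X j)).

Lemma measurable_sample : measurable_fun [set: T] (sample A mX).
Proof. by apply: measurable_envP => j _; exact: mX. Qed.

HB.instance Definition _ := isMeasurableFun.Build _ _ T (env R A) (sample A mX) measurable_sample.

End sample.
Arguments measurable_sample {J R d T} A {X} mX.

Section iid_theory.
Context {J : eqType} {R : realType} (nu : set R -> \bar R).

Section law.
Context d1 (T1 : measurableType d1) (P1 : probability T1 R).
Context d2 (T2 : measurableType d2) (P2 : probability T2 R).
Variables (X1 : J -> T1 -> R) (X2 : J -> T2 -> R) (A : set J).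
Hypotheses (iX1 : iid_on nu P1 X1 A) (iX2 : iid_on nu P2 X2 A).

Lemma iid_distribution S : measurable S ->
  distribution P1 (sample A iX1.1) S = distribution P2 (sample A iX2.1) S.
Proof.
apply: (@measure_env_unique _ _ A).
  by rewrite /= /distribution /pushforward preimage_setT probability_setT ltry.
move=> r B ur rA mB; transitivity (\prod_(j <- r) nu (B j))%E.
  exact: iX1.2.
by symmetry; exact: iX2.2.
Qed.

Lemma iid_prob (S : set (env R A)) : measurable S ->
  P1 [set w | S (X1 ^~ w)] = P2 [set w | S (X2 ^~ w)].
Proof. exact: iid_distribution. Qed.

Lemma iid_integral (f : env R A -> \bar R) :
  measurable_fun [set: env R A] f -> (forall x, 0 <= f x)%E ->
  (\int[P1]_w f (X1 ^~ w) = \int[P2]_w f (X2 ^~ w))%E.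
Proof.
move=> mf f0.
have := @ge0_integral_distribution _ _ _ _ _ P1 (sample A iX1.1) f mf f0.
have := @ge0_integral_distribution _ _ _ _ _ P2 (sample A iX2.1) f mf f0.
rewrite /comp /sample => <- <-.
by apply: eq_measure_integral => S mS _; exact: iid_distribution.
Qed.

End law.

(** With [F] fixed, both sides are finite measures in [S], so agreement on boxes suffices.
    [iid_indep] uses this twice: a box in [A] is fixed to free the event in [B], then that event is
    fixed to free the one in [A]. *)
Lemma indep_of_boxes d (T : measurableType d) (P : probability T R)
    (X : J -> T -> R) (A : set J) (F : set T) :
  (forall j, measurable_fun [set: T] (X j)) -> measurable F ->
  (forall (r : seq J) (B : J -> set R), uniq r -> (forall j, j \in r -> A j) ->
    (forall j, measurable (B j)) ->
    P (F `&` [set w | forall j, j \in r -> B j (X j w)]) =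
    (P F * P [set w | forall j, j \in r -> B j (X j w)])%E) ->
  forall S : set (env R A), measurable S ->
    P (F `&` [set w | S (X ^~ w)]) = (P F * P [set w | S (X ^~ w)])%E.
Proof.
move=> mX mF box S mS.
have Fge0 : (0 <= fine (P F))%R by apply: fine_ge0; exact: measure_ge0.
pose XA : {mfun T >-> env R A} := sample A mX.
have mXA := measurable_sample A mX.
pose m1 : {measure set (env R A) -> \bar R} :=
  [the measure _ _ of pushforward (mrestr P mF) XA].
pose m2 : {measure set (env R A) -> \bar R} :=
  [the measure _ _ of mscale (NngNum Fge0) (distribution P XA)].
have m2E G : m2 G = (P F * P [set w | G (X ^~ w)])%E.
  by rewrite /m2 /= /mscale /=; congr (_ * _)%E; rewrite fineK// fin_num_measure.
rewrite setIC -m2E; apply: (@measure_env_unique _ _ A (m1 mXA) m2) => //.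
  rewrite /= /pushforward /mrestr preimage_setT setTI.
  by apply: le_lt_trans (probability_le1 _ _) _ => //; rewrite ltry.
by move=> r B ur rA mB; rewrite m2E -box // setIC.
Qed.

Section independence.
Context d (T : measurableType d) (P : probability T R).
Variables (X : J -> T -> R) (A B : set J).
Hypotheses (iX : iid_on nu P X (A `|` B)) (AB : A `&` B = set0).

Let iA : iid_on nu P X A. Proof. by apply: iid_onS iX; left. Qed.
Let iB : iid_on nu P X B. Proof. by apply: iid_onS iX; right. Qed.

Let mA := measurable_sample A iX.1.
Let mB := measurable_sample B iX.1.

Let msetA (S : set (env R A)) : measurable S -> measurable [set w | S (X ^~ w)].
Proof. by move=> mS; rewrite -[X in measurable X]setTI; exact: mA. Qed.
Let msetB (S : set (env R B)) : measurable S -> measurable [set w | S (X ^~ w)].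
Proof. by move=> mS; rewrite -[X in measurable X]setTI; exact: mB. Qed.

Lemma measurable_box (D : set J) (r : seq J) (C : J -> set R) : uniq r ->
  (forall j, j \in r -> D j) -> (forall j, measurable (C j)) ->
  @measurable _ (env R D) [set x | forall j, j \in r -> C j (x j)].
Proof.
by move=> ur rD mC; rewrite measurable_boxes; apply: sub_sigma_algebra; exists r => //; exists C.
Qed.

Lemma iid_indep (S1 : set (env R A)) (S2 : set (env R B)) :
  measurable S1 -> measurable S2 ->
  P [set w | S1 (X ^~ w) /\ S2 (X ^~ w)] =
  (P [set w | S1 (X ^~ w)] * P [set w | S2 (X ^~ w)])%E.
Proof.
have boxbox r1 C1 r2 C2 : uniq r1 -> (forall j, j \in r1 -> A j) ->
    (forall j, measurable (C1 j)) -> uniq r2 -> (forall j, j \in r2 -> B j) ->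
    (forall j, measurable (C2 j)) ->
    P ([set w | forall j, j \in r1 -> C1 j (X j w)] `&`
       [set w | forall j, j \in r2 -> C2 j (X j w)]) =
    (P [set w | forall j, j \in r1 -> C1 j (X j w)] *
     P [set w | forall j, j \in r2 -> C2 j (X j w)])%E.
  move=> u1 A1 m1 u2 B2 m2.
  have dj j : j \in r1 -> j \in r2 -> False.
    by move=> /A1 Aj /B2 Bj; have : (A `&` B) j by []; rewrite AB.
  rewrite (iA.2 _ _ u1 A1 m1) (iB.2 _ _ u2 B2 m2).
  transitivity (\prod_(j <- r1 ++ r2) nu ((fun j => if j \in r1 then C1 j else C2 j) j))%E.
    rewrite -iX.2; first congr (P _).
    - apply/seteqP; split=> w /=.
        move=> [h1 h2] j; rewrite mem_cat; case: ifP => [jr _|jr /= /h2//]; exact: h1.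
      move=> h; split=> j jr.
        by have := h j; rewrite mem_cat jr /=; apply.
      have := h j; rewrite mem_cat jr orbT; case: ifP => [jr1|_]; last exact.
      by case: (dj j jr1 jr).
    - rewrite cat_uniq u1 u2 andbT /=; apply/hasPn => j jr2; apply/negP => jr1.
      exact: (dj j).
    - by move=> j; rewrite mem_cat => /orP[/A1|/B2]; [left|right].
    - by move=> j; case: ifP.
  rewrite big_cat/=; congr (_ * _)%E; apply: eq_big_seq => j jr.
    by rewrite jr.
  by case: ifP => // jr1; case: (dj j jr1 jr).
have step1 r1 C1 (S : set (env R B)) : uniq r1 -> (forall j, j \in r1 -> A j) ->
    (forall j, measurable (C1 j)) -> measurable S ->
    P ([set w | forall j, j \in r1 -> C1 j (X j w)] `&` [set w | S (X ^~ w)]) =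
    (P [set w | forall j, j \in r1 -> C1 j (X j w)] * P [set w | S (X ^~ w)])%E.
  move=> u1 A1 m1; apply: (indep_of_boxes iX.1).
    by apply: (@msetA [set x | forall j, j \in r1 -> C1 j (x j)]); exact: measurable_box.
  by move=> r2 C2 u2 B2 m2; exact: boxbox.
move=> mS1 mS2; rewrite muleC [X in P X](_ : _ = [set w | S2 (X ^~ w)] `&` [set w | S1 (X ^~ w)]); last first.
  by apply/seteqP; split=> w /= [].
apply: (indep_of_boxes iX.1) mS1; first exact: msetB.
by move=> r2 C2 u2 B2 m2; rewrite setIC step1 // muleC.
Qed.

(** By independence the joint law of the two samples is the product of their laws, and Tonelli
    applies. It is used to freeze the outer thirds of a walk while the middle third is
    integrated. *)
Lemma iid_fubini (f : env R A * env R B -> \bar R) :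
  measurable_fun [set: env R A * env R B] f -> (forall x, 0 <= f x)%E ->
  (\int[P]_w f (X ^~ w, X ^~ w) = \int[P]_w \int[P]_w' f (X ^~ w, X ^~ w'))%E.
Proof.
move=> mf f0.
pose XA : {mfun T >-> env R A} := sample A iX.1.
pose XB : {mfun T >-> env R B} := sample B iX.1.
pose XX := fun w => (XA w, XB w).
have mXX : measurable_fun [set: T] XX by apply: measurable_fun_pair.
have := @ge0_integral_pushforward _ _ _ _ _ XX mXX P setT f measurableT mf.
rewrite preimage_setT => <- //.
rewrite (@eq_measure_integral _ _ _ _ (distribution P XA \x distribution P XB)%E); last first.
  move=> S mS _; symmetry; apply: product_measure_unique => // S1 S2 mS1 mS2.
  exact: iid_indep.
rewrite fubini_tonelli1 //.
rewrite ge0_integral_distribution //=.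
- apply: eq_integral => w _; rewrite /fubini_F /=.
  by rewrite (ge0_integral_distribution XB) //; exact: measurableT_comp.
- exact: measurable_fun_fubini_tonelli_F.
- by move=> x; exact: integral_ge0.
Qed.

Lemma iid_integralM (f : env R A -> \bar R) (g : env R B -> \bar R) :
  measurable_fun [set: env R A] f -> measurable_fun [set: env R B] g ->
  (forall x, 0 <= f x)%E -> (forall x, 0 <= g x)%E ->
  (\int[P]_w (f (X ^~ w) * g (X ^~ w)) =
   (\int[P]_w f (X ^~ w)) * (\int[P]_w g (X ^~ w)))%E.
Proof.
move=> mf mg f0 g0.
have := @iid_fubini (fun z => f z.1 * g z.2)%E => ->.
- under eq_integral => w _.
    rewrite /= ge0_integralZl //; last exact: measurableT_comp mg mB.
    over.
  by rewrite ge0_integralZr // ?integral_ge0 //; exact: measurableT_comp mf mA.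
- apply: emeasurable_funM; first exact: measurableT_comp mf measurable_fst.
  exact: measurableT_comp mg measurable_snd.
- by move=> x; exact: mule_ge0.
Qed.

End independence.
End iid_theory.

(** * Change of measure *)

Section density.
Context d (T : measurableType d) {R : realType}.
Import HBNNSimple.

(** The density enters as an identity between set functions rather than as a Radon-Nikodym
    derivative, so that the same lemma serves tilted laws, cascade measures and the normal law.
    Simple functions increasing to [g] reduce it to indicators. *)
Lemma ge0_integral_density (P m : {measure set T -> \bar R}) (f : T -> R)
    (g : T -> \bar R) :
  (forall x, 0 <= f x) -> measurable_fun [set: T] f ->
  (forall A, measurable A -> m A = \int[P]_(x in A) (f x)%:E)%E ->
  measurable_fun [set: T] g -> (forall x, 0 <= g x)%E ->
  (\int[m]_x g x = \int[P]_x (g x * (f x)%:E))%E.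
Proof.
move=> f0 mf mE mg g0.
have mEf : measurable_fun [set: T] (fun x => (f x)%:E) by exact/measurable_EFinP.
pose h := nnsfun_approx measurableT mg.
have hg x : (h n x)%:E @[n --> \oo] --> g x by exact: cvg_nnsfun_approx.
have -> : (\int[m]_x g x = lim (\int[m]_x (h n x)%:E @[n --> \oo]))%E.
  have gE x : g x = lim ((h n x)%:E @[n --> \oo]) by apply/esym/cvg_lim.
  under eq_integral do rewrite gE.
  apply: monotone_convergence => //.
  - by move=> n; apply/measurable_EFinP.
  - by move=> n x _; rewrite lee_fin.
  - by move=> x _ a b ab; rewrite lee_fin; exact/lefP/nd_nnsfun_approx.
have -> : (\int[P]_x (g x * (f x)%:E) =
    lim (\int[P]_x ((h n x)%:E * (f x)%:E) @[n --> \oo]))%E.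
  have gE x : (g x * (f x)%:E = lim ((h n x)%:E * (f x)%:E @[n --> \oo]))%E.
    by apply/esym/cvg_lim => //; exact: cvgeZr.
  under eq_integral do rewrite gE.
  apply: monotone_convergence => //.
  - by move=> n; apply/measurable_EFinP; exact: measurable_funM.
  - by move=> n x _; rewrite lee_fin mulr_ge0.
  - move=> x _ a b ab; rewrite lee_fin ler_wpM2r //; exact/lefP/nd_nnsfun_approx.
suff suf n : (\int[P]_x ((h n x)%:E * (f x)%:E) = \int[m]_x (h n x)%:E)%E.
  by under eq_fun do rewrite -suf.
have indich r : measurable_fun [set: T] (fun x => (r * \1_(h n @^-1` [set r]) x)%:E).
  by apply/measurable_EFinP; exact: measurable_funM.
transitivity (\int[m]_x
   (\sum_(y \in range (h n)) (y * \1_(h n @^-1` [set y]) x)%:E))%E; last first.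
  by apply: eq_integral => t _; rewrite [in RHS]fimfunE -fsumEFin.
rewrite ge0_integral_fsum//; last by move=> r y Ey; exact: nnfun_muleindic_ge0.
transitivity (\int[P]_x (\sum_(y \in range (h n))
    (y * \1_(h n @^-1` [set y]) x)%:E * (f x)%:E))%E.
  under [RHS]eq_integral => x xE.
    rewrite -ge0_mule_fsuml => [|y]; last exact: nnfun_muleindic_ge0.
    rewrite fsumEFin // -(fimfunE _ x); over.
  by [].
rewrite ge0_integral_fsum//; last 2 first.
  - by move=> y; apply: emeasurable_funM.
  - move=> r y _; apply: mule_ge0; last by rewrite lee_fin.
    by rewrite EFinM nnfun_muleindic_ge0.
apply: eq_fsbigr => r rhn.
have mr : measurable (h n @^-1` [set r]) by exact: measurable_sfunP.
have r0 : (0 <= r)%R by move: rhn; rewrite inE => -[x _ <-].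
under eq_integral do rewrite EFinM -muleA.
rewrite ge0_integralZl//; last 2 first.
- by apply: emeasurable_funM => //; exact/measurable_EFinP.
- by move=> x _; rewrite mule_ge0 ?lee_fin.
under [RHS]eq_integral do rewrite EFinM.
rewrite ge0_integralZl//; last exact/measurable_EFinP.
congr (_ * _)%E; rewrite integral_indic// setIT mE//.
rewrite [RHS]integral_mkcond; apply: eq_integral => x _.
by rewrite epatch_indic muleC.
Qed.

End density.

Section density_probability.
Context d (T : measurableType d) {R : realType} (P : probability T R).

Definition density_prob (f : T -> R) (f0 : forall x, 0 <= f x)
    (mf : measurable_fun [set: T] f) (f1 : (\int[P]_x (f x)%:E = 1)%E) (A : set T) : \bar R :=
  (\int[P]_(x in A) (f x)%:E)%E.

Variables (f : T -> R) (f0 : forall x, 0 <= f x).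
Variables (mf : measurable_fun [set: T] f) (f1 : (\int[P]_x (f x)%:E = 1)%E).

Let Q := density_prob f0 mf f1.

Let Q0 : Q set0 = 0%E. Proof. exact: integral_set0. Qed.

Let Q_ge0 A : (0 <= Q A)%E.
Proof. by apply: integral_ge0 => x _; rewrite lee_fin. Qed.

Let Q_sigma_additive : semi_sigma_additive Q.
Proof.
move=> F mF tF mUF; rewrite /Q /density_prob ge0_integral_bigcup//=.
- by apply: is_cvg_ereal_nneg_natsum_cond => k _ _; exact: Q_ge0.
- by apply: measurable_funTS; exact/measurable_EFinP.
- by move=> x _; rewrite lee_fin.
Qed.

HB.instance Definition _ := isMeasure.Build _ _ _ (density_prob f0 mf f1) Q0 Q_ge0
  Q_sigma_additive.

Let Q1 : density_prob f0 mf f1 [set: T] = 1%E. Proof. exact: f1. Qed.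

HB.instance Definition _ := @Measure_isProbability.Build _ _ _ (density_prob f0 mf f1) Q1.

End density_probability.

Section iid_more.
Context {R : realType} (nu : {measure set R -> \bar R}).

Lemma iid_integral1 (J : eqType) d (T : measurableType d) (P : probability T R)
    (X : J -> T -> R) (A : set J) j (f : R -> \bar R) :
  iid_on nu P X A -> A j ->
  measurable_fun [set: R] f -> (forall x, 0 <= f x)%E ->
  (\int[P]_w f (X j w) = \int[nu]_x f x)%E.
Proof.
move=> [mX XE] Aj mf f0.
have := @ge0_integral_pushforward _ _ _ _ _ (X j) (mX j) P setT f measurableT mf.
rewrite preimage_setT /comp => <- //.
apply: eq_measure_integral => S mS _.
have := XE [:: j] (fun=> S) erefl _ (fun=> mS).
rewrite big_seq1 => <-; last by move=> k; rewrite inE => /eqP->.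
congr (P _); apply/seteqP; split=> w /=.
  by move=> ? k; rewrite inE => /eqP->.
by apply; rewrite inE.
Qed.

Lemma iid_reindex (J J' : eqType) d (T : measurableType d) (P : probability T R)
    (X : J -> T -> R) (A : set J) (A' : set J') (phi : J' -> J) :
  iid_on nu P X A -> (forall i, A' i -> A (phi i)) ->
  (forall i j, A' i -> A' j -> phi i = phi j -> i = j) ->
  iid_on nu P (fun i => X (phi i)) A'.
Proof.
move=> [mX XE] AA inj; split=> [j|r B ur rA mB]; first exact: mX.
case: r ur rA => [|i0 r'].
  rewrite big_nil => _ _; rewrite (_ : [set w | _] = setT) ?probability_setT//.
  by apply/seteqP; split.
move: (i0 :: r') => r ur rA.
have injr : {in r &, injective phi} by move=> i j /rA Ai /rA Aj; exact: inj.
(* The inverse of [phi] on [r], obtained by position in the list; the empty list was treated apart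
   because [nth] needs a default element. *)
pose B' j := B (nth i0 r (index j (map phi r))).
have B'E i : i \in r -> B' (phi i) = B i.
  by move=> ir; rewrite /B' nth_index_map.
transitivity (\prod_(j <- map phi r) nu (B' j))%E; last first.
  by rewrite big_map; apply: eq_big_seq => i ir; rewrite B'E.
rewrite -XE.
- congr (P _); apply/seteqP; split=> w /=.
    by move=> H _ /mapP[i ir ->]; rewrite B'E //; exact: H.
  by move=> H i ir; rewrite -(B'E i ir); apply: H; exact: map_f.
- by rewrite map_inj_in_uniq.
- by move=> _ /mapP[i ir ->]; exact/AA/rA.
- by move=> j; exact: mB.
Qed.

Section path.
Context d (T : measurableType d) (P : probability T R) (X : nat -> T -> R).

(** The factors may depend on [k], since [tilt_iid] inserts an indicator at the constrained indices
    only. *)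
Lemma iid_prod N (f : nat -> R -> R) : iid_on nu P X `I_N ->
  (forall k x, 0 <= f k x) -> (forall k, measurable_fun [set: R] (f k)) ->
  (\int[P]_w (\prod_(k < N) f k (X k w))%:E = \prod_(k < N) \int[nu]_x (f k x)%:E)%E.
Proof.
move=> iX f0 mf; elim: N iX => [|N IH] iX.
  rewrite big_ord0; rewrite (eq_integral (cst 1%E)) => [|w _]; last by rewrite big_ord0.
  by rewrite integral_cst// mul1e; exact: probability_setT.
have iXN : iid_on nu P X `I_N by apply: iid_onS iX => k /=; exact: leqW.
have iX' : iid_on nu P X (`I_N `|` [set N]).
  by apply: iid_onS iX => k /= [/leqW//|->].
rewrite big_ord_recr /= -IH// -(@iid_integral1 _ _ _ _ _ _ N (fun x => (f N x)%:E) iX)//=; last 2 first.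
  exact/measurable_EFinP.
  by move=> x; rewrite lee_fin.
under eq_integral do rewrite big_ord_recr/= EFinM.
apply: (@iid_integralM _ _ _ _ _ _ _ `I_N [set N] iX' _
  (fun x => (\prod_(k < N) f k (x k))%:E) (fun x => (f N (x N))%:E)) => //.
- by apply/seteqP; split=> k //= [+ kN]; rewrite kN ltnn.
- apply/measurable_EFinP; apply: measurable_prod => k _.
  by apply: (measurableT_comp (mf k)); apply: measurable_coord => /=.
- apply/measurable_EFinP; apply: (measurableT_comp (mf N)); exact: measurable_coord.
- by move=> x; rewrite lee_fin prodr_ge0.
- by move=> x; rewrite lee_fin.
Qed.

Section tilt.
Variables (N : nat) (g : R -> R).
Hypotheses (g0 : forall x, 0 <= g x) (mg : measurable_fun [set: R] g).
Hypotheses (g1 : (\int[nu]_x (g x)%:E = 1)%E) (iX : iid_on nu P X `I_N).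

Lemma tilt_ge0 w : 0 <= \prod_(k < N) g (X k w).
Proof. exact: prodr_ge0. Qed.

Lemma measurable_tilt : measurable_fun [set: T] (fun w => \prod_(k < N) g (X k w)).
Proof. by apply: measurable_prod => k _; apply: (measurableT_comp mg); exact: iX.1. Qed.

Lemma integral_tilt : (\int[P]_w (\prod_(k < N) g (X k w))%:E = 1)%E.
Proof. by rewrite (iid_prod (f := fun=> g) iX)// big1. Qed.

(** A change of measure on the same space: the variables stay, the probability changes. The density
    is a product over [N] steps, so only these [N] variables acquire the tilted law. *)
Definition tilt := density_prob tilt_ge0 measurable_tilt integral_tilt.

Lemma tilt_iid (nu' : {measure set R -> \bar R}) :
  (forall B, measurable B -> nu' B = \int[nu]_(x in B) (g x)%:E)%E ->
  iid_on nu' tilt X `I_N.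
Proof.
move=> nu'E; split=> [|r B ur rN mB]; first exact: iX.1.
(* Density and box condition are merged into one factor per index, so that the tilted probability of
   a box is an instance of [iid_prod]. *)
pose f k x := g x * (if k \in r then \1_(B k) x else 1).
have mf k : measurable_fun [set: R] (f k).
  apply: measurable_funM => //; case: (k \in r) => //; exact: measurable_indic.
have f0 k x : 0 <= f k x by apply: mulr_ge0 => //; case: ifP.
transitivity (\int[P]_w (\prod_(k < N) f k (X k w))%:E)%E.
  rewrite /tilt /= /density_prob integral_mkcond; apply: eq_integral => w _.
  rewrite big_split /= patchE.
  case: ifPn => [/set_mem/= H|/negP H].
    rewrite [X in _ * X]big1 ?mulr1// => k _; case: ifP => // kr.
    by rewrite indicE mem_set //; exact: H.
  have [k kr kB] : exists2 k, k \in r & ~ B k (X k w).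
    apply: contrapT => H'; apply: H; apply/mem_set => k kr.
    by apply: contrapT => kB; apply: H'; exists k.
  rewrite [X in _ * X](bigD1 (Ordinal (rN k kr)))//= kr indicE memNset//.
  by rewrite mul0r mulr0.
rewrite iid_prod//.
transitivity (\prod_(k < N) (if val k \in r then nu' (B k) else 1))%E.
  apply: eq_bigr => k _; rewrite /f; case: ifP => kr; last first.
    by under eq_integral do rewrite mulr1.
  rewrite nu'E // [RHS]integral_mkcond; apply: eq_integral => x _.
  by rewrite patchE indicE; case: ifP; rewrite ?mulr1 ?mulr0.
rewrite -big_mkcond /= -(big_mkord (fun k => k \in r) (fun k => nu' (B k))) -big_filter.
apply: perm_big; apply: uniq_perm => //; first by rewrite filter_uniq// iota_uniq.
move=> k; rewrite mem_filter mem_index_iota /=.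
by case kr : (k \in r) => //=; rewrite rN.
Qed.

End tilt.
End path.
End iid_more.

(** * Concentration of sums *)

Section trigo_bounds.
Context {R : realType}.
Implicit Types x : R.

Lemma sin_MVT x : 0 < x -> exists2 c, c \in `]0, x[ & sin x = cos c * x.
Proof.
move=> x0; have [|c c0x] := @MVT R (@sin R) (@cos R) 0 x x0.
  by apply: continuous_subspaceT => y; exact: continuous_sin.
by rewrite sin0 !subr0 => E; exists c.
Qed.

Lemma sin_le_id x : 0 <= x -> sin x <= x.
Proof.
rewrite le_eqVlt => /predU1P[<-|x0]; first by rewrite sin0.
by have [c _ ->] := sin_MVT x0; rewrite ler_piMl ?cos_le1//; exact: ltW.
Qed.

Lemma oneBcos x : 1 - cos x = (sin (x / 2) ^+ 2) *+ 2.
Proof.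
have {1}-> : x = (x / 2) *+ 2 by rewrite -mulr_natr divfK.
by rewrite cos_mulr2n cos2sin2; move: (sin (x / 2) ^+ 2) => s; lra.
Qed.

Lemma abs_sin_le x : `|sin x| <= `|x|.
Proof.
wlog x0 : x / 0 <= x.
  move=> H; have [/H//|/ltW x0] := leP 0 x.
  by have := H (- x); rewrite oppr_ge0 => /(_ x0); rewrite sinN !normrN.
rewrite (ger0_norm x0) ler_norml sin_le_id// andbT.
move: x0; rewrite le_eqVlt => /predU1P[<-|x0]; first by rewrite sin0 oppr0.
have [c _ ->] := sin_MVT x0; rewrite -mulN1r ler_wpM2r ?cos_geN1//; exact: ltW.
Qed.

Lemma cos_ge_quadratic x : 1 - x ^+ 2 / 2 <= cos x.
Proof.
rewrite lerBlDr -lerBlDl oneBcos.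
have : sin (x / 2) ^+ 2 <= (x / 2) ^+ 2.
  rewrite -[leLHS]real_normK ?num_real// -[leRHS]real_normK ?num_real//.
  by rewrite lerXn2r ?nnegrE ?abs_sin_le.
by rewrite -mulr_natr; move: (sin _ ^+ 2) => s; lra.
Qed.

Lemma cos_ge_half x : `|x| <= 1 -> 2^-1 <= cos x.
Proof.
move=> x1; apply: le_trans (cos_ge_quadratic x).
have : x ^+ 2 <= 1 by rewrite -[leLHS]real_normK ?num_real// expr_le1.
lra.
Qed.

(** From 1 - cos x = 2 sin^2(x/2) and the bound sin y >= y/2 on [0, 1/2], itself the mean value
    theorem with cos >= 1/2. The constant 1/8 is not sharp. *)
Lemma cos_le_quadratic x : `|x| <= 1 -> cos x <= 1 - x ^+ 2 / 8.
Proof.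
wlog x0 : x / 0 <= x.
  move=> H; have [/H//|/ltW x0] := leP 0 x.
  by have := H (- x); rewrite oppr_ge0 => /(_ x0); rewrite sqrrN cosN normrN.
rewrite ger0_norm// => x1.
rewrite lerBrDr -lerBrDl oneBcos.
have : x / 4 <= sin (x / 2).
  move: x0; rewrite le_eqVlt => /predU1P[<-|x0]; first by rewrite !mul0r sin0.
  have y0 : 0 < x / 2 by lra.
  have [c /[!in_itv]/= /andP[c0 cx] ->] := sin_MVT y0.
  rewrite (_ : x / 4 = 2^-1 * (x / 2)); last by field.
  apply: ler_wpM2r; first exact: ltW.
  by apply: cos_ge_half; rewrite gtr0_norm//; lra.
move=> H; have : (x / 4) ^+ 2 <= sin (x / 2) ^+ 2.
  by rewrite lerXn2r ?nnegrE//; [lra|apply: le_trans H; lra].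
by rewrite -mulr_natr; move: (sin _ ^+ 2) => s; lra.
Qed.

End trigo_bounds.

Section bounded.
Context d (T : measurableType d) {R : realType} (P : probability T R).

Lemma bounded_integrable (f : T -> R) M : measurable_fun [set: T] f ->
  (forall x, `|f x| <= M) -> P.-integrable [set: T] (EFin \o f).
Proof.
move=> mf fM; apply: measurable_bounded_integrable => //.
  by rewrite (@le_lt_trans _ _ 1%E) ?ltry ?probability_le1.
by exists M; split; [exact: num_real|move=> N MN x _ /=; apply: le_trans (fM x) (ltW MN)].
Qed.

Lemma EFin_Rintegral (f : T -> R) : P.-integrable [set: T] (EFin \o f) ->
  (\int[P]_w (f w)%:E)%E = (\int[P]_w f w)%:E.
Proof. by move=> fi; rewrite /Rintegral fineK//; exact: integrable_fin_num. Qed.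

Lemma integral_prob_cst (r : R) : (\int[P]_w r%:E = r%:E)%E.
Proof. by rewrite (integral_cst P measurableT r%:E) [X in (_ * X)%E](probability_setT P) mule1. Qed.

Lemma Rintegral_cst1 (r : R) : \int[P]_w r = r.
Proof. by rewrite /Rintegral integral_prob_cst. Qed.

Lemma ge0_integral_ge_set (f : T -> R) m (A : set T) p : measurable_fun [set: T] f ->
  (forall x, 0 <= f x) -> measurable A -> (p%:E <= P A)%E ->
  (forall x, A x -> m <= f x) -> 0 <= m -> ((p * m)%:E <= \int[P]_w (f w)%:E)%E.
Proof.
move=> mf f0 mA pA mfA m0.
apply: (@le_trans _ _ (m%:E * P A)%E).
  by rewrite mulrC EFinM lee_wpmul2l.
rewrite -integral_cst//.
apply: (@le_trans _ _ (\int[P]_(w in A) (f w)%:E)%E).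
  by apply: ge0_le_integral => //; apply: measurable_funTS; exact/measurable_EFinP.
apply: ge0_subset_integral => //; first exact/measurable_EFinP.
by move=> x _; rewrite lee_fin.
Qed.

Lemma Rintegral_ge_set (f : T -> R) M m (A : set T) p : measurable_fun [set: T] f ->
  (forall x, 0 <= f x <= M) -> measurable A -> (p%:E <= P A)%E ->
  (forall x, A x -> m <= f x) -> 0 <= m -> p * m <= \int[P]_w f w.
Proof.
move=> mf f0M mA pA mfA m0.
have f0 x : 0 <= f x by have /andP[] := f0M x.
rewrite -lee_fin -EFin_Rintegral; first exact: ge0_integral_ge_set mA pA mfA m0.
by apply: (@bounded_integrable _ M) => // x; rewrite ger0_norm; have /andP[] := f0M x.
Qed.

End bounded.

Section bounded_independence.
Context {J : eqType} {R : realType} (nu : {measure set R -> \bar R}).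
Context d (T : measurableType d) (P : probability T R).
Variables (X : J -> T -> R) (A B : set J).
Hypotheses (iX : iid_on nu P X (A `|` B)) (AB : A `&` B = set0).

(** [iid_integralM] handles nonnegative functions only, while cosines and sines change sign. Adding
    1 to both functions makes them nonnegative, and expanding (f + 1)(g + 1) leaves the wanted
    identity. *)
Lemma iid_RintegralM (f : env R A -> R) (g : env R B -> R) :
  measurable_fun [set: env R A] f -> measurable_fun [set: env R B] g ->
  (forall x, `|f x| <= 1) -> (forall x, `|g x| <= 1) ->
  \int[P]_w (f (X ^~ w) * g (X ^~ w)) =
  (\int[P]_w f (X ^~ w)) * (\int[P]_w g (X ^~ w)).
Proof.
move=> mf mg f1 g1.
have mfX : measurable_fun [set: T] (fun w => f (X ^~ w)).
  exact: (measurableT_comp mf (measurable_sample A iX.1)).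
have mgX : measurable_fun [set: T] (fun w => g (X ^~ w)).
  exact: (measurableT_comp mg (measurable_sample B iX.1)).
have fi : P.-integrable [set: T] (EFin \o (fun w => f (X ^~ w))) by exact: (@bounded_integrable _ _ _ _ _ 1).
have gi : P.-integrable [set: T] (EFin \o (fun w => g (X ^~ w))) by exact: (@bounded_integrable _ _ _ _ _ 1).
have c1 : P.-integrable [set: T] (EFin \o (fun w => 1 : R)).
  by apply: (@bounded_integrable _ _ _ _ _ 1) => // _; rewrite normr1.
have fgi : P.-integrable [set: T] (EFin \o (fun w => f (X ^~ w) * g (X ^~ w))).
  apply: (@bounded_integrable _ _ _ _ _ 1); first exact: measurable_funM.
  by move=> x; rewrite normrM mulr_ile1.
have p0 (h : R) : `|h| <= 1 -> 0 <= h + 1 by rewrite ler_norml => /andP[]; lra.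
have H (h : T -> R) : P.-integrable [set: T] (EFin \o h) ->
    (\int[P]_w (h w + 1)%:E = ((\int[P]_w h w) + 1)%:E)%E.
  move=> hi; have i1 := integrableD measurableT hi c1.
  by rewrite EFin_Rintegral// RintegralD// Rintegral_cst1.
have : (\int[P]_w ((f (X ^~ w) + 1)%:E * (g (X ^~ w) + 1)%:E) =
   (\int[P]_w (f (X ^~ w) + 1)%:E) * (\int[P]_w (g (X ^~ w) + 1)%:E))%E.
  apply: (@iid_integralM _ _ nu _ _ _ X A B iX AB (fun x => (f x + 1)%:E) (fun x => (g x + 1)%:E)).
  - by apply/measurable_EFinP; exact: measurable_funD.
  - by apply/measurable_EFinP; exact: measurable_funD.
  - by move=> x; rewrite lee_fin p0.
  - by move=> x; rewrite lee_fin p0.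
have -> : (\int[P]_w ((f (X ^~ w) + 1)%:E * (g (X ^~ w) + 1)%:E) =
   ((\int[P]_w (f (X ^~ w) * g (X ^~ w))) + (\int[P]_w f (X ^~ w)) +
     (\int[P]_w g (X ^~ w)) + 1)%:E)%E.
  transitivity (\int[P]_w ((f (X ^~ w) * g (X ^~ w)) + f (X ^~ w) + g (X ^~ w) + 1)%:E)%E.
    by apply: eq_integral => w _; rewrite -EFinM; congr EFin; ring.
  have i1 := integrableD measurableT fgi fi.
  have i2 := integrableD measurableT i1 gi.
  have i3 := integrableD measurableT i2 c1.
  by rewrite EFin_Rintegral// !RintegralD// Rintegral_cst1.
rewrite !H// -EFinM => -[].
set u := Rintegral _ _ _; set v := Rintegral _ _ _; set x := Rintegral _ _ _.
lra.
Qed.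

End bounded_independence.

(** * Characteristic functions in real form *)

Section charfun.
Context {R : realType} (nu : probability R R).

Lemma measurable_cos : measurable_fun [set: R] (@cos R).
Proof. apply: continuous_measurable_fun => x; exact: continuous_cos. Qed.

Lemma measurable_sin : measurable_fun [set: R] (@sin R).
Proof. apply: continuous_measurable_fun => x; exact: continuous_sin. Qed.

Lemma measurable_expRM (s : R) : measurable_fun [set: R] (fun x : R => expR (s * x)).
Proof. by apply: (measurableT_comp (@measurable_expR R)); exact: measurable_funM. Qed.

Lemma Rintegral_iid1 (J : eqType) d (T : measurableType d) (P : probability T R)
    (X : J -> T -> R) (A : set J) (j : J) (g : R -> R) :
  iid_on nu P X A -> A j -> measurable_fun [set: R] g -> (forall x, `|g x| <= 1) ->
  \int[P]_w g (X j w) = \int[nu]_x g x.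
Proof.
move=> iX Aj mg g1.
have mXg : measurable_fun [set: T] (fun w => g (X j w)).
  exact: measurableT_comp mg (iX.1 j).
have c1 d' (T' : measurableType d') (P' : probability T' R) :
    P'.-integrable [set: T'] (EFin \o (fun w => 1 : R)).
  by apply: (@bounded_integrable _ _ _ _ _ 1) => // _; rewrite normr1.
have i1 : P.-integrable [set: T] (EFin \o (fun w => g (X j w))).
  by apply: (@bounded_integrable _ _ _ _ _ 1).
have i2 : nu.-integrable [set: R] (EFin \o g) by apply: (@bounded_integrable _ _ _ _ _ 1).
suff : \int[P]_w (g (X j w) + 1) = \int[nu]_x (g x + 1).
  by rewrite (RintegralD measurableT i1 (c1 _ _ P)) (RintegralD measurableT i2 (c1 _ _ nu)) !Rintegral_cst1 => /addIr.
rewrite /Rintegral; congr fine.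
apply: (iid_integral1 (f := fun x => (g x + 1)%:E) iX Aj).
  by apply/measurable_EFinP; exact: measurable_funD.
by move=> x; rewrite lee_fin; have := g1 x; rewrite ler_norml => /andP[]; lra.
Qed.

(* The squared modulus of the characteristic function of nu. *)
Definition charfun2 t := (\int[nu]_x cos (t * x)) ^+ 2 + (\int[nu]_x sin (t * x)) ^+ 2.

(** The squared modulus of E e^{i(tS + th)} is multiplicative over independent steps and does not
    see the phase [th]; [concentration] puts its shift [a] into that phase. *)
Lemma charfun2_sum n d (T : measurableType d) (P : probability T R) (X : nat -> T -> R) t th :
  iid_on nu P X `I_n ->
  (\int[P]_w cos (t * (\sum_(i < n) X i w) + th)) ^+ 2 +
  (\int[P]_w sin (t * (\sum_(i < n) X i w) + th)) ^+ 2 = charfun2 t ^+ n.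
Proof.
elim: n => [|n IH] iX.
  under eq_Rintegral do rewrite big_ord0 mulr0 add0r.
  under [X in _ + X ^+ 2]eq_Rintegral do rewrite big_ord0 mulr0 add0r.
  by rewrite !Rintegral_cst1 cos2Dsin2.
have iXn : iid_on nu P X `I_n by apply: iid_onS iX => k /=; exact: leqW.
have iX' : iid_on nu P X (`I_n `|` [set n]).
  by apply: iid_onS iX => k /= [/leqW//|->].
have nn : `I_n `&` [set n] = set0.
  by apply/seteqP; split=> k //= [+ kN]; rewrite kN ltnn.
pose S (x : nat -> R) := t * (\sum_(i < n) x i) + th.
have mS : measurable_fun [set: env R `I_n] S.
  apply: measurable_funD => //; apply: measurable_funM => //.
  by apply: measurable_sum => i; apply: measurable_coord => /=.
have mX : measurable_fun [set: env R [set n]] (fun x : env R [set n] => t * x n).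
  by apply: measurable_funM => //; apply: measurable_coord.
have ind (f g : R -> R) : measurable_fun [set: R] f -> measurable_fun [set: R] g ->
    (forall x, `|f x| <= 1) -> (forall x, `|g x| <= 1) ->
    \int[P]_w (f (S (X ^~ w)) * g (t * X n w)) =
    (\int[P]_w f (S (X ^~ w))) * (\int[nu]_x g (t * x)).
  move=> mf mg f1 g1.
  rewrite (iid_RintegralM iX' nn (f := fun x => f (S x)) (g := fun x => g (t * x n))) //.
  - congr (_ * _); rewrite (Rintegral_iid1 (g := fun x => g (t * x)) iX) //=.
    by apply: (measurableT_comp mg); exact: measurable_funM.
  - exact: measurableT_comp mf mS.
  - exact: measurableT_comp mg mX.
have c1 (x : R) : `|cos x| <= 1 by rewrite ler_norml cos_geN1 cos_le1.
have s1 (x : R) : `|sin x| <= 1 by rewrite ler_norml sin_geN1 sin_le1.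
have mST : measurable_fun [set: T] (fun w => S (X ^~ w)).
  exact: (measurableT_comp mS (measurable_sample _ iX.1)).
have mXT : measurable_fun [set: T] (fun w => t * X n w).
  by apply: measurable_funM => //; exact: iX.1.
have it (f g : R -> R) : measurable_fun [set: R] f -> measurable_fun [set: R] g ->
    (forall x, `|f x| <= 1) -> (forall x, `|g x| <= 1) ->
    P.-integrable [set: T] (EFin \o (fun w => f (S (X ^~ w)) * g (t * X n w))).
  move=> mf mg f1 g1; apply: (@bounded_integrable _ _ _ _ _ 1).
    by apply: measurable_funM; [exact: measurableT_comp mf mST|exact: measurableT_comp mg mXT].
  by move=> x; rewrite normrM mulr_ile1.
have SE w : t * (\sum_(i < n.+1) X i w) + th = S (X ^~ w) + t * X n w.
  by rewrite big_ord_recr /S /= mulrDr; ring.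
under eq_Rintegral do rewrite SE cosD.
under [X in _ + X ^+ 2]eq_Rintegral do rewrite SE sinD.
have mc := measurable_cos; have ms := measurable_sin.
rewrite RintegralB//; try exact: it.
rewrite RintegralD//; try exact: it.
rewrite !ind// [RHS]exprSr -IH// /charfun2 /S.
set a := Rintegral _ _ _; set b := Rintegral _ _ _; set u := Rintegral _ _ _; set v := Rintegral _ _ _.
ring.
Qed.

Lemma charfun2_ge0 t : 0 <= charfun2 t.
Proof. by rewrite addr_ge0// sqr_ge0. Qed.

(** Symmetrization: one minus the squared modulus is the mean of 1 - cos(t(x - y)) for independent x
    and y of law [nu]. With probability at least p^2, x lies in [c, B] and y in [-B, -c]; then 2c <=
    x - y <= 2B, and |t| 2B <= 1 allows [cos_le_quadratic]. *)
Lemma charfun2_le (c B p t : R) : 0 < c -> c <= B -> 0 < p ->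
  (p%:E <= nu `[c, B]%classic)%E -> (p%:E <= nu `[(- B)%R, (- c)%R]%classic)%E -> `|t| * (2 * B) <= 1 ->
  charfun2 t <= 1 - p ^+ 2 * c ^+ 2 / 2 * t ^+ 2.
Proof.
move=> c0 cB p0 pr pl tB.
have mc := measurable_cos; have ms := measurable_sin.
have c1 (x : R) : `|cos x| <= 1 by rewrite ler_norml cos_geN1 cos_le1.
have s1 (x : R) : `|sin x| <= 1 by rewrite ler_norml sin_geN1 sin_le1.
have mt (f : R -> R) : measurable_fun [set: R] f -> measurable_fun [set: R] (fun x => f (t * x)).
  by move=> mf; apply: (measurableT_comp mf); exact: measurable_funM.
have ic : nu.-integrable [set: R] (EFin \o (fun x => cos (t * x))).
  by apply: (@bounded_integrable _ _ _ _ _ 1) => //; exact: (mt _ mc).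
have is_ : nu.-integrable [set: R] (EFin \o (fun x => sin (t * x))).
  by apply: (@bounded_integrable _ _ _ _ _ 1) => //; exact: (mt _ ms).
have i1 : nu.-integrable [set: R] (EFin \o (fun w => 1 : R)).
  by apply: (@bounded_integrable _ _ _ _ _ 1) => // _; rewrite normr1.
have lin a b : \int[nu]_y (1 - (a * cos (t * y) + b * sin (t * y))) =
   1 - (a * (\int[nu]_y cos (t * y)) + b * (\int[nu]_y sin (t * y))).
  have iac : nu.-integrable [set: R] (EFin \o (fun x => a * cos (t * x))).
    by have := integrableZl measurableT a ic.
  have ibs : nu.-integrable [set: R] (EFin \o (fun x => b * sin (t * x))).
    by have := integrableZl measurableT b is_.
  have iab := integrableD measurableT iac ibs.
  by rewrite RintegralB// RintegralD// !RintegralZl// Rintegral_cst1.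
set C := \int[nu]_x cos (t * x); set S := \int[nu]_x sin (t * x).
have hE x : 1 - (C * cos (t * x) + S * sin (t * x)) = \int[nu]_y (1 - cos (t * x - t * y)).
  transitivity (\int[nu]_y (1 - (cos (t * x) * cos (t * y) + sin (t * x) * sin (t * y)))).
    by rewrite lin -/C -/S; ring.
  apply: eq_Rintegral => y _; rewrite cosB; ring.
have tc0 (x : R) : 0 <= 1 - cos x <= 2.
  by have := cos_le1 x; have := cos_geN1 x; lra.
have mB y : measurable_fun [set: R] (fun x => 1 - cos (t * y - t * x)).
  apply: measurable_funB => //; apply: (measurableT_comp mc).
  by apply: measurable_funB => //; exact: measurable_funM.
have h0 x : 0 <= 1 - (C * cos (t * x) + S * sin (t * x)).
  by rewrite hE; apply: Rintegral_ge0 => y _; have /andP[] := tc0 (t * x - t * y).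
have CS (f : R -> R) : measurable_fun [set: R] f -> (forall x, `|f x| <= 1) -> `|\int[nu]_x f x| <= 1.
  move=> mf f1; have fi : nu.-integrable [set: R] (EFin \o f) by exact: (@bounded_integrable _ _ _ _ _ 1).
  apply: le_trans (le_normr_Rintegral _ _) _ => //.
  rewrite -[leRHS](Rintegral_cst1 nu 1); apply: le_Rintegral => //.
  by apply: (@bounded_integrable _ _ _ _ _ 1) => [|x]; [exact: measurableT_comp|rewrite normr_id].
have C1 : `|C| <= 1 by apply: CS => //; exact: mt.
have S1 : `|S| <= 1 by apply: CS => //; exact: mt.
have h3 x : 1 - (C * cos (t * x) + S * sin (t * x)) <= 3.
  have : `|C * cos (t * x)| <= 1 by rewrite normrM mulr_ile1.
  have : `|S * sin (t * x)| <= 1 by rewrite normrM mulr_ile1.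
  by rewrite !ler_norml => /andP[? ?] /andP[? ?]; lra.
have key : p * (p * ((2 * c * t) ^+ 2 / 8)) <= 1 - charfun2 t.
  have -> : 1 - charfun2 t = \int[nu]_x (1 - (C * cos (t * x) + S * sin (t * x))).
    by rewrite lin -/C -/S /charfun2 -/C -/S; ring.
  apply: (@Rintegral_ge_set _ _ _ _ _ 3 _ `[c, B]%classic) => //.
  - apply: measurable_funB => //; apply: measurable_funD; apply: measurable_funM => //; exact: mt.
  - by move=> x; rewrite h0 h3.
  - move=> x /=; rewrite in_itv/= => /andP[cx xB]; rewrite hE.
    apply: (@Rintegral_ge_set _ _ _ _ _ 2 _ `[- B, - c]%classic) => //.
    + move=> y /=; rewrite in_itv/= => /andP[By yc].
      rewrite -mulrBr lerBrDl -lerBrDr.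
      have xy : 2 * c <= x - y <= 2 * B by lra.
      apply: le_trans (cos_le_quadratic _) _.
        rewrite normrM; apply: le_trans tB; apply: ler_wpM2l => //.
        by rewrite ger0_norm; lra.
      rewrite lerD2l lerN2 ler_wpM2r// ?invr_ge0//.
      rewrite !exprMn [leRHS]mulrC ler_wpM2r ?sqr_ge0//.
      by rewrite -exprMn lerXn2r ?nnegrE; lra.
    + by rewrite divr_ge0 ?sqr_ge0.
  - by rewrite mulr_ge0 ?divr_ge0 ?sqr_ge0 ?ltW.
have -> : p ^+ 2 * c ^+ 2 / 2 * t ^+ 2 = p * (p * ((2 * c * t) ^+ 2 / 8)) by field.
lra.
Qed.

End charfun.

Section geometric.
Context {R : realType}.
Variable q : R.
Hypotheses (q0 : 0 <= q) (q1 : q < 1).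

Lemma geometric_sum_le m : \sum_(i < m) q ^+ i <= (1 - q)^-1.
Proof.
have Hq : 0 < 1 - q by rewrite subr_gt0.
have H : (1 - q) * (\sum_(i < m) q ^+ i) = 1 - q ^+ m.
  elim: m => [|m IH]; first by rewrite big_ord0 mulr0 expr0 subrr.
  rewrite big_ord_recr/= mulrDr IH exprS; ring.
rewrite -(ler_pM2l Hq) divff ?gt_eqF// H lerBlDr lerDl; exact: exprn_ge0.
Qed.

(** With truncated subtraction the exponent is |j - k|: this is a two-sided geometric series around
    [j]. *)
Lemma geometric_sum_abs_le (M j : nat) :
  \sum_(k < M) q ^+ (j - k + (k - j)) <= 2 / (1 - q).
Proof.
have : \sum_(k < M) q ^+ (j - k + (k - j)) <= \sum_(i < j.+1) q ^+ i + (1 - q)^-1.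
  elim: M j => [|M IH] [|j].
  - by rewrite big_ord0 addr_ge0 ?sumr_ge0 ?invr_ge0 ?subr_ge0 ?(ltW q1)// => i _; exact: exprn_ge0.
  - by rewrite big_ord0 addr_ge0 ?sumr_ge0 ?invr_ge0 ?subr_ge0 ?(ltW q1)// => i _; exact: exprn_ge0.
  - under eq_bigr do rewrite sub0n add0n subn0.
    by rewrite ler_wpDl ?geometric_sum_le ?sumr_ge0// => i _; exact: exprn_ge0.
  - rewrite big_ord_recl/= subn0 sub0n addn0 big_ord_recr/= addrAC [leRHS]addrC lerD2l.
    by apply: le_trans (IH j); apply: ler_sum => i _.
move=> /le_trans; apply; rewrite mulrDl mul1r lerD2r; exact: geometric_sum_le.
Qed.

End geometric.

Section concentration.
Context {R : realType} (nu : probability R R).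

Lemma Rintegral_sum d (T : measurableType d) (P : {measure set T -> \bar R})
    (I : Type) (r : seq I) (f : I -> T -> R) :
  (forall i, P.-integrable [set: T] (EFin \o f i)) ->
  \int[P]_w (\sum_(i <- r) f i w) = \sum_(i <- r) \int[P]_w f i w.
Proof.
move=> fi; elim: r => [|i r IH].
  under eq_Rintegral do rewrite big_nil.
  by rewrite big_nil /Rintegral integral0.
under eq_Rintegral do rewrite big_cons.
rewrite big_cons RintegralD// ?IH//.
have := @integrable_sum _ _ _ P _ measurableT _ r xpredT (fun i => EFin \o f i) (fun i _ => fi i).
by apply: eq_integrable => // w _; rewrite /= sumEFin.
Qed.

(** The squared modulus of the sum of e^{i j tau x} over j < M, that is, M times a Fejer kernel:
    nonnegative, of order M^2 near 0, and built from frequencies of size less than M tau. *)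
Definition fejer (M : nat) (tau x : R) : R :=
  \sum_(j < M) \sum_(k < M) cos ((j%:R - k%:R) * tau * x).

Lemma fejerE M tau x : fejer M tau x =
  (\sum_(j < M) cos (j%:R * tau * x)) ^+ 2 + (\sum_(j < M) sin (j%:R * tau * x)) ^+ 2.
Proof.
rewrite !expr2 !big_distrlr/= -big_split/=; apply: eq_bigr => j _.
rewrite -big_split/=; apply: eq_bigr => k _.
by rewrite -cosB; congr cos; ring.
Qed.

Lemma fejer_ge0 M tau x : 0 <= fejer M tau x.
Proof. by rewrite fejerE addr_ge0// sqr_ge0. Qed.

Lemma sum2_const (M : nat) (x : R) : \sum_(j < M) \sum_(k < M) x = M%:R ^+ 2 * x.
Proof.
under eq_bigr do rewrite sumr_const card_ord -(mulr_natl x M).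
by rewrite sumr_const card_ord -(mulr_natl (M%:R * x) M) expr2 mulrA.
Qed.

Lemma fejer_le M tau x : fejer M tau x <= M%:R ^+ 2.
Proof.
apply: (@le_trans _ _ (\sum_(j < M) \sum_(k < M) 1)).
  by apply: ler_sum => j _; apply: ler_sum => k _; exact: cos_le1.
by rewrite sum2_const mulr1.
Qed.

Lemma fejer_ge M tau x : `|M%:R * tau * x| <= 1 -> M%:R ^+ 2 / 2 <= fejer M tau x.
Proof.
move=> H; apply: (@le_trans _ _ (\sum_(j < M) \sum_(k < M) 2^-1)); last first.
  apply: ler_sum => j _; apply: ler_sum => k _; apply: cos_ge_half; apply: le_trans H.
  rewrite -!mulrA normrM [leRHS]normrM; apply: ler_wpM2r => //.
  rewrite [leRHS]ger0_norm// ler_norml.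
  have : (j%:R : R) <= M%:R by rewrite ler_nat ltnW.
  have : (k%:R : R) <= M%:R by rewrite ler_nat ltnW.
  have : (0:R) <= j%:R by []. have : (0:R) <= k%:R by []. lra.
by rewrite sum2_const.
Qed.

Lemma natr_abs_sub (j k : nat) : (j%:R - k%:R : R) ^+ 2 = ((j - k + (k - j))%N)%:R ^+ 2.
Proof.
have [jk|/ltnW kj] := leqP j k.
  have /eqP -> : (j - k)%N == 0%N by rewrite subn_eq0.
  by rewrite add0n natrB// -sqrrN opprB.
have /eqP -> : (k - j)%N == 0%N by rewrite subn_eq0.
by rewrite addn0 natrB.
Qed.

Lemma nat_sqrt (n : nat) : (0 < n)%N ->
  exists2 M : nat, (0 < M)%N & M%:R <= Num.sqrt (n%:R : R) <= 2 * M%:R.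
Proof.
move=> n0; have ex : exists m, (m ^ 2 <= n)%N by exists 0%N.
have ub m : (m ^ 2 <= n)%N -> (m <= n)%N.
  by move=> /(leq_trans _); apply; case: m => // m; rewrite -mulnn leq_pmulr.
case: (ex_maxnP ex ub) => M Mn Mmax; exists M.
  by apply: Mmax.
have M1 : (1 <= M)%N by apply: Mmax.
have nM : (n <= (2 * M) ^ 2)%N.
  have : (n < M.+1 ^ 2)%N by rewrite ltnNge; apply/negP => /Mmax; rewrite ltnn.
  move=> /ltnW/leq_trans; apply; rewrite leq_exp2r// mul2n -addnn -addn1 leq_add2l//.
have s0 : 0 <= Num.sqrt (n%:R : R) by exact: sqrtr_ge0.
apply/andP; split.
  by rewrite -(@ler_pXn2r _ 2) ?nnegrE// sqr_sqrtr// -natrX ler_nat.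
by rewrite -(@ler_pXn2r _ 2) ?nnegrE// sqr_sqrtr// -natrM -natrX ler_nat.
Qed.

Variables (c B p : R).
Hypotheses (c0 : 0 < c) (cB : c <= B) (p0 : 0 < p).
Hypothesis nu_right : (p%:E <= nu `[c, B]%classic)%E.
Hypothesis nu_left : (p%:E <= nu `[(- B)%R, (- c)%R]%classic)%E.

(** [kappa] is the quadratic decay rate of [charfun2_le] and [t1] bounds the frequencies at which it
    is used. [C] is chosen so that C l^2 = 16 / lam for the rate [lam] of the next proof. *)
Let kappa := p ^+ 2 * c ^+ 2 / 2.
Let t1 := (1 + 2 * B)^-1.
Let C := 32 / (kappa * t1 ^+ 2).

Lemma concentration_const_gt0 : 0 < C.
Proof.
have B0 : 0 < B by exact: lt_le_trans cB.
by rewrite divr_gt0// mulr_gt0 ?divr_gt0 ?mulr_gt0 ?exprn_gt0 ?invr_gt0//; lra.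
Qed.

(** Esseen's method with a discrete kernel. On the event the kernel is at least M^2/2, while its
    mean is a double sum of terms at most q^{|j-k|}, hence of order M / lam. So the probability is
    of order 1 / (lam M), with M of order sqrt n. *)
Lemma concentration n l d (T : measurableType d) (P : probability T R)
    (X : nat -> T -> R) (a : R) : (0 < n)%N -> 1 <= l -> iid_on nu P X `I_n ->
  (P [set w | (`|\sum_(i < n) X i w + a| <= l)%R] <= (C * l ^+ 2 / Num.sqrt n%:R)%:E)%E.
Proof.
move=> n0 l1 iX.
have B0 : 0 < B by exact: lt_le_trans cB.
have k0 : 0 < kappa by rewrite divr_gt0// mulr_gt0 ?exprn_gt0.
have t10 : 0 < t1 by rewrite invr_gt0; lra.
have t11 : t1 <= 1 by rewrite invf_le1; lra.
have t1B : t1 * (2 * B) <= 1 by rewrite mulrC ler_pdivrMr; lra.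
have l0 : 0 < l by lra.
have p1 : p <= 1.
  by have := le_trans nu_right (probability_le1 nu (measurable_itv _)); rewrite lee_fin.
have [M M0 /andP[Mn nM]] := nat_sqrt n0.
have M0' : 0 < M%:R :> R by rewrite ltr0n.
(* All differences of frequencies stay below t1 / l, where [charfun2_le] applies; and |M tau S| <= 1
   as soon as |S| <= l, which is what [fejer_ge] asks. *)
pose tau := t1 / l / M%:R.
have tau0 : 0 < tau by rewrite !divr_gt0.
pose lam := kappa * t1 ^+ 2 / (2 * l ^+ 2).
have lam0 : 0 < lam by rewrite divr_gt0 ?mulr_gt0 ?exprn_gt0.
have lam1 : lam <= 1.
  rewrite ler_pdivrMr ?mulr_gt0 ?exprn_gt0// mul1r.
  have -> : kappa * t1 ^+ 2 = p ^+ 2 * (c * t1) ^+ 2 / 2 by rewrite /kappa; field.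
  have ct1 : (c * t1) ^+ 2 <= 1.
    rewrite expr_le1 ?mulr_ge0 ?(ltW c0) ?(ltW t10)//.
    apply: le_trans t1B; rewrite [c * t1]mulrC; apply: ler_wpM2l; first exact: ltW.
    by apply: le_trans cB _; rewrite ler_peMl ?ler1n// ltW.
  have p21 : p ^+ 2 <= 1 by rewrite expr_le1// ltW.
  have : p ^+ 2 * (c * t1) ^+ 2 <= 1 by rewrite mulr_ile1 ?sqr_ge0.
  have : 1 <= l ^+ 2 by rewrite expr_ge1// ltW.
  lra.
pose q := expR (- lam).
have q0 : 0 <= q by exact: expR_ge0.
have q1 : q < 1 by rewrite expR_lt1 oppr_lt0.
(* Since lam <= 1, 1 - e^{-lam} >= lam / (1 + lam) >= lam / 2. *)
have qlam : 2 / (1 - q) <= 4 / lam.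
  have H : q * (1 + lam) <= 1.
    rewrite /q expRN mulrC ler_pdivrMr ?expR_gt0// mul1r; exact: expR_ge1Dx.
  have q01 : 0 < 1 - q by rewrite subr_gt0.
  rewrite ler_pdivrMr// mulrAC ler_pdivlMr//; nra.
pose S w := \sum_(i < n) X i w + a.
have mS : measurable_fun [set: T] S.
  by apply: measurable_funD => //; apply: measurable_sum => i; exact: iX.1.
set E := [set w | _].
have mE : measurable E.
  rewrite (_ : E = S @^-1` `[- l, l]); last first.
    by rewrite /E; apply/seteqP; split=> w /=; rewrite in_itv/= ler_norml.
  by rewrite -[X in measurable X]setTI; apply: mS => //; exact: measurable_itv.
have mcos (t : R) : measurable_fun [set: T] (fun w => cos (t * S w)).
  by apply: (measurableT_comp measurable_cos); exact: measurable_funM.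
have icos (t : R) : P.-integrable [set: T] (EFin \o (fun w => cos (t * S w))).
  by apply: (@bounded_integrable _ _ _ _ _ 1) => // x; rewrite ler_norml cos_geN1 cos_le1.
(* The square of the integral is at most e^{-kappa t^2 n}. As M^2 <= n, the exponent is at least 2
   lam d^2 with d = |j - k|, and d <= d^2 for integers turns the Gaussian decay into a geometric
   one. *)
have Ecos (j k : 'I_M) : \int[P]_w cos ((j%:R - k%:R) * tau * S w) <= q ^+ (j - k + (k - j)).
  set t := (j%:R - k%:R) * tau.
  under eq_Rintegral do rewrite mulrDr.
  set I := (Rintegral _ _ _).
  have tM : `|t| <= t1 / l.
    rewrite normrM (gtr0_norm tau0) /tau mulrCA ler_piMr ?divr_ge0 ?(ltW t10) ?(ltW l0)//.
    rewrite ler_pdivrMr// mul1r ler_norml.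
    have : (j%:R : R) <= M%:R by rewrite ler_nat ltnW.
    have : (k%:R : R) <= M%:R by rewrite ler_nat ltnW.
    have : (0:R) <= j%:R by []. have : (0:R) <= k%:R by []. lra.
  have tB : `|t| * (2 * B) <= 1.
    apply: le_trans t1B; apply: ler_wpM2r; first lra.
    by apply: le_trans tM _; rewrite ler_pdivrMr// ler_peMr// ltW.
  have cf := charfun2_le c0 cB p0 nu_right nu_left tB.
  have I2 : I ^+ 2 <= expR (- kappa * t ^+ 2) ^+ n.
    apply: (@le_trans _ _ (charfun2 nu t ^+ n)).
      by rewrite -(charfun2_sum t (t * a) iX) lerDl sqr_ge0.
    rewrite lerXn2r ?nnegrE ?charfun2_ge0 ?expR_ge0//.
    by apply: le_trans cf _; apply: le_trans (expR_ge1Dx _); rewrite mulNr.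
  have qd0 : 0 <= q ^+ (j - k + (k - j)) by exact: exprn_ge0.
  apply: le_trans (ler_norm I) _.
  rewrite -(@ler_pXn2r _ 2) ?nnegrE// real_normK ?num_real//; apply: le_trans I2 _.
  rewrite -exprM -!expRM_natl ler_expR.
  set dd := (j - k + (k - j))%N.
  have t2 : t ^+ 2 = dd%:R ^+ 2 * (t1 / l) ^+ 2 / M%:R ^+ 2.
    by rewrite /t exprMn natr_abs_sub -/dd /tau; field; rewrite !gt_eqF.
  have nM2 : M%:R ^+ 2 <= (n%:R : R).
    rewrite -[leRHS]sqr_sqrtr// lerXn2r ?nnegrE ?sqrtr_ge0//.
  have dd2 : (dd%:R : R) <= dd%:R ^+ 2 by rewrite -natrX ler_nat; case: (dd) => // m; rewrite -mulnn leq_pmulr.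
  have lamE : kappa * (t1 / l) ^+ 2 = 2 * lam by rewrite /lam; field; rewrite gt_eqF.
  rewrite natrM.
  have : 2 * lam * dd%:R <= kappa * t ^+ 2 * n%:R.
    rewrite t2 (_ : _ * n%:R = (kappa * (t1 / l) ^+ 2) * (dd%:R ^+ 2 * (n%:R / M%:R ^+ 2))); last first.
      by field; rewrite !gt_eqF.
    rewrite lamE; apply: ler_wpM2l; first by rewrite mulr_ge0 ?(ltW lam0).
    apply: le_trans dd2 _.
    by rewrite ler_peMr ?sqr_ge0// ler_pdivlMr ?exprn_gt0// mul1r.
  lra.
have Ef : \int[P]_w fejer M tau (S w) <= M%:R * (4 / lam).
  rewrite /fejer Rintegral_sum => [|i]; last first.
    have := @integrable_sum _ _ _ P _ measurableT _ (index_enum 'I_M) xpredT (fun k => EFin \o (fun w => cos ((i%:R - k%:R) * tau * S w))) (fun k _ => icos _).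
    by apply: eq_integrable => // w _; rewrite /= sumEFin.
  apply: (@le_trans _ _ (\sum_(j < M) (4 / lam))); last first.
    by rewrite sumr_const card_ord -(mulr_natl (4 / lam) M).
  apply: ler_sum => j _; rewrite Rintegral_sum//.
  apply: le_trans qlam; apply: le_trans (geometric_sum_abs_le q0 q1 M j).
  exact: ler_sum.
have PE : (0 <= fine (P E)) by exact: fine_ge0.
have : fine (P E) * (M%:R ^+ 2 / 2) <= \int[P]_w fejer M tau (S w).
  apply: (@Rintegral_ge_set _ _ _ _ _ (M%:R ^+ 2) _ E) => //.
  - by apply: measurable_sum => j; apply: measurable_sum => k; exact: mcos.
  - by move=> x; rewrite fejer_ge0 fejer_le.
  - by rewrite fineK// fin_num_measure.
  - move=> w Ew; apply: fejer_ge; rewrite /tau.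
    rewrite (_ : _ * _ * S w = t1 * (S w / l)); last by field; rewrite !gt_eqF.
    rewrite normrM (gtr0_norm t10); apply: mulr_ile1 => //; first exact: ltW.
    by rewrite normrM normfV (gtr0_norm l0) ler_pdivrMr// mul1r.
move=> /le_trans/(_ Ef) H.
have -> : P E = (fine (P E))%:E by rewrite fineK// fin_num_measure.
rewrite lee_fin.
have sn0 : 0 < Num.sqrt (n%:R : R) by rewrite sqrtr_gt0 ltr0n.
rewrite ler_pdivlMr//.
have : fine (P E) * Num.sqrt n%:R <= fine (P E) * (2 * M%:R) by rewrite ler_wpM2l.
move=> /le_trans; apply.
have -> : C * l ^+ 2 = 16 / lam by rewrite /C /lam; field; rewrite !gt_eqF.
have : fine (P E) * (M%:R / 2) <= 4 / lam.
  by rewrite -(ler_pM2l M0'); apply: le_trans H; rewrite le_eqVlt; apply/orP; left; apply/eqP; field.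
have -> : 16 / lam = 4 * (4 / lam) by field; rewrite gt_eqF.
lra.
Qed.

End concentration.

(** * Random walks above a barrier *)

Section measurable_sets.
Context d (T : measurableType d) {R : realType}.
Implicit Types f g : T -> R.

Lemma measurable_le_set f (a : R) : measurable_fun [set: T] f ->
  measurable [set w | f w <= a].
Proof.
move=> mf; rewrite (_ : [set w | _] = f @^-1` `]-oo, a]).
  by rewrite -[X in measurable X]setTI; apply: mf => //; exact: measurable_itv.
by apply/seteqP; split=> w /=; rewrite in_itv.
Qed.

Lemma measurable_ge_set f (a : R) : measurable_fun [set: T] f ->
  measurable [set w | a <= f w].
Proof.
move=> mf; rewrite (_ : [set w | _] = f @^-1` `[a, +oo[).
  by rewrite -[X in measurable X]setTI; apply: mf => //; exact: measurable_itv.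
by apply/seteqP; split=> w /=; rewrite in_itv/= andbT.
Qed.

Lemma measurable_gt_set f (a : R) : measurable_fun [set: T] f ->
  measurable [set w | a < f w].
Proof.
move=> mf; rewrite (_ : [set w | _] = f @^-1` `]a, +oo[).
  by rewrite -[X in measurable X]setTI; apply: mf => //; exact: measurable_itv.
by apply/seteqP; split=> w /=; rewrite in_itv/= andbT.
Qed.

Lemma measurable_all (P : nat -> Prop) (F : nat -> set T) :
  (forall k, P k -> measurable (F k)) -> measurable [set w | forall k, P k -> F k w].
Proof.
move=> mF; rewrite (_ : [set w | _] = \bigcap_(k in P) F k).
  exact: bigcap_measurableType.
by apply/seteqP; split.
Qed.

Lemma EFin_prob (P : probability T R) A : measurable A -> P A = (fine (P A))%:E.
Proof. by move=> mA; rewrite fineK// fin_num_measure. Qed.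

Lemma fine_prob_le (P : probability T R) (A B : set T) : measurable A -> measurable B ->
  A `<=` B -> fine (P A) <= fine (P B).
Proof.
move=> mA mB AB; rewrite -lee_fin -!EFin_prob//; apply: le_measure => //; exact: mem_set.
Qed.

Lemma fine_prob_ge0 (P : probability T R) (A : set T) : 0 <= fine (P A).
Proof. exact: fine_ge0. Qed.

End measurable_sets.

Definition psum {R : realType} (x : nat -> R) (k : nat) : R := \sum_(i < k) x i.

Section psum.
Context {R : realType}.
Implicit Types x : nat -> R.

Lemma psum0 x : psum x 0 = 0. Proof. by rewrite /psum big_ord0. Qed.

Lemma psumS x k : psum x k.+1 = psum x k + x k.
Proof. by rewrite /psum big_ord_recr. Qed.

Lemma psumD x k l : psum x (k + l) = psum x k + psum (fun i => x (k + i)%N) l.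
Proof. by rewrite /psum big_split_ord. Qed.

Lemma measurable_psum (A : set nat) k : (forall i, (i < k)%N -> A i) ->
  measurable_fun [set: env R A] (psum^~ k : env R A -> R).
Proof. by move=> kA; apply: measurable_sum => i; apply: measurable_coord; exact: kA. Qed.

Lemma measurable_reindex (A B : set nat) (phi : nat -> nat) :
  (forall i, B i -> A (phi i)) ->
  measurable_fun [set: env R A] (fun x : env R A => (fun i => x (phi i)) : env R B).
Proof. by move=> BA; apply: measurable_envP => j Bj; apply: measurable_coord; exact: BA. Qed.

End psum.

Lemma measurable_env_sub (J : eqType) (R : realType) (D D' : set J) (A : set (J -> R)) :
  D `<=` D' -> @measurable _ (env R D) A -> @measurable _ (env R D') A.
Proof.
move=> DD mA; rewrite -[A]setTI.
apply: (@measurable_envP J R _ (env R D') D (fun x => x) _ measurableT _ mA) => j Dj.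
by apply: measurable_coord; exact: DD.
Qed.

Section walk.
Context {R : realType} (nu : probability R R) d (T : measurableType d).
Variables (X : nat -> T -> R) (Q : nat -> probability T R).
Hypothesis iQ : forall N, iid_on nu (Q N) X `I_N.

(** The horizon is an argument because under [Q n] only the first [n] steps are controlled; by
    [prob_widen] a longer horizon gives the same value. *)
Definition prob n (A : set (nat -> R)) : R := fine (Q n [set w | A (X ^~ w)]).

Lemma measurable_step j : measurable_fun [set: T] (X j). Proof. exact: (iQ 0).1. Qed.

Lemma measurable_event (D : set nat) (A : set (env R D)) : measurable A ->
  measurable [set w | A (X ^~ w)].
Proof.
move=> mA; rewrite -[X in measurable X]setTI; apply: (measurable_sample D measurable_step) => //.
Qed.

Lemma prob_ge0 n A : 0 <= prob n A. Proof. exact: fine_prob_ge0. Qed.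

Lemma prob_le n (A B : set (env R `I_n)) : measurable A -> measurable B ->
  A `<=` B -> prob n A <= prob n B.
Proof. by move=> /measurable_event mA /measurable_event mB AB; apply: fine_prob_le => // w; exact: AB. Qed.

Lemma prob_reindex n N (A : set (env R `I_n)) (phi : nat -> nat) : measurable A ->
  (forall i, (i < n)%N -> (phi i < N)%N) ->
  (forall i j, (i < n)%N -> (j < n)%N -> phi i = phi j -> i = j) ->
  prob N [set x | A (fun i => x (phi i))] = prob n A.
Proof.
move=> mA pN inj; rewrite /prob.
have iphi : iid_on nu (Q N) (fun i => X (phi i)) `I_n by exact: iid_reindex (iQ N) _ _.
by rewrite -(iid_prob iphi (iQ n) mA).
Qed.

Lemma prob_widen n N (A : set (env R `I_n)) : measurable A -> (n <= N)%N ->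
  prob N A = prob n A.
Proof. by move=> mA nN; rewrite -(@prob_reindex n N A id)// => i /leq_trans; apply. Qed.

Lemma prob_indep N (D1 D2 : set nat) (A : set (env R D1)) (B : set (env R D2)) :
  measurable A -> measurable B -> D1 `<=` `I_N -> D2 `<=` `I_N -> D1 `&` D2 = set0 ->
  prob N (A `&` B) = prob N A * prob N B.
Proof.
move=> mA mB D1N D2N D12.
have i12 : iid_on nu (Q N) X (D1 `|` D2).
  by apply: iid_onS (iQ N) => i [/D1N|/D2N].
rewrite /prob -fineM; [|exact/fin_num_measure/(measurable_event mA)|exact/fin_num_measure/(measurable_event mB)].
by congr fine; exact: (iid_indep i12 D12 mA mB).
Qed.

Definition stay n J : set (nat -> R) := [set x | forall k, (0 < k <= n)%N -> - J <= psum x k].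

Lemma measurable_stay n J D : (forall i, (i < n)%N -> D i) ->
  @measurable _ (env R D) (stay n J).
Proof.
move=> nD; apply: (@measurable_all _ (env R D) (fun k => (0 < k <= n)%N) (fun k => [set x | - J <= psum x k])).
move=> k /andP[_ kn]; apply: measurable_ge_set; apply: measurable_psum => i ik.
by apply: nD; exact: leq_trans kn.
Qed.

Definition pstay n J := prob n (stay n J).

(** A block in [G] followed by [n] independent steps staying above -(J + h) gives L + n steps
    staying above -J, and only the first [n] of them are kept. *)
Lemma pstay_block n L (G : set (env R `I_L)) (J h : R) : measurable G ->
  (forall x, G x -> forall k, (0 < k <= L)%N -> - J <= psum x k) ->
  (forall x, G x -> h <= psum x L) ->
  prob L G * pstay n (J + h) <= pstay n J.
Proof.
move=> mG GJ Gh.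
have mst : @measurable _ (env R `I_n) (stay n J) by exact: measurable_stay.
have mst' : @measurable _ (env R `I_n) (stay n (J + h)) by exact: measurable_stay.
rewrite /pstay -(prob_widen mst (leq_addl L n)).
rewrite -(prob_widen mG (leq_addr n L)).
pose D2 := [set i | (L <= i < L + n)%N].
pose B : set (env R D2) := [set x | stay n (J + h) (fun i => x (L + i)%N)].
have mB : measurable B.
  rewrite -[B]setTI.
  apply: (@measurable_reindex R D2 `I_n (addn L) _ measurableT _ mst') => i /= iN.
  by rewrite /D2 /= leq_addr ltn_add2l.
have <- : prob (L + n) B = prob n (stay n (J + h)).
  apply: (prob_reindex (phi := addn L) mst') => [i iN|i j _ _ /addnI//].
  by rewrite ltn_add2l.
rewrite -(prob_indep mG mB) => [|i|i /andP[]//|]; last first.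
  by apply/seteqP; split=> i //= [iL /andP[]]; rewrite leqNgt iL.
  by move=> /= iL; apply: leq_trans iL _; exact: leq_addr.
apply: prob_le.
- apply: measurableI.
    by apply: measurable_env_sub mG => i /= iL; apply: leq_trans iL _; exact: leq_addr.
  by apply: measurable_env_sub mB => i /= /andP[].
- by apply: measurable_stay => i iN; apply: leq_trans iN _; exact: leq_addl.
move=> x [Gx Bx] k /andP[k0 kn].
have [kL|Lk] := leqP k L; first by apply: GJ => //; rewrite k0.
rewrite -(subnKC (ltnW Lk)) psumD.
have := Bx (k - L)%N; rewrite subn_gt0 Lk /= => /(_ _).
have -> : (k - L <= n)%N by apply: leq_trans kn; exact: leq_subr.
by move=> /(_ isT); have := Gh x Gx; lra.
Qed.

Hypothesis nu_int : nu.-integrable [set: R] (EFin \o @id R).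
Hypothesis nu_center : \int[nu]_x x = 0.
Variables (c B p : R).
Hypotheses (c0 : 0 < c) (cB : c <= B) (p0 : 0 < p).
Hypothesis nu_right : (p%:E <= nu `[c, B]%classic)%E.
Hypothesis nu_left : (p%:E <= nu `[(- B)%R, (- c)%R]%classic)%E.

Lemma measurable_psum_gt D n (h : R) : (forall i, (i < n)%N -> D i) ->
  @measurable _ (env R D) [set x | h <= psum x n].
Proof. by move=> nD; apply: measurable_ge_set; exact: measurable_psum. Qed.

Lemma integrable_step N j : (j < N)%N -> (Q N).-integrable [set: T] (EFin \o X j).
Proof.
move=> jN; apply/integrableP; split; first by apply/measurable_EFinP; exact: measurable_step.
move/integrableP : nu_int => [_].
by rewrite -(iid_integral1 (f := fun x => `|x%:E|%E) (iQ N) jN)//; apply: measurableT_comp.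
Qed.

Lemma integral_step N j : (j < N)%N -> \int[Q N]_w X j w = 0.
Proof.
move=> jN; rewrite -nu_center /Rintegral; congr fine.
transitivity (\int[pushforward (Q N) (X j)]_y y%:E)%E.
  rewrite (integral_pushforward (measurable_step j)) ?preimage_setT //.
  exact: integrable_step.
apply: eq_measure_integral => [|mXj S mS _]; first exact: measurable_step.
transitivity (Q N [set w | forall k, k \in [:: j] -> S (X k w)]); last first.
  have := (iQ N).2 [:: j] (fun=> S) erefl _ (fun=> mS); rewrite big_seq1; apply => k.
  by rewrite inE => /eqP->.
congr (Q N _); apply/seteqP; split=> w /=.
  by move=> ? k; rewrite inE => /eqP->.
by apply; rewrite inE.
Qed.

(* Otherwise the positive parts of all the centred sums would have uniformly
   bounded means, hence so would the absolute values, against concentration. *)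
Lemma climb_exists eps H : 0 < eps -> 0 < H ->
  exists2 L, (0 < L)%N & exists2 h, H <= h & expR (- (eps * h)) <= prob L [set x | h <= psum x L].
Proof.
move=> e0 H0.
pose q := expR (- eps).
(* If all climbs were rarer than e^{-eps h}, the positive part of S would have mean at most H +
   sum_i q^i <= K, and the centred S would satisfy E|S| = 2 E S^+ <= 2K. Concentration gives |S| > M
   with probability at least 1/2, so E|S| >= M/2, which exceeds 2K for M = 1 + 4K. *)
pose K := H + (1 - q)^-1.
have q0 : 0 <= q by exact: expR_ge0.
have q1 : q < 1 by rewrite expR_lt1 oppr_lt0.
have K0 : 0 < K by rewrite addr_gt0// invr_gt0 subr_gt0.
pose M := 1 + 4 * K.
have M1 : 1 <= M by rewrite lerDl mulr_ge0// ltW.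
have [L L0 PM] : exists2 L, (0 < L)%N & (Q L [set w | (`|psum (X ^~ w) L| <= M)%R] <= 2^-1%:E)%E.
  pose C := 32 / (p ^+ 2 * c ^+ 2 / 2 * (1 + 2 * B)^-1 ^+ 2).
  have C0 : 0 < C by exact: concentration_const_gt0.
  pose y := 2 * (C * M ^+ 2).
  have y0 : 0 <= y.
    by apply: mulr_ge0 => //; apply: mulr_ge0; [exact: ltW|exact: sqr_ge0].
  pose L := (Num.bound (y ^+ 2)).+1.
  exists L => //.
  have := @concentration R nu c B p c0 cB p0 nu_right nu_left L M _ _ (Q L) X 0 isT M1 (iQ L).
  rewrite (_ : [set w | (_ <= M)%R] = [set w | (`|psum (X ^~ w) L| <= M)%R]); last first.
    by apply/seteqP; split=> w /=; rewrite addr0.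
  move=> /le_trans; apply; rewrite lee_fin.
  have sL : 0 < Num.sqrt (L%:R : R) by rewrite sqrtr_gt0 ltr0n.
  rewrite ler_pdivrMr// ler_pdivlMl// -/y.
  rewrite -(ger0_norm y0) -sqrtr_sqr ler_wsqrtr//.
  by apply: le_trans (ltW (archi_boundP (sqr_ge0 y))) _; rewrite ler_nat.
exists L => //; apply: contrapT => Hno.
have small h : H <= h -> prob L [set x | h <= psum x L] <= expR (- (eps * h)).
  move=> Hh; rewrite leNgt; apply/negP => /ltW Hc; apply: Hno; exists h => //.
pose S w := psum (X ^~ w) L.
have mS : measurable_fun [set: T] S by apply: measurable_sum => i; exact: measurable_step.
have iS : (Q L).-integrable [set: T] (EFin \o S).
  have := @integrable_sum _ _ _ (Q L) _ measurableT _ (index_enum 'I_L) xpredT (fun k => EFin \o X k) (fun k _ => integrable_step (ltn_ord k)).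
  by apply: eq_integrable => // w _; rewrite /= sumEFin.
have S0 : (\int[Q L]_w (S w)%:E = 0)%E.
  rewrite EFin_Rintegral// /S /psum Rintegral_sum => [|i]; last exact: integrable_step.
  by rewrite big1// => i _; exact: integral_step.
have mS1 i : measurable [set w | H + i%:R <= S w] by exact: measurable_ge_set.
have Splus : (\int[Q L]_w (Num.max (S w) 0)%:E <= K%:E)%E.
  apply: (@le_trans _ _ (\int[Q L]_w (H%:E + \sum_(0 <= i <oo) (\1_[set w | (H + i%:R <= S w)%R] w)%:E))%E).
    apply: ge0_le_integral => //.
    - by move=> w _; rewrite lee_fin le_max lexx orbT.
    - by apply/measurable_EFinP; apply: measurable_maxr.
    - apply: emeasurable_funD => //; apply: ge0_emeasurable_sum => //.
      by move=> k _; apply/measurable_EFinP; exact: measurable_indic.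
    move=> w _.
    have [SH|SH] := leP (S w) H.
      apply: (@le_trans _ _ (H%:E + 0)%E).
        by rewrite adde0 lee_fin ge_max SH ltW.
      by apply: leeD => //; apply: nneseries_ge0 => n _ _; rewrite lee_fin.
    have SH0 : 0 <= S w - H by rewrite subr_ge0 ltW.
    pose t := Num.truncn (S w - H).
    have /andP[t1 t2] := truncn_itv SH0.
    apply: (@le_trans _ _ (H%:E + \sum_(0 <= i < t.+1) (\1_[set w | (H + i%:R <= S w)%R] w)%:E)%E); last first.
      by apply: leeD => //; apply: nneseries_lim_ge => n _ _; rewrite lee_fin.
    rewrite sumEFin -EFinD lee_fin big_mkord.
    rewrite (eq_bigr (fun=> 1)) => [|i _]; last first.
      rewrite indicE mem_set//=; rewrite -lerBrDl; apply: le_trans t1.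
      by rewrite ler_nat -ltnS.
    rewrite sumr_const card_ord ge_max addr_ge0 ?(ltW H0)// andbT -lerBlDl.
    exact: ltW.
  rewrite ge0_integralD//; last 3 first.
  - by move=> w _; rewrite lee_fin ltW.
  - by move=> w _; apply: nneseries_ge0 => n _ _; rewrite lee_fin.
  - apply: ge0_emeasurable_sum => //.
    by move=> k _; apply/measurable_EFinP; exact: measurable_indic.
  rewrite integral_prob_cst EFinD.
  apply: leeD => //.
  rewrite integral_nneseries//; last first.
    by move=> n; apply/measurable_EFinP; exact: measurable_indic.
  under eq_eseriesr do rewrite integral_indic// setIT.
  apply: lime_le; first by apply: is_cvg_nneseries => n _ _; exact: measure_ge0.
  apply: nearW => m.
  apply: (@le_trans _ _ (\sum_(0 <= i < m) (q ^+ i)%:E)%E).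
    suff HH i : (Q L [set w | (H + i%:R <= S w)%R] <= (q ^+ i)%:E)%E by apply: lee_sum => i _; exact: HH.
    rewrite (EFin_prob (Q L) (mS1 i)) lee_fin.
    apply: le_trans (small (H + i%:R) _) _; first by rewrite lerDl.
    rewrite /q -expRM_natl ler_expR; have : 0 <= eps * H by rewrite mulr_ge0 ?(ltW e0) ?(ltW H0).
    by rewrite mulrDr; move: (eps * H) => ?; lra.
  by rewrite sumEFin lee_fin big_mkord; exact: geometric_sum_le.
have iaS : (Q L).-integrable [set: T] (EFin \o (fun w => `|S w|)) by exact: integrable_norm.
have Sabs : (\int[Q L]_w (`|S w|)%:E <= (2 * K)%:E)%E.
  have -> : (\int[Q L]_w (`|S w|)%:E = \int[Q L]_w (`|S w|)%:E + \int[Q L]_w (S w)%:E)%E.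
    by rewrite S0 adde0.
  rewrite -integralD//.
  have -> : (\int[Q L]_w ((`|S w|)%:E + (S w)%:E) = \int[Q L]_w (2%:E * (Num.max (S w) 0)%:E))%E.
    apply: eq_integral => w _; rewrite -EFinD -EFinM; congr EFin.
    by have [?|?] := ler0P (S w); ring.
  rewrite ge0_integralZl//; last 2 first.
  - by apply/measurable_EFinP; apply: measurable_maxr.
  - by move=> w _; rewrite lee_fin le_max lexx orbT.
  by rewrite EFinM lee_wpmul2l.
have : ((2^-1 * M)%:E <= \int[Q L]_w (`|S w|)%:E)%E.
  have mA : measurable [set w | `|S w| <= M].
    by apply: measurable_le_set; exact: measurableT_comp.
  apply: (@ge0_integral_ge_set _ _ _ _ _ _ (~` [set w | `|S w| <= M])) => //.
  - exact: measurableT_comp.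
  - exact: measurableC.
  - rewrite probability_setC// (EFin_prob _ mA) -EFinB lee_fin.
    have : fine (Q L [set w | `|S w| <= M]) <= 2^-1 by rewrite -lee_fin -EFin_prob.
    lra.
  - by move=> w /= /negP; rewrite -ltNge => /ltW.
  - lra.
by move=> /le_trans/(_ Sabs); rewrite lee_fin /M; lra.
Qed.

(** [climb_exists] constrains the endpoint only. Requiring in addition that no step falls below -B'
    keeps the whole path above -L B'; by Markov's inequality this costs at most half of the
    probability. *)
Lemma climb_block eps : 0 < eps -> exists L (h B' : R) (G : set (env R `I_L)),
  [/\ measurable G, 0 < h /\ 0 < B',
    forall x, G x -> forall k, (0 < k <= L)%N -> - (L%:R * B') <= psum x k,
    forall x, G x -> h <= psum x L & expR (- (eps * h)) <= prob L G].
Proof.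
move=> e0; have e20 : 0 < eps / 2 by rewrite divr_gt0.
(* With h >= 2 / eps, e^{-eps h / 2} <= 1/2. The climb is taken at rate eps / 2, so the half that
   survives the truncation is still at least e^{-eps h}. *)
have H0 : 0 < 2 / eps by rewrite divr_gt0.
have [L L0 [h Hh PF]] := climb_exists e20 H0.
have h0 : 0 < h by exact: lt_le_trans Hh.
pose m1 := \int[nu]_x `|x|.
have m10 : 0 <= m1 by apply: Rintegral_ge0 => x _.
have imX : nu.-integrable [set: R] (EFin \o (fun x : R => `|x|)) by exact: integrable_norm.
(* Chosen to make the Markov bound L m1 / B' at most e^{-eps h / 2} / 2. *)
pose B' := 1 + 2 * L%:R * m1 * expR (eps / 2 * h).
have B'0 : 0 < B' by rewrite ltr_pwDl// !mulr_ge0// expR_ge0.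
pose F : set (env R `I_L) := [set x | h <= psum x L].
have mF : measurable F by exact: measurable_psum_gt.
pose G : set (env R `I_L) := F `&` [set x | forall i, (i < L)%N -> - B' <= x i].
have mG : measurable G.
  apply: measurableI => //.
  apply: (@measurable_all _ (env R `I_L) (fun i => (i < L)%N) (fun i => [set x | - B' <= x i])) => i iL.
  by apply: measurable_ge_set; exact: measurable_coord.
exists L, h, B', G; split => //.
- move=> x [_ /= Gx] k /andP[_ kL].
  apply: (@le_trans _ _ (\sum_(i < k) - B')).
    rewrite sumr_const card_ord mulNrn -(mulr_natl B' k) lerN2 ler_wpM2r ?ler_nat//; exact: ltW.
  by apply: ler_sum => i _; apply: Gx; exact: leq_trans kL.
- by move=> x [].
have mFT := measurable_event mF; have mGT := measurable_event mG.
have : (Q L [set w | F (X ^~ w)] <= Q L [set w | G (X ^~ w)] + (L%:R * (m1 / B'))%:E)%E.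
  have int1 A : measurable A -> Q L A = (\int[Q L]_w (\1_A w)%:E)%E.
    by move=> mA; rewrite integral_indic// setIT.
  rewrite (int1 _ mFT) (int1 _ mGT).
  have -> : ((L%:R * (m1 / B'))%:E = \int[Q L]_w (\sum_(i < L) (`|X i w| / B')%:E))%E.
    rewrite ge0_integral_sum//; last first.
      by move=> i w _; rewrite lee_fin divr_ge0// ltW.
    - move=> i; apply/measurable_EFinP; apply: measurable_funM => //.
      by apply: measurableT_comp => //; exact: measurable_step.
    - rewrite (eq_bigr (fun=> (m1 / B')%:E)) => [|i _].
        by rewrite sumEFin sumr_const card_ord -(mulr_natl (m1 / B') L).
      rewrite (iid_integral1 (f := fun x => (`|x| / B')%:E) (iQ L) (ltn_ord i))//.
      + under eq_integral do rewrite EFinM.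
        rewrite ge0_integralZr//; first by rewrite EFin_Rintegral.
          by apply/measurable_EFinP; exact: normr_measurable.
        by rewrite lee_fin invr_ge0 ltW.
      + by apply/measurable_EFinP; apply: measurable_funM => //; exact: measurableT_comp.
      + by move=> x; rewrite lee_fin divr_ge0// ltW.
  rewrite -ge0_integralD//; last 3 first.
  - exact/measurable_EFinP/measurable_indic.
  - by move=> w _; apply: sume_ge0 => i _; rewrite lee_fin divr_ge0// ltW.
  - apply: emeasurable_sum => i; apply/measurable_EFinP; apply: measurable_funM => //.
    by apply: measurableT_comp => //; exact: measurable_step.
  apply: ge0_le_integral => //.
  - exact/measurable_EFinP/measurable_indic.
  - apply: emeasurable_funD; first exact/measurable_EFinP/measurable_indic.
    apply: emeasurable_sum => i; apply/measurable_EFinP; apply: measurable_funM => //.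
    by apply: measurableT_comp => //; exact: measurable_step.
  move=> w _; rewrite sumEFin -EFinD lee_fin.
  have s0 : 0 <= \sum_(i < L) `|X i w| / B' by apply: sumr_ge0 => i _; rewrite divr_ge0// ltW.
  rewrite !indicE; have [Fw|Fw] := boolP (w \in _); last by rewrite addr_ge0.
  have [Gw|Gw] := boolP (w \in _); first by rewrite lerDl.
  rewrite add0r.
  have [i iL Xi] : exists2 i, (i < L)%N & X i w < - B'.
    apply: contrapT => H; move/negP : Gw; apply; apply/mem_set; split; first exact: set_mem Fw.
    move=> i iL; rewrite leNgt; apply/negP => Xi; apply: H; exists i => //.
  rewrite (bigD1 (Ordinal iL))//= -[leLHS]addr0; apply: lerD.
    by rewrite ler_pdivlMr// mul1r ltr0_norm; lra.
  by apply: sumr_ge0 => j _; rewrite divr_ge0// ltW.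
rewrite (EFin_prob _ mFT) (EFin_prob _ mGT) -EFinD lee_fin -/(prob L F) -/(prob L G) => FG.
have E0 : 0 < expR (- (eps / 2 * h)) by exact: expR_gt0.
have small : L%:R * (m1 / B') <= expR (- (eps / 2 * h)) / 2.
  rewrite mulrA ler_pdivrMr// expRN mulrAC ler_pdivlMr ?expR_gt0// /B'.
  have := expR_gt0 (eps / 2 * h); move: (expR _) => z z0.
  rewrite (_ : z^-1 * _ = z^-1 + 2 * L%:R * m1); last by field; rewrite gt_eqF.
  have : 0 < z^-1 by rewrite invr_gt0.
  by move: (z^-1) => y; lra.
have half : expR (- (eps / 2 * h)) <= 2^-1.
  apply: (@le_trans _ _ (expR (- 1))).
    have H1 : eps / 2 * (2 / eps) <= eps / 2 * h by rewrite ler_wpM2l// ltW.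
    have H2 : eps / 2 * (2 / eps) = 1 by field; rewrite gt_eqF.
    by rewrite H2 in H1; rewrite ler_expR lerN2.
  rewrite expRN lef_pV2 ?posrE ?expR_gt0//; exact: expR_ge1Dx.
have -> : expR (- (eps * h)) = expR (- (eps / 2 * h)) * expR (- (eps / 2 * h)).
  by rewrite -expRD; congr expR; field.
have : expR (- (eps / 2 * h)) * expR (- (eps / 2 * h)) <= expR (- (eps / 2 * h)) * 2^-1.
  by rewrite ler_wpM2l// ltW.
move: PF FG small; rewrite -/F; lra.
Qed.

(* Prefixing a walk with one [climb_block] of probability e^{- eps h} raises the
   barrier by h; J / h blocks bring it from - J up to 0. *)
Lemma pstay_climb eps : 0 < eps -> exists2 C, 0 < C & forall n J, 0 <= J ->
  pstay n J <= C * expR (eps * J) * prob n [set x | forall k, (0 < k <= n)%N -> 0 < psum x k].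
Proof.
move=> e0; have [L [h [B' [G [mG [h0 B'0] GJ Gh PG]]]]] := climb_block e0.
pose a := L%:R * B'.
have a0 : 0 <= a by rewrite mulr_ge0// ltW.
(* A block may dip by [a], so blocks work only while the barrier is at least that deep. The
   remaining height, from a to -c/2, is climbed by [s] single steps of size at least c, each at a
   cost p. *)
pose s := (Num.truncn (a / c)).+2.
exists (expR (eps * h) * p^-1 ^+ s); first by rewrite mulr_gt0 ?expR_gt0 ?exprn_gt0 ?invr_gt0.
move=> n J J0.
have mst J' : @measurable _ (env R `I_n) (stay n J') by exact: measurable_stay.
have mono J1 J2 : J1 <= J2 -> pstay n J1 <= pstay n J2.
  move=> J12; apply: prob_le => // x xJ k kn; apply: le_trans (xJ k kn); lra.
have step1 J1 : - c <= J1 -> p * pstay n (J1 + c) <= pstay n J1.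
  move=> cJ.
  pose G1 : set (env R `I_1) := [set x | c <= x 0%N].
  have mG1 : measurable G1 by apply: measurable_ge_set; exact: measurable_coord.
  apply: (@le_trans _ _ (prob 1 G1 * pstay n (J1 + c))).
    apply: ler_wpM2r; first exact: prob_ge0.
    rewrite -lee_fin -EFin_prob; last exact: measurable_event mG1.
    apply: le_trans nu_right _.
    have := (iQ 1).2 [:: 0%N] (fun=> `[c, B]%classic) erefl _ (fun=> measurable_itv _).
    rewrite big_seq1 => <-; last by move=> k; rewrite inE => /eqP->.
    apply: le_measure.
    - rewrite inE; rewrite (_ : [set w | _] = X 0%N @^-1` `[c, B]).
        by rewrite -[X in measurable X]setTI; apply: measurable_step => //; exact: measurable_itv.
      apply/seteqP; split=> w /=; first by apply; rewrite inE.
      by move=> ? k; rewrite inE => /eqP->.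
    - by rewrite inE; exact: measurable_event mG1.
    - by move=> w /= /(_ 0%N); rewrite inE eqxx in_itv/= => /(_ isT)/andP[].
  apply: pstay_block => // x; rewrite /G1 /=.
    move=> xc k; case: k => [//|[|//]] _; rewrite psumS psum0; move: c0; lra.
  by rewrite psumS psum0 add0r.
have step2 J1 : a <= J1 -> expR (- (eps * h)) * pstay n (J1 + h) <= pstay n J1.
  move=> aJ; apply: (@le_trans _ _ (prob L G * pstay n (J1 + h))).
    by apply: ler_wpM2r => //; exact: prob_ge0.
  apply: pstay_block => // x Gx k kL; apply: le_trans (GJ x Gx k kL).
  by rewrite lerN2.
(* The climb ends at J = -c/2 and not at 0: sums bounded below by c/2 are strictly positive, as the
   conclusion requires. *)
have it1 m : pstay n (- c / 2 + m%:R * c) <= p^-1 ^+ m * pstay n (- c / 2).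
  elim: m => [|m IH]; first by rewrite mul0r addr0 expr0 mul1r.
  rewrite exprS -mulrA ler_pdivlMl//.
  apply: le_trans IH; rewrite (_ : _ + _ = (- c / 2 + m%:R * c) + c); last first.
    by rewrite -[m.+1]addn1 natrD; ring.
  have mc : 0 <= m%:R * c by rewrite mulr_ge0// ltW.
  apply: step1; move: c0; lra.
have it2 m : pstay n (a + m%:R * h) <= expR (eps * h) ^+ m * pstay n a.
  elim: m => [|m IH]; first by rewrite mul0r addr0 expr0 mul1r.
  rewrite exprS -mulrA -ler_pdivrMl ?expR_gt0// -expRN.
  apply: le_trans IH; rewrite (_ : a + _ = (a + m%:R * h) + h); last first.
    by rewrite -[m.+1]addn1 natrD; ring.
  by apply: step2; rewrite lerDl mulr_ge0// ltW.
pose l := (Num.truncn (J / h)).+1.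
have /andP[l1 l2] := truncn_itv (divr_ge0 J0 (ltW h0)).
have /andP[s1 s2] := truncn_itv (divr_ge0 a0 (ltW c0)).
apply: (@le_trans _ _ (pstay n (a + l%:R * h))).
  apply: mono; move: l2; rewrite ltr_pdivrMr// -/l; lra.
apply: le_trans (it2 l) _.
have El : expR (eps * h) ^+ l <= expR (eps * h) * expR (eps * J).
  rewrite -expRM_natl -expRD ler_expR.
  have : l%:R * h <= h + J.
    rewrite /l -[X in X%:R * _]addn1 natrD mulrDl mul1r addrC lerD2l.
    by move: l1; rewrite ler_pdivlMr.
  move=> /(ler_wpM2l (ltW e0)); rewrite mulrDr; lra.
have ua : pstay n a <= p^-1 ^+ s * pstay n (- c / 2).
  apply: le_trans (it1 s); apply: mono.
  move: s2; rewrite ltr_pdivrMr// /s -[X in X%:R * _](addn1 (Num.truncn (a / c)).+1) natrD; move: c0; lra.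
have uq : pstay n (- c / 2) <= prob n [set x | forall k, (0 < k <= n)%N -> 0 < psum x k].
  apply: prob_le => //.
    apply: (@measurable_all _ (env R `I_n) (fun k => (0 < k <= n)%N) (fun k => [set x | 0 < psum x k])).
    move=> k /andP[_ kn]; apply: measurable_gt_set; apply: measurable_psum => i ik /=.
    exact: leq_trans kn.
  move=> x xc k kn; have := xc k kn; move: c0; lra.
apply: (@le_trans _ _ (expR (eps * h) * expR (eps * J) * (p^-1 ^+ s * pstay n (- c / 2)))).
  by apply: ler_pM => //; exact: prob_ge0.
rewrite [leLHS]mulrA [leLHS](_ : _ = expR (eps * h) * p^-1 ^+ s * expR (eps * J) * pstay n (- c / 2)); last by ring.
apply: ler_wpM2l => //; apply: mulr_ge0; last exact: expR_ge0.
by apply: mulr_ge0; rewrite ?expR_ge0// exprn_ge0// invr_ge0 ltW.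
Qed.

End walk.

(** * Time reversal and the position of the maximum *)

Section reversal.
Context {R : realType}.

Lemma psum_rev (x : nat -> R) n j : (j <= n)%N ->
  psum (fun i => x (n - i.+1)%N) j = psum x n - psum x (n - j).
Proof.
elim: j => [|j IH] jn; first by rewrite psum0 subn0 subrr.
rewrite psumS IH ?(ltnW jn)//.
have -> : (n - j = (n - j.+1).+1)%N by rewrite subnSK.
by rewrite psumS; ring.
Qed.

Lemma psumN (x : nat -> R) n : psum (fun i => - x i) n = - psum x n.
Proof. by rewrite /psum sumrN. Qed.

End reversal.

Section extremes.
Context {R : realType} (nu : probability R R) d (T : measurableType d).
Variables (X : nat -> T -> R) (Q : nat -> probability T R).
Hypothesis iQ : forall N, iid_on nu (Q N) X `I_N.

Local Notation prob := (prob X Q).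

Definition above n : set (nat -> R) := [set x | forall k, (0 < k <= n)%N -> 0 < psum x k].
Definition below n : set (nat -> R) := [set x | forall k, (0 < k <= n)%N -> psum x k <= 0].

Lemma measurable_above n D : (forall i, (i < n)%N -> D i) -> @measurable _ (env R D) (above n).
Proof.
move=> nD; apply: (@measurable_all _ (env R D) (fun k => (0 < k <= n)%N) (fun k => [set x | 0 < psum x k])).
move=> k /andP[_ kn]; apply: measurable_gt_set; apply: measurable_psum => i ik.
by apply: nD; exact: leq_trans kn.
Qed.

Lemma measurable_below n D : (forall i, (i < n)%N -> D i) -> @measurable _ (env R D) (below n).
Proof.
move=> nD; apply: (@measurable_all _ (env R D) (fun k => (0 < k <= n)%N) (fun k => [set x | psum x k <= 0])).
move=> k /andP[_ kn]; apply: measurable_le_set; apply: measurable_psum => i ik.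
by apply: nD; exact: leq_trans kn.
Qed.

(* The path of length n attains its maximum for the first time at exactly one
   k <= n; this splits it into a reversed path staying above 0 and a path
   staying below 0. *)
Lemma above_below n : n.+1%:R * (prob n (above n) * prob n (below n)) <= 1.
Proof.
pose D1 k : set nat := [set i | (i < k)%N].
pose D2 k : set nat := [set i | (k <= i < n)%N].
pose rev k i := (k - i.+1)%N.
pose E1 k : set (env R (D1 k)) := [set x | above k (fun i => x (rev k i))].
pose E2 k : set (env R (D2 k)) := [set x | below (n - k) (fun i => x (k + i)%N)].
have mE1 k : measurable (E1 k).
  rewrite -[E1 k]setTI.
  apply: (@measurable_reindex R (D1 k) `I_k (rev k) _ measurableT _ (measurable_above _)) => // i /= ik.
  by rewrite /D1 /= /rev ltn_subrL (leq_ltn_trans _ ik).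
have mE2 k : measurable (E2 k).
  rewrite -[E2 k]setTI.
  apply: (@measurable_reindex R (D2 k) `I_(n - k) (addn k) _ measurableT _ (measurable_below _)) => // i /= ik.
  by rewrite /D2 /= leq_addr -ltn_subRL.
have PE1 k : (k <= n)%N -> prob n (above n) <= prob n (E1 k).
  move=> kn; have -> : prob n (E1 k) = prob k (above k).
    apply: (prob_reindex iQ (measurable_above _)) => // [i ik|i j ik jk].
      by rewrite /rev; apply: leq_trans kn; rewrite ltn_subrL (leq_ltn_trans _ ik).
    rewrite /rev => E; have : (k - (k - i.+1) = k - (k - j.+1))%N by rewrite E.
    by rewrite !subKn// => -[].
  rewrite -(prob_widen iQ (measurable_above _) kn)//.
  apply: (prob_le iQ).
  - exact: measurable_above.
  - by apply: measurable_above => i ik /=; exact: leq_trans kn.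
  by move=> x xn j /andP[j0 jk]; apply: xn; rewrite j0 (leq_trans jk).
have PE2 k : (k <= n)%N -> prob n (below n) <= prob n (E2 k).
  move=> kn; have -> : prob n (E2 k) = prob (n - k) (below (n - k)).
    apply: (prob_reindex iQ (measurable_below _)) => // [i ik|i j _ _ /addnI//].
    by rewrite -ltn_subRL.
  rewrite -(prob_widen iQ (measurable_below _) (leq_subr k n))//.
  apply: (prob_le iQ).
  - exact: measurable_below.
  - by apply: measurable_below => i ik /=; apply: leq_trans ik _; exact: leq_subr.
  by move=> x xn j /andP[j0 jk]; apply: xn; rewrite j0 (leq_trans jk)// leq_subr.
have PE k : (k <= n)%N -> prob n (above n) * prob n (below n) <= prob n (E1 k `&` E2 k).
  move=> kn; rewrite (prob_indep iQ (mE1 k) (mE2 k)).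
  - by apply: ler_pM; rewrite ?PE1 ?PE2//; exact: prob_ge0.
  - by move=> i /= ik; exact: leq_trans kn.
  - by move=> i /andP[].
  - by apply/seteqP; split=> i //= [+ /andP[+ _]]; rewrite /D1/= ltnNge => /negP.
pose F (k : 'I_n.+1) := [set w | (E1 k `&` E2 k) (X ^~ w)].
have mF k : measurable (F k).
  apply: measurableI; [exact: (measurable_event iQ (mE1 k))|exact: (measurable_event iQ (mE2 k))].
have tF : trivIset setT F.
  (* For i < j, [F j] forces S_j > S_i by its reversed part, while [F i] forces S_j <= S_i by its
     later part. *)
  suff dF (i j : 'I_n.+1) w : (i < j)%N -> F i w -> F j w -> False.
    apply/trivIsetP => i j _ _; rewrite -(inj_eq val_inj) neq_ltn => /orP[ij|ji].
      by apply/seteqP; split => // w [Fi Fj]; exact: dF ij Fi Fj.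
    by apply/seteqP; split => // w [Fi Fj]; exact: dF ji Fj Fi.
  move=> ij [_ Ei] [Ej _].
  have ji0 : (0 < j - i)%N by rewrite subn_gt0.
  have jn : (j <= n)%N by rewrite -ltnS.
  have /= := Ei (j - i)%N; rewrite ji0 /= leq_sub2r// => /(_ isT).
  have /= := Ej (j - i)%N; rewrite ji0 /= leq_subr => /(_ isT).
  rewrite (psum_rev (X ^~ w)) ?leq_subr// subKn ?(ltnW ij)//.
  have -> : psum (X ^~ w) j = psum (X ^~ w) i + psum (fun l => X (i + l)%N w) (j - i).
    by rewrite -(psumD (X ^~ w)) subnKC// ltnW.
  lra.
have H : (\sum_(k < n.+1) Q n (F k) <= 1)%E.
  rewrite -(measure_bigsetU_ord (Q n) xpredT)//.
  by apply: probability_le1; exact: bigsetU_measurable.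
rewrite -lee_fin; apply: le_trans H.
set z := _ * prob n (below n).
have -> : (n.+1%:R * z)%:E = (\sum_(k < n.+1) z%:E)%E.
  by rewrite sumEFin sumr_const card_ord mulr_natl.
apply: lee_sum => k _; rewrite (EFin_prob (Q n) (mF k)) lee_fin.
by apply: PE; rewrite -ltnS.
Qed.

End extremes.

Section opposite.
Context {R : realType}.

Definition opp_fun (x : R) : R := - x.

Lemma measurable_opp_fun : measurable_fun [set: R] opp_fun.
Proof. exact: oppr_measurable. Qed.

HB.instance Definition _ := isMeasurableFun.Build _ _ R R opp_fun measurable_opp_fun.

Variable nu : probability R R.

Definition opp_law : probability R R := distribution nu opp_fun.

Lemma iid_opp (J : eqType) d' (T' : measurableType d') (P : probability T' R)
    (Y : J -> T' -> R) (A : set J) :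
  iid_on nu P Y A -> iid_on opp_law P (fun j w => - Y j w) A.
Proof.
move=> [mY YE]; split=> [j|r B ur rA mB]; first exact: measurableT_comp.
rewrite (YE r (fun j => opp_fun @^-1` B j))// => j.
by rewrite -[X in measurable X]setTI; exact: measurable_opp_fun.
Qed.

Hypothesis nui : nu.-integrable [set: R] (EFin \o @id R).

Let integrable_opp_fun : nu.-integrable [set: R] (EFin \o opp_fun).
Proof. by have := integrableN nui; apply: eq_integrable. Qed.

Lemma integrable_opp_law : opp_law.-integrable [set: R] (EFin \o @id R).
Proof.
apply/integrableP; split; first exact/measurable_EFinP.
have E := @ge0_integral_distribution _ _ _ _ _ nu opp_fun (fun x : R => `|x%:E|%E).
rewrite [X in (X < _)%E]E//; last exact: measurableT_comp.
by move/integrableP : integrable_opp_fun => [].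
Qed.

Lemma integral_opp_law : \int[nu]_x x = 0 -> \int[opp_law]_x x = 0.
Proof.
move=> nu0.
transitivity (\int[nu]_x (-1 * x)); last by rewrite RintegralZl// nu0 mulr0.
rewrite /Rintegral /opp_law [X in fine X](integral_pushforward measurable_opp_fun)//.
by congr fine; apply: eq_integral => x _; rewrite /= /opp_fun mulN1r.
Qed.

End opposite.

(** * Barrier events over three blocks *)

Section barrier.
Context {R : realType} (nu : probability R R) d (T : measurableType d).
Variables (X : nat -> T -> R) (Q : nat -> probability T R).
Hypothesis iQ : forall N, iid_on nu (Q N) X `I_N.

Local Notation prob := (prob X Q).

Hypothesis nu_int : nu.-integrable [set: R] (EFin \o @id R).
Hypothesis nu_center : \int[nu]_x x = 0.
Variables (c B p : R).
Hypotheses (c0 : 0 < c) (cB : c <= B) (p0 : 0 < p).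
Hypothesis nu_right : (p%:E <= nu `[c, B]%classic)%E.
Hypothesis nu_left : (p%:E <= nu `[(- B)%R, (- c)%R]%classic)%E.

Definition first_below n (K : R) : set (nat -> R) :=
  [set x | forall k, (0 < k <= n)%N -> psum x k <= K].

Lemma measurable_first_below n K D : (forall i, (i < n)%N -> D i) ->
  @measurable _ (env R D) (first_below n K).
Proof.
move=> nD; apply: (@measurable_all _ (env R D) (fun k => (0 < k <= n)%N) (fun k => [set x | psum x k <= K])).
move=> k /andP[_ kn]; apply: measurable_le_set; apply: measurable_psum => i ik.
by apply: nD; exact: leq_trans kn.
Qed.

(** This is [pstay_climb] for the reflected walk -S, whose law satisfies the same hypotheses with
    the two tails exchanged. *)
Lemma first_below_le eps : 0 < eps -> exists2 C, 0 < C & forall n K, 0 <= K ->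
  prob n (first_below n K) <= C * expR (eps * K) * prob n (below n).
Proof.
move=> e0.
have iopp N : iid_on (opp_law nu) (Q N) (fun j w => - X j w) `I_N by exact: iid_opp.
have [||C C0 H] := pstay_climb iopp (integrable_opp_law nu_int) (integral_opp_law nu_int nu_center) c0 cB p0 _ _ e0.
- apply: le_trans nu_left _; apply: le_measure; rewrite ?inE//.
    by rewrite -[X in measurable X]setTI; exact: measurable_opp_fun.
  by move=> x /=; rewrite !in_itv/= /opp_fun => ?; lra.
- apply: le_trans nu_right _; apply: le_measure; rewrite ?inE//.
    by rewrite -[X in measurable X]setTI; exact: measurable_opp_fun.
  by move=> x /=; rewrite !in_itv/= /opp_fun => ?; lra.
exists C => // n K K0.
have -> : prob n (first_below n K) = pstay (fun j w => - X j w) Q n K.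
  rewrite /pstay /prob; congr (fine (Q n _)); apply/seteqP; split=> w /= H1 k /H1;
    by rewrite psumN; lra.
apply: le_trans (H n K K0) _; apply: ler_wpM2l.
  by rewrite mulr_ge0 ?expR_ge0// ltW.
have -> : prob n (below n) = fine (Q n [set w | below n (X ^~ w)]) by [].
rewrite /prob; apply: fine_prob_le.
- apply: (measurable_event iopp (D := `I_n)).
  exact: measurable_above.
- by apply: (measurable_event iQ (D := `I_n)); exact: measurable_below.
- move=> w H1 k /H1; rewrite psumN; lra.
Qed.

(** Absorbs the squared window length of [concentration] into the exponential cost of the
    barrier. *)
Lemma sqr_le_expR (e y : R) : 0 < e -> 0 <= y -> (1 + y) ^+ 2 <= (1 + 2 / e) ^+ 2 * expR (e * y).
Proof.
move=> e0 y0; have -> : expR (e * y) = expR (e / 2 * y) ^+ 2.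
  by rewrite -expRM_natl; congr expR; field.
have h0 : 0 < 2 / e by rewrite divr_gt0.
have h1 : 0 <= e / 2 * y by rewrite mulr_ge0// divr_ge0// ltW.
have h2 : 1 + y <= (1 + 2 / e) * expR (e / 2 * y).
  apply: (@le_trans _ _ ((1 + 2 / e) * (1 + e / 2 * y))).
    rewrite (_ : (1 + 2 / e) * _ = 1 + 2 / e + e / 2 * y + y); last by field; rewrite gt_eqF.
    by move: h0 h1; move: (2 / e) (e / 2 * y) => z1 z2; lra.
  by apply: ler_wpM2l; [rewrite addr_ge0// ltW|exact: expR_ge1Dx].
rewrite -exprMn; apply: lerXn2r => //; rewrite nnegrE.
  by rewrite addr_ge0.
by apply: le_trans h2; rewrite addr_ge0.
Qed.

(* The first and the last n steps are controlled by [above_below] (the last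
   ones after time reversal), the middle m steps by concentration. *)
Lemma barrier_bound eps : 0 < eps -> exists2 C, 0 < C & forall n m (K L : R),
  (0 < m)%N -> 0 <= K -> 0 <= L ->
  prob (n + m + n) (first_below (n + m + n) K `&` [set x | - L <= psum x (n + m + n)])
    <= C * expR (eps * (K + L)) / (n.+1%:R * Num.sqrt m%:R).
Proof.
(* The first block costs e^{eK}, the last one e^{e(K+L)}, and the squared window another e^{e(K+L)};
   the total exponent e(3K + 2L) is at most eps (K + L). *)
move=> eps0; pose e := eps / 3.
have e0 : 0 < e by rewrite divr_gt0.
have [C1 C10 H1] := first_below_le e0.
have [C2 C20 H2] := pstay_climb iQ nu_int nu_center c0 cB p0 nu_right nu_left e0.
pose C3 := 32 / (p ^+ 2 * c ^+ 2 / 2 * (1 + 2 * B)^-1 ^+ 2).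
have C30 : 0 < C3 by exact: concentration_const_gt0.
exists (C1 * C2 * (C3 * (1 + 2 / e) ^+ 2)).
  have : 0 < 1 + 2 / e by rewrite addr_gt0// divr_gt0.
  by move=> ?; apply: mulr_gt0; apply: mulr_gt0 => //; exact: exprn_gt0.
move=> n m K L m0 K0 L0; set N := (n + m + n)%N.
pose D1 : set nat := [set i | (i < n)%N \/ (n + m <= i < N)%N].
pose D2 : set nat := [set i | (n <= i < n + m)%N].
have nN : (n <= N)%N by rewrite /N leq_addl.
have D12 : D1 `&` D2 = set0.
  by apply/seteqP; split=> i //= [[ni|/andP[i1 _]] /andP[i2 i3]]; [rewrite leqNgt ni in i2|rewrite leqNgt i3 in i1].
have D1N : D1 `<=` `I_N by move=> i /= [/leq_trans|/andP[]//]; apply.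
have D2N : D2 `<=` `I_N by move=> i /= /andP[_ /leq_trans]; apply; exact: leq_addr.
have iX : iid_on nu (Q N) X (D1 `|` D2) by apply: iid_onS (iQ N) => i [/D1N|/D2N].
pose rev i := (N - i.+1)%N.
have revD i : (i < n)%N -> (n + m <= rev i < N)%N.
  move=> iN; rewrite /rev /N leq_subRL ?(leq_trans iN)// addnC leq_add2l iN/=.
  by rewrite ltn_subrL (leq_trans _ nN)// (leq_ltn_trans _ iN).
pose F1 : set (env R `I_n) := first_below n K.
have mF1 : measurable F1 by exact: measurable_first_below.
(* Read backwards, the last block has partial sums S_N - S_{N-k}, which are at least -(K + L)
   because S_N >= -L and S_{N-k} <= K. *)
pose F2 : set (env R [set i | (n + m <= i < N)%N]) := [set x | stay n (K + L) (fun i => x (rev i))].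
have mF2 : measurable F2.
  rewrite -[F2]setTI.
  exact: (@measurable_reindex R _ `I_n rev _ measurableT _ (measurable_stay _ _)).
pose F : set (env R D1) := F1 `&` F2.
have mF : measurable F.
  apply: measurableI.
    by apply: measurable_env_sub mF1 => i; left.
  by apply: measurable_env_sub mF2 => i; right.
have PF1 : prob N F1 <= C1 * expR (e * K) * prob n (below n).
  by rewrite (prob_widen iQ mF1 nN); exact: H1.
have PF2 : prob N F2 <= C2 * expR (e * (K + L)) * prob n (above n).
  have -> : prob N F2 = pstay X Q n (K + L).
    apply: (prob_reindex iQ (measurable_stay _ _)) => // [i iN|i j iN jN].
      by have /andP[] := revD i iN.
    rewrite /rev => E; have : (N - (N - i.+1) = N - (N - j.+1))%N by rewrite E.
    by rewrite !subKn ?(leq_trans _ nN)// => -[].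
  by apply: H2; rewrite addr_ge0.
have PF : prob N F <= C1 * C2 * expR (e * (K + (K + L))) / n.+1%:R.
  rewrite /F (prob_indep iQ mF1 mF2).
  - apply: (@le_trans _ _ ((C1 * expR (e * K) * prob n (below n)) * (C2 * expR (e * (K + L)) * prob n (above n)))).
      by apply: ler_pM => //; exact: prob_ge0.
    rewrite ler_pdivlMr ?ltr0n//.
    have -> : expR (e * (K + (K + L))) = expR (e * K) * expR (e * (K + L)) by rewrite -expRD -mulrDr.
    have := above_below iQ n; rewrite -/(above n).
    set u := prob n (above n); set v := prob n (below n) => uv.
    rewrite [leLHS](_ : _ = (C1 * C2 * (expR (e * K) * expR (e * (K + L)))) * (n.+1%:R * (u * v))); last by ring.
    by rewrite ler_piMr// !mulr_ge0 ?expR_ge0// ltW.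
  - by move=> i /= /leq_trans; apply.
  - by move=> i /andP[].
  - apply/seteqP; split=> i //= [iN /andP[+ _]].
    by rewrite leqNgt (leq_trans iN)// leq_addr.
pose l := 1 + (K + L).
have l1 : 1 <= l by rewrite lerDl addr_ge0.
pose a (x : nat -> R) := psum x n + psum (fun i => x (n + m + i)%N) n.
pose M (y : nat -> R) := psum (fun i => y (n + i)%N) m.
have ma : measurable_fun [set: env R D1] a.
  apply: measurable_funD; first by apply: measurable_psum => i; left.
  apply: measurable_sum => i; apply: measurable_coord; right.
  by rewrite /= leq_addr ltn_add2l /=.
have mM : measurable_fun [set: env R D2] M.
  by apply: measurable_sum => i; apply: measurable_coord; rewrite /D2 /= leq_addr ltn_add2l /=.
pose E : set (env R D1 * env R D2) := [set z | `|M z.2 + a z.1| <= l].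
have mE : measurable E.
  apply: measurable_le_set; apply: measurableT_comp => //; apply: measurable_funD.
    exact: (measurableT_comp mM measurable_snd).
  exact: (measurableT_comp ma measurable_fst).
pose phi (z : env R D1 * env R D2) : \bar R := ((\1_F z.1 : R) * \1_E z)%:E.
have mphi : measurable_fun [set: env R D1 * env R D2] phi.
  apply/measurable_EFinP; apply: measurable_funM; last exact: measurable_indic.
  by apply: (measurableT_comp _ measurable_fst); exact: measurable_indic.
have phi0 z : (0 <= phi z)%E by rewrite lee_fin mulr_ge0.
have mFT := measurable_event iQ mF.
pose G : set (env R `I_N) := first_below N K `&` [set x | - L <= psum x N].
have mG : measurable G.
  by apply: measurableI; [exact: measurable_first_below|exact: measurable_psum_gt].
have mGT := measurable_event iQ mG.
have GE w : G (X ^~ w) -> F (X ^~ w) /\ E (X ^~ w, X ^~ w).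
  move=> [Gb /= GL].
  have psN : psum (X ^~ w) N = psum (X ^~ w) n + M (X ^~ w) + psum (fun i => X (n + m + i)%N w) n.
    by rewrite /N /M (psumD (X ^~ w)) (psumD (X ^~ w)).
  have N0 : (0 < N)%N by rewrite /N addn_gt0 addn_gt0 m0 orbT.
  split; last first.
    rewrite /E /= /a (_ : _ + _ = psum (X ^~ w) N); last by rewrite psN; ring.
    have := Gb N; rewrite N0 leqnn => /(_ isT) GN.
    by rewrite ler_norml /l; lra.
  split=> [k /andP[k0 kn]|k /andP[k0 kn]]; first by apply: Gb; rewrite k0 (leq_trans kn).
  rewrite (psum_rev (X ^~ w)) ?(leq_trans kn)//.
  suff : psum (X ^~ w) (N - k) <= K by lra.
  have [->|Nk] := posnP (N - k)%N; first by rewrite psum0.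
  by apply: Gb; rewrite Nk leq_subr.
have : (Q N [set w | G (X ^~ w)] <= \int[Q N]_w phi (X ^~ w, X ^~ w))%E.
  rewrite -[X in (Q N X <= _)%E]setIT -integral_indic//.
  apply: ge0_le_integral => //.
  - exact/measurable_EFinP/measurable_indic.
  - apply: (measurableT_comp mphi); apply: measurable_fun_pair.
      exact: (measurable_sample D1 (measurable_step iQ)).
    exact: (measurable_sample D2 (measurable_step iQ)).
  - move=> w _; rewrite lee_fin /phi /= indicE.
    have [Gw|_] := boolP (w \in _); last by rewrite mulr_ge0.
    have [Fw Ew] := GE w (set_mem Gw).
    by rewrite !indicE !mem_set// mulr1.
rewrite (iid_fubini iX D12 mphi phi0).
have inner x : (\int[Q N]_w' phi (x, X ^~ w') <= ((\1_F x : R) * (C3 * l ^+ 2 / Num.sqrt m%:R))%:E)%E.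
  have iX' : iid_on nu (Q N) (fun i => X (n + i)%N) `I_m.
    apply: (iid_reindex (iQ N)) => [i /= im|i j _ _ /addnI//].
    by apply: (@leq_trans (n + m)); rewrite ?ltn_add2l// leq_addr.
  have := concentration c0 cB p0 nu_right nu_left (a x) m0 l1 iX'.
  set A := [set w | _] => HA.
  have mA : measurable A.
    apply: measurable_le_set; apply: measurableT_comp => //; apply: measurable_funD => //.
    by apply: measurable_sum => i; exact: (measurable_step iQ).
  under eq_integral => w' _.
    rewrite /phi /= EFinM (_ : \1_E (x, X ^~ w') = \1_A w'); last by [].
    over.
  rewrite ge0_integralZl//; last exact/measurable_EFinP/measurable_indic.
  by rewrite integral_indic// setIT EFinM lee_wpmul2l.
rewrite -/(prob N G) => HG.
rewrite -lee_fin -EFin_prob//; apply: le_trans HG _.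
apply: (@le_trans _ _ (\int[Q N]_w ((\1_F (X ^~ w) : R) * (C3 * l ^+ 2 / Num.sqrt m%:R))%:E)%E).
  apply: ge0_le_integral => //.
  - by move=> w _; exact: integral_ge0.
  - pose psi (z : T * T) := phi (X ^~ z.1, X ^~ z.2).
    have mpsi : measurable_fun [set: T * T] psi.
      apply: (measurableT_comp mphi); apply: measurable_fun_pair.
        exact: (measurableT_comp (measurable_sample D1 (measurable_step iQ)) measurable_fst).
      exact: (measurableT_comp (measurable_sample D2 (measurable_step iQ)) measurable_snd).
    have psi0 z : (0 <= psi z)%E by exact: phi0.
    exact: (measurable_fun_fubini_tonelli_F (m2 := Q N) psi mpsi psi0).
  - by apply/measurable_EFinP; apply: measurable_funM => //; exact: (measurable_indic mFT).
have sm0 : 0 < Num.sqrt (m%:R : R) by rewrite sqrtr_gt0 ltr0n.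
have k0 : 0 <= C3 * l ^+ 2 / Num.sqrt m%:R.
  by rewrite divr_ge0 ?(ltW sm0)// mulr_ge0 ?sqr_ge0// ltW.
under eq_integral do rewrite EFinM.
rewrite ge0_integralZr//; last exact/measurable_EFinP/(measurable_indic mFT).
have -> : (\int[Q N]_w (\1_F (X ^~ w))%:E = (prob N F)%:E)%E.
  transitivity (\int[Q N]_w (\1_[set w | F (X ^~ w)] w)%:E)%E => //.
  by rewrite integral_indic// setIT /prob -EFin_prob.
rewrite -EFinM lee_fin.
apply: (@le_trans _ _ ((C1 * C2 * expR (e * (K + (K + L))) / n.+1%:R) * (C3 * ((1 + 2 / e) ^+ 2 * expR (e * (K + L))) / Num.sqrt m%:R))).
  apply: ler_pM => //; first exact: prob_ge0.
  rewrite ler_wpM2r ?invr_ge0 ?(ltW sm0)// ler_wpM2l ?(ltW C30)//.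
  by apply: sqr_le_expR => //; exact: addr_ge0.
have Ee : expR (e * (K + (K + L))) * expR (e * (K + L)) <= expR (eps * (K + L)).
  rewrite -expRD ler_expR /e.
  have := mulr_ge0 (ltW eps0) L0; have := mulr_ge0 (ltW eps0) K0; lra.
rewrite [leLHS](_ : _ = (C1 * C2 * (C3 * (1 + 2 / e) ^+ 2)) / (n.+1%:R * Num.sqrt m%:R) * (expR (e * (K + (K + L))) * expR (e * (K + L)))); last first.
  by field; rewrite !gt_eqF.
rewrite [leRHS](_ : _ = (C1 * C2 * (C3 * (1 + 2 / e) ^+ 2)) / (n.+1%:R * Num.sqrt m%:R) * expR (eps * (K + L))); last by ring.
apply: ler_wpM2l => //; apply: divr_ge0; last by apply: mulr_ge0 => //; exact: ltW.
by apply: mulr_ge0; apply: mulr_ge0; rewrite ?sqr_ge0// ltW.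
Qed.

End barrier.

(** The remainder of the division goes to the middle block, which is thus nonempty even when N <
    3. *)
Lemma thirds (N : nat) (n := (N %/ 3)%N) (m := (N - 2 * n)%N) : (0 < N)%N ->
  [/\ N = (n + m + n)%N, (0 < m)%N, (N <= 3 * n.+1)%N & (N <= 3 * m)%N].
Proof.
rewrite /m /n => N0; have := divn_eq N 3; have : (N %% 3 < 3)%N by rewrite ltn_mod.
move: N0; move: (N %/ 3)%N (N %% 3)%N => q r N0 r3 NE0; move: N0; rewrite NE0 => N0.
have -> : (q * 3 + r - 2 * q = q + r)%N.
  by rewrite mulnC -[3%N]/(1 + 2)%N mulnDl mul1n addnAC addnK.
have NE : (q * 3 + r = q + (q + r) + q)%N.
  by rewrite mulnC !mulSn mul0n addn0 -!addnA [(r + q)%N]addnC addnA.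
split=> //.
- by move: N0; rewrite NE; case: (q + r)%N (leq_addr r q) => //; rewrite leqn0 => /eqP ->.
- by rewrite [(3 * q.+1)%N]mulnC mulSn addnC leq_add2r ltnW.
- by rewrite mulnDr mulnC leq_add2l leq_pmull.
Qed.

Section low_barrier.
Context {R : realType} (nu : probability R R) d (T : measurableType d).
Variables (X : nat -> T -> R) (Q : nat -> probability T R).
Hypothesis iQ : forall N, iid_on nu (Q N) X `I_N.
Hypothesis nu_int : nu.-integrable [set: R] (EFin \o @id R).
Hypothesis nu_center : \int[nu]_x x = 0.
Variables (c B p : R).
Hypotheses (c0 : 0 < c) (cB : c <= B) (p0 : 0 < p).
Hypothesis nu_right : (p%:E <= nu `[c, B]%classic)%E.
Hypothesis nu_left : (p%:E <= nu `[(- B)%R, (- c)%R]%classic)%E.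

Lemma low_barrier (a b eps : R) : 0 <= a -> 0 <= b -> 0 < eps -> exists2 C, 0 < C & forall N,
  (0 < N)%N ->
  prob X Q N (first_below N (b * ln N%:R) `&` [set x | - (a * ln N%:R) <= psum x N])
    <= C * N%:R `^ (eps - 3 / 2).
Proof.
(* Then e (a + b) <= eps, so barriers proportional to ln N cost at most N^eps. The factor 9 below
   comes from N <= 3 (n + 1) and sqrt N <= 3 sqrt m. *)
move=> a0 b0 eps0; pose e := eps / (1 + a + b).
have ab0 : 0 < 1 + a + b by lra.
have e0 : 0 < e by rewrite divr_gt0.
have [C C0 H] := barrier_bound iQ nu_int nu_center c0 cB p0 nu_right nu_left e0.
exists (9 * C); first by rewrite mulr_gt0.
move=> N N0; pose n := (N %/ 3)%N; pose m := (N - 2 * n)%N.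
have [NE m0 n3 m3] : [/\ N = (n + m + n)%N, (0 < m)%N, (N <= 3 * n.+1)%N & (N <= 3 * m)%N] by exact: thirds.
have N1 : 1 <= N%:R :> R by rewrite ler1n.
have lN0 : 0 <= ln N%:R :> R by rewrite ln_ge0.
have := H n m (b * ln N%:R) (a * ln N%:R) m0 (mulr_ge0 b0 lN0) (mulr_ge0 a0 lN0).
rewrite -NE => /le_trans; apply.
have N00 : 0 < N%:R :> R by rewrite ltr0n.
have -> : N%:R `^ (eps - 3 / 2) = expR (eps * ln N%:R) / (N%:R * Num.sqrt N%:R).
  have NN0 : N%:R != 0 :> R by rewrite gt_eqF.
  rewrite powRB ?NN0 ?implybT//; congr (_ / _); first by rewrite /powR (negbTE NN0).
  rewrite (_ : 3 / 2 = 1 + 2^-1); last by field.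
  by rewrite powRD ?NN0 ?implybT// powRr1// powR12_sqrt.
have Ee : expR (e * (b * ln N%:R + a * ln N%:R)) <= expR (eps * ln N%:R).
  rewrite ler_expR -mulrDl mulrA ler_wpM2r// /e mulrAC ler_pdivrMr// ler_wpM2l ?(ltW eps0)//; lra.
have sN0 : 0 < Num.sqrt N%:R :> R by rewrite sqrtr_gt0.
have sm0 : 0 < Num.sqrt m%:R :> R by rewrite sqrtr_gt0 ltr0n.
have n13 : N%:R <= 3 * n.+1%:R :> R by rewrite -natrM ler_nat.
have sm3 : Num.sqrt N%:R <= 3 * Num.sqrt m%:R :> R.
  rewrite -(@ler_pXn2r _ 2) ?nnegrE ?mulr_ge0 ?sqrtr_ge0// exprMn !sqr_sqrtr// -natrX -natrM ler_nat.
  by apply: (leq_trans m3); rewrite leq_mul2r orbT.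
have n10 : 0 < n.+1%:R :> R by rewrite ltr0n.
rewrite ler_pdivrMr ?mulr_gt0//.
rewrite [leRHS](_ : _ = C * expR (eps * ln N%:R) * ((3 * n.+1%:R) * (3 * Num.sqrt m%:R) / (N%:R * Num.sqrt N%:R))); last first.
  by field; rewrite !gt_eqF.
rewrite -[leLHS]mulr1; apply: ler_pM => //.
- by rewrite mulr_ge0 ?expR_ge0// ltW.
- by rewrite ler_wpM2l// ltW.
rewrite ler_pdivlMr ?mulr_gt0// mul1r; apply: ler_pM => //; exact: ltW.
Qed.

End low_barrier.

(** * Moments of the cascade masses *)

Section power_inequalities.
Context {R : realType}.
Implicit Types a b p r y : R.

Lemma powR_le1D r p y : 0 <= y -> 0 <= r -> r <= p -> y `^ r <= 1 + y `^ p.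
Proof.
move=> y0 r0 rp; have [y1|y1] := leP y 1.
  apply: (@le_trans _ _ 1); last by rewrite lerDl powR_ge0.
  by have := ge0_ler_powR r0 (y0 : y \in Num.nneg) (ler01 : 1 \in Num.nneg) y1; rewrite powR1.
by apply: (le_trans (ler_powR (ltW y1) rp)); rewrite lerDr.
Qed.

(** For b <= a, a + b is a convex combination of a and 2a with weight b/a on 2a, and convexity of
    the power gives the bound; the other case is symmetric. In the cross terms the exponents are p -
    1 and 1, so moments of order p - 1 control them. *)
Lemma powRD_le p a b : 1 <= p -> 0 <= a -> 0 <= b ->
  (a + b) `^ p <= a `^ p + b `^ p +
    (2 `^ p - 1) * (a `^ (p - 1) * b + a * b `^ (p - 1)).
Proof.
move=> p1.
have p0 : p != 0 by rewrite gt_eqF// (lt_le_trans _ p1).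
have c0 : 0 <= 2 `^ p - 1 :> R.
  by rewrite subr_ge0 (le_trans _ (le1r_powR _ p1)) ?ler1n.
have key x y : 0 < x -> 0 <= y -> y <= x ->
    (x + y) `^ p <= x `^ p + (2 `^ p - 1) * (x `^ (p - 1) * y).
  move=> x0 y0 yx.
  have t01 : 0 <= y / x <= 1 by rewrite ler_pdivrMr// mul1r yx divr_ge0// ltW.
  have [t0 t1] := andP t01.
  pose t : {i01 R} := Itv01 t0 t1.
  have xin : x \in `[0, +oo[%classic by apply/mem_set; rewrite /= in_itv/= andbT ltW.
  have x2in : x + x \in `[0, +oo[%classic by apply/mem_set; rewrite /= in_itv/= andbT addr_ge0 ?ltW.
  have H : (y / x * (x + x) + unstable.onem (y / x) * x) `^ p <=
      y / x * (x + x) `^ p + unstable.onem (y / x) * x `^ p := convex_powR p1 t x2in xin.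
  move: H.
  have -> : y / x * (x + x) + unstable.onem (y / x) * x = x + y by rewrite /unstable.onem; field; rewrite gt_eqF.
  move=> /le_trans; apply.
  have xp : x `^ (p - 1) = x `^ p / x.
    by rewrite powRB ?(gt_eqF x0) ?implybT// powRr1// ltW.
  rewrite -mulr2n -(mulr_natl x) powRM ?(ltW x0)// xp /unstable.onem.
  rewrite le_eqVlt; apply/orP; left; apply/eqP; field; by rewrite gt_eqF.
move=> a0 b0.
have h0 x y : 0 <= x -> 0 <= y -> 0 <= (2 `^ p - 1) * (x `^ (p - 1) * y).
  by move=> x0 y0; rewrite !mulr_ge0// powR_ge0.
have [a00|a0'] := eqVneq a 0.
  by rewrite a00 add0r powR0// add0r lerDl mulrDr mul0r mulr0 addr0 h0.
have [b00|b0'] := eqVneq b 0.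
  by rewrite b00 addr0 powR0// addr0 lerDl mulrDr !mulr0 add0r [a * _]mulrC h0.
have ap : 0 < a by rewrite lt_neqAle eq_sym a0'.
have bp : 0 < b by rewrite lt_neqAle eq_sym b0'.
rewrite mulrDr [a * _]mulrC.
have [ab|ab] := leP b a.
  apply: (le_trans (key a b ap b0 ab)).
  by have := h0 b a b0 a0; have := powR_ge0 b p; lra.
rewrite addrC; apply: (le_trans (key b a bp a0 (ltW ab))).
by have := h0 a b a0 b0; have := powR_ge0 a p; lra.
Qed.

End power_inequalities.

Section words.

Lemma sum_tuple0 (V : nmodType) (F : seq bool -> V) :
  \sum_(s : 0.-tuple bool) F s = F [::].
Proof.
by rewrite (bigD1 [tuple])//= big1 ?addr0// => s /eqP[]; exact: tuple0.
Qed.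

Lemma sum_tupleS (V : nmodType) m (F : seq bool -> V) :
  \sum_(s : m.+1.-tuple bool) F s = \sum_(b : bool) \sum_(s : m.-tuple bool) F (b :: s).
Proof.
rewrite pair_big /= (reindex (fun z : bool * m.-tuple bool => [tuple of z.1 :: z.2])) //.
exists (fun s => (thead s, [tuple of behead s])) => [[b s] _|s _] /=.
  by congr (_, _); apply: val_inj.
by rewrite [RHS]tuple_eta; apply: val_inj.
Qed.

Lemma sum_tupleD (V : nmodType) n m (F : seq bool -> V) :
  \sum_(s : (n + m).-tuple bool) F s =
  \sum_(s : n.-tuple bool) \sum_(t : m.-tuple bool) F (s ++ t).
Proof.
elim: n F => [|n IH] F.
  by rewrite (sum_tuple0 (fun s => \sum_(t : m.-tuple bool) F (s ++ t))).
rewrite (@sum_tupleS _ (n + m) F).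
rewrite (@sum_tupleS _ n (fun s => \sum_(t : m.-tuple bool) F (s ++ t))).
apply: eq_bigr => b _.
exact: (IH (fun s => F (b :: s))).
Qed.

Definition nonroot : set (seq bool) := [set s | s != [::]].
Definition below_node (u : seq bool) : set (seq bool) :=
  [set s | exists2 t, nonroot t & s = u ++ t].

End words.

Section mass.
Context {R : realType} (g : R -> R).

(** The total mass of the cascade at depth [m]. Recursion on the first letter displays the
    fixed-point equation of the limit, W = sum_b g(x_b) W_b; [massE] recovers the sum over paths. *)
Fixpoint mass m (x : seq bool -> R) : R :=
  if m is m'.+1 then \sum_(b : bool) g (x [:: b]) * mass m' (fun s => x (b :: s)) else 1.

Lemma massE m x :
  mass m x = \sum_(s : m.-tuple bool) \prod_(k < m) g (x (take k.+1 s)).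
Proof.
elim: m x => [|m IH] x /=.
  by rewrite (sum_tuple0 (fun s => \prod_(k < 0) g (x (take k.+1 s)))) big_ord0.
rewrite (@sum_tupleS _ m (fun s => \prod_(k < m.+1) g (x (take k.+1 s)))).
apply: eq_bigr => b _; rewrite IH big_distrr/=; apply: eq_bigr => s _.
by rewrite big_ord_recl /= take0.
Qed.

Hypotheses (g0 : forall y, 0 <= g y) (mg : measurable_fun [set: R] g).

Lemma mass_ge0 m x : 0 <= mass m x.
Proof.
elim: m x => [|m IH] x //=; rewrite ?ler01//.
by apply: sumr_ge0 => b _; rewrite mulr_ge0.
Qed.

Lemma measurable_mass_below m u (A : set (seq bool)) : below_node u `<=` A ->
  measurable_fun [set: env R A] (fun x : env R A => mass m (fun s => x (u ++ s))).
Proof.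
elim: m u A => [|m IH] u A DA /=; first exact: measurable_cst.
apply: measurable_sum => b; apply: measurable_funM.
  by apply: (measurableT_comp mg); apply: measurable_coord; apply: DA; exists [:: b].
rewrite (_ : (fun x => _) = (fun x : env R A => mass m (fun s => x ((u ++ [:: b]) ++ s)))).
  apply: IH => _ [t _ ->]; apply: DA; exists (b :: t) => //; by rewrite -catA.
by apply/funext => x; congr mass; apply/funext => s; rewrite -catA.
Qed.

Lemma measurable_mass m (A : set (seq bool)) : nonroot `<=` A ->
  measurable_fun [set: env R A] (mass m : env R A -> R).
Proof. by move=> DA; apply: (@measurable_mass_below _ [::]) => _ [t Dt ->]; exact: DA. Qed.

End mass.

Section moments.
Context {R : realType} (nu : probability R R) (g : R -> R).
Hypotheses (g0 : forall y, 0 <= g y) (mg : measurable_fun [set: R] g).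
Hypothesis g1 : (\int[nu]_y (g y)%:E = (2^-1)%:E)%E.
Context d (T : measurableType d) (P : probability T R) (X : seq bool -> T -> R).
Hypothesis iX : iid_on nu P X nonroot.

Lemma integral_mass_below u m (f : R -> \bar R) : measurable_fun [set: R] f ->
  (forall y, 0 <= f y)%E ->
  (\int[P]_w f (mass g m (fun s => X (u ++ s) w)) = \int[P]_w f (mass g m (X ^~ w)))%E.
Proof.
move=> mf f0.
have iXu : iid_on nu P (fun s => X (u ++ s)) nonroot.
  apply: iid_reindex iX _ _ => [|s t _ _ /eqP]; first by case: u.
  by rewrite eqseq_cat// eqxx => /eqP.
apply: (iid_integral iXu iX (f := fun x => f (mass g m x))) => //.
by apply: (measurableT_comp mf); exact: measurable_mass.
Qed.

(** [h] is nonnegative on nonnegative reals only, so that the identity is allowed; since masses are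
    nonnegative, [h] may be replaced by its absolute value, to which the product formula applies. *)
Lemma integral_step_mass b m (f h : R -> \bar R) :
  measurable_fun [set: R] f -> measurable_fun [set: R] h ->
  (forall y, 0 <= f y)%E -> (forall y, (0 <= y)%R -> 0 <= h y)%E ->
  (\int[P]_w (f (X [:: b] w) * h (mass g m (fun s => X (b :: s) w))) =
   (\int[nu]_y f y) * (\int[P]_w h (mass g m (X ^~ w))))%E.
Proof.
move=> mf mh f0 h0.
have -> : (\int[P]_w h (mass g m (X ^~ w)) = \int[P]_w (`|h (mass g m (X ^~ w))|))%E.
  by apply: eq_integral => w _ /=; rewrite gee0_abs// h0// mass_ge0.
have ah w : h (mass g m (fun s => X (b :: s) w)) = `|h (mass g m (fun s => X (b :: s) w))|%E.
  by rewrite gee0_abs// h0// mass_ge0.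
under eq_integral do rewrite ah.
have mah : measurable_fun [set: R] (fun y => `|h y|%E) by exact: measurableT_comp.
rewrite -(@integral_mass_below [:: b] m (fun y => `|h y|%E))//.
have iX' : iid_on nu P X ([set [:: b]] `|` below_node [:: b]).
  by apply: iid_onS iX => _ [->|[t _ ->]].
rewrite -(iid_integral1 (j := [:: b]) iX)//.
apply: (iid_integralM iX' _ (f := fun x => f (x [:: b]))
  (g := fun x => `|h (mass g m (fun s => x (b :: s)))|%E)) => //.
- by apply/seteqP; split=> //= _ [-> [t + [/esym tE]]]; rewrite tE.
- by apply: (measurableT_comp mf); exact: measurable_coord.
- by apply: (measurableT_comp mah); exact: (measurable_mass_below _ _ (u := [:: b])).
Qed.

Definition moment p m : \bar R := (\int[P]_w (mass g m (X ^~ w) `^ p)%:E)%E.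

Lemma measurable_mass_sample u m : measurable_fun [set: T] (fun w => mass g m (fun s => X (u ++ s) w)).
Proof.
have H := measurable_mass_below mg m (@subset_refl _ (below_node u)).
exact: (measurableT_comp H (measurable_sample _ iX.1)).
Qed.

Lemma integral_mass m : (\int[P]_w (mass g m (X ^~ w))%:E = 1)%E.
Proof.
elim: m => [|m IH].
  exact: integral_prob_cst.
under eq_integral do rewrite /= big_bool /= EFinD.
have mt b : measurable_fun [set: T] (fun w => (g (X [:: b] w) * mass g m (fun s => X (b :: s) w))%:E).
  apply/measurable_EFinP; apply: measurable_funM; last exact: (measurable_mass_sample [:: b]).
  by apply: (measurableT_comp mg); exact: iX.1.
have t0 b w : (0 <= (g (X [:: b] w) * mass g m (fun s => X (b :: s) w))%:E)%E.
  by rewrite lee_fin mulr_ge0// mass_ge0.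
rewrite ge0_integralD//.
have E b : (\int[P]_w (g (X [:: b] w) * mass g m (fun s => X (b :: s) w))%:E = (2^-1)%:E)%E.
  under eq_integral do rewrite EFinM.
  rewrite (@integral_step_mass b m (EFin \o g) EFin)//= ?g1 ?IH ?mule1//.
  - exact/measurable_EFinP.
by rewrite (E true) (E false) -EFinD; congr EFin; field.
Qed.

Lemma moment_ge0 p m : (0 <= moment p m)%E.
Proof. by apply: integral_ge0 => w _; rewrite lee_fin powR_ge0. Qed.

Definition weight_moment p : \bar R := (\int[nu]_y (g y `^ p)%:E)%E.

(** [powRD_le] applied to the two subtrees of the root. They are independent, each with mean
    contribution 1/2, so a cross term factorizes into the moment of order p - 1 of one subtree times
    1/2. *)
Lemma moment_rec p m : 1 <= p ->
  (moment p m.+1 <= weight_moment p * moment p m + weight_moment p * moment p m +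
     (2 `^ p - 1)%:E * (weight_moment (p - 1) * moment (p - 1) m * (2^-1)%:E +
       weight_moment (p - 1) * moment (p - 1) m * (2^-1)%:E))%E.
Proof.
move=> p1.
have mgp r : measurable_fun [set: R] (fun y => g y `^ r).
  exact: measurableT_comp (measurable_powR r) mg.
pose t b w := g (X [:: b] w) * mass g m (fun s => X (b :: s) w).
have t0 b w : 0 <= t b w by rewrite mulr_ge0// mass_ge0.
have mt b : measurable_fun [set: T] (t b).
  apply: measurable_funM; last exact: (measurable_mass_sample [:: b]).
  by apply: (measurableT_comp mg); exact: iX.1.
have mtp b r : measurable_fun [set: T] (fun w => t b w `^ r).
  exact: measurableT_comp (measurable_powR r) (mt b).
have Et b r : (\int[P]_w (t b w `^ r)%:E = weight_moment r * moment r m)%E.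
  under eq_integral do rewrite powRM ?mass_ge0// EFinM.
  rewrite (@integral_step_mass b m (fun y => (g y `^ r)%:E) (fun y => (y `^ r)%:E))//=.
  - exact/measurable_EFinP.
  - by apply/measurable_EFinP; exact: measurable_powR.
  - by move=> y; rewrite lee_fin powR_ge0.
  - by move=> y; rewrite lee_fin powR_ge0.
have Et1 b : (\int[P]_w (t b w)%:E = (2^-1)%:E)%E.
  have := Et b 1; under eq_integral do rewrite powRr1//.
  move=> ->; rewrite /weight_moment /moment.
  under eq_integral do rewrite powRr1//.
  rewrite g1; under eq_integral do rewrite powRr1 ?mass_ge0//.
  by rewrite integral_mass mule1.
have iXT : iid_on nu P X ([set s | head true s /\ s != [::]] `|` [set s | ~~ head true s]).
  by apply: iid_onS iX => -[|[] s] //= [[]|].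
have mtenv b (A : set (seq bool)) : (forall s, A (b :: s)) ->
    measurable_fun [set: env R A] (fun x : env R A => g (x [:: b]) * mass g m (fun s => x (b :: s))).
  move=> Ab; apply: measurable_funM.
    by apply: (measurableT_comp mg); exact: measurable_coord.
  by apply: (measurable_mass_below mg m (u := [:: b])) => _ [s _ ->]; exact: Ab.
have Ett r r' : (\int[P]_w (t true w `^ r * t false w `^ r')%:E =
    (\int[P]_w (t true w `^ r)%:E) * (\int[P]_w (t false w `^ r')%:E))%E.
  under eq_integral do rewrite EFinM.
  apply: (iid_integralM iXT _
    (f := fun x => ((g (x [:: true]) * mass g m (fun s => x (true :: s))) `^ r)%:E)
    (g := fun x => ((g (x [:: false]) * mass g m (fun s => x (false :: s))) `^ r')%:E)).
  - by apply/seteqP; split=> // -[|[] s] //= [[]].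
  - by apply/measurable_EFinP; apply: (measurableT_comp (measurable_powR r)); exact: mtenv.
  - by apply/measurable_EFinP; apply: (measurableT_comp (measurable_powR r')); exact: mtenv.
  - by move=> x; rewrite lee_fin powR_ge0.
  - by move=> x; rewrite lee_fin powR_ge0.
have Ett1 : (\int[P]_w (t true w `^ (p - 1) * t false w)%:E =
    weight_moment (p - 1) * moment (p - 1) m * (2^-1)%:E)%E.
  have <- : (\int[P]_w (t true w `^ (p - 1) * t false w `^ 1)%:E)%E = (\int[P]_w (t true w `^ (p - 1) * t false w)%:E)%E.
    by apply: eq_integral => w _; rewrite powRr1.
  rewrite Ett (Et true); congr (_ * _)%E; rewrite -(Et1 false).
  by apply: eq_integral => w _; rewrite powRr1.
have Ett2 : (\int[P]_w (t true w * t false w `^ (p - 1))%:E =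
    weight_moment (p - 1) * moment (p - 1) m * (2^-1)%:E)%E.
  have <- : (\int[P]_w (t true w `^ 1 * t false w `^ (p - 1))%:E)%E = (\int[P]_w (t true w * t false w `^ (p - 1))%:E)%E.
    by apply: eq_integral => w _; rewrite powRr1.
  rewrite Ett (Et false) muleC; congr (_ * _)%E; rewrite -(Et1 true).
  by apply: eq_integral => w _; rewrite powRr1.
have c0 : 0 <= 2 `^ p - 1 :> R by rewrite subr_ge0 (le_trans _ (le1r_powR _ p1)) ?ler1n.
rewrite -{1}Ett1 -Ett2 -{1}(Et true) -(Et false).
have mEt b : measurable_fun [set: T] (fun w => (t b w `^ p)%:E) by exact/measurable_EFinP.
have m1 : measurable_fun [set: T] (fun w => (t true w `^ (p - 1) * t false w)%:E).
  by apply/measurable_EFinP; exact: measurable_funM.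
have m2 : measurable_fun [set: T] (fun w => (t true w * t false w `^ (p - 1))%:E).
  by apply/measurable_EFinP; exact: measurable_funM.
have p0 b r w : (0 <= (t b w `^ r)%:E)%E by rewrite lee_fin powR_ge0.
have q0 b b' r w : (0 <= (t b w `^ r * t b' w)%:E)%E by rewrite lee_fin mulr_ge0// powR_ge0.
have q0' b b' r w : (0 <= (t b w * t b' w `^ r)%:E)%E by rewrite lee_fin mulr_ge0// powR_ge0.
rewrite -ge0_integralD// -ge0_integralD// -ge0_integralZl//; last 2 first.
- exact: emeasurable_funD.
- by move=> w _; rewrite adde_ge0.
have s0 w : (0 <= (2 `^ p - 1)%:E * ((t true w `^ (p - 1) * t false w)%:E + (t true w * t false w `^ (p - 1))%:E))%E.
  by apply: mule_ge0; [rewrite lee_fin|exact: adde_ge0].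
have ms : measurable_fun [set: T] (fun w => (2 `^ p - 1)%:E * ((t true w `^ (p - 1) * t false w)%:E + (t true w * t false w `^ (p - 1))%:E))%E.
  by apply: emeasurable_funM => //; exact: emeasurable_funD.
rewrite -ge0_integralD//; last 2 first.
- by move=> w _; rewrite adde_ge0.
- exact: emeasurable_funD.
apply: ge0_le_integral => //.
- by move=> w _; rewrite lee_fin powR_ge0.
- by apply/measurable_EFinP; apply: (measurableT_comp (measurable_powR p)); exact: (measurable_mass_sample [::]).
- by apply: emeasurable_funD => //; exact: emeasurable_funD.
- move=> w _; rewrite /= big_bool.
  have := powRD_le p1 (t0 true w) (t0 false w); rewrite -lee_fin; exact.
Qed.

(** In the manner of Kahane and Peyriere: [moment_rec] controls order r by order r - 1, so orders
    are climbed by unit steps from r <= 1, where the mean 1 suffices. At each order 2 E g^r < 1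
    makes the recursion contracting. *)
Lemma mass_moments_bounded p : 0 <= p ->
  (forall r, 1 < r -> r <= p -> (weight_moment r + weight_moment r < 1)%E) ->
  exists C, forall m, (moment p m <= C%:E)%E.
Proof.
move=> p0 H.
have mm m : measurable_fun [set: T] (fun w => mass g m (X ^~ w)) by exact: (measurable_mass_sample [::]).
have mmp q m : measurable_fun [set: T] (fun w => (mass g m (X ^~ w) `^ q)%:E).
  by apply/measurable_EFinP; exact: (measurableT_comp (measurable_powR q)).
have small r : 0 <= r -> r <= 1 -> exists C, forall m, (moment r m <= C%:E)%E.
  move=> r0 r1; exists 2 => m.
  have -> : 2%:E = (\int[P]_w (1 + (mass g m (X ^~ w))%:E))%E.
    rewrite ge0_integralD//; last 2 first.
    - by move=> w _; rewrite lee_fin mass_ge0.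
    - exact/measurable_EFinP.
    by rewrite integral_mass integral_prob_cst -EFinD.
  apply: ge0_le_integral => //.
  - by move=> w _; rewrite lee_fin powR_ge0.
  - by apply: emeasurable_funD => //; exact/measurable_EFinP.
  - move=> w _; rewrite -EFinD lee_fin.
    by have := powR_le1D (mass_ge0 g0 m (X ^~ w)) r0 r1; rewrite powRr1// mass_ge0.
suff K k r : 0 <= r -> r <= k%:R -> r <= p -> exists C, forall m, (moment r m <= C%:E)%E.
  by apply: (K (Num.trunc p).+1) => //; rewrite ltW// truncnS_gt.
elim: k r => [|k IH] r r0 rk rp; first by apply: small => //; exact: le_trans rk ler01.
have [r1|r1] := leP r 1; first exact: small.
have [C HC] := IH (r - 1) ltac:(lra) ltac:(rewrite -natr1 in rk; lra) ltac:(lra).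
have Hr := H r r1 rp.
have mgp q : measurable_fun [set: R] (fun y => (g y `^ q)%:E).
  by apply/measurable_EFinP; exact: measurableT_comp (measurable_powR q) mg.
have W0 q : (0 <= weight_moment q)%E by apply: integral_ge0 => y _; rewrite lee_fin powR_ge0.
have [G GE] : exists G, weight_moment r = G%:E.
  exists (fine (weight_moment r)); rewrite fineK// ge0_fin_numE//.
  by apply: le_lt_trans (lt_trans Hr (ltry 1)); rewrite leeDl.
have G0 : 0 <= G by rewrite -lee_fin -GE.
have G1 : G + G < 1 by rewrite -lte_fin EFinD -GE.
have [G' GE'] : exists G', weight_moment (r - 1) = G'%:E.
  exists (fine (weight_moment (r - 1))); rewrite fineK// ge0_fin_numE//.
  apply: (@le_lt_trans _ _ (\int[nu]_y (1 + (g y `^ r)%:E))%E).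
    apply: ge0_le_integral => //.
    - by move=> y _; rewrite lee_fin powR_ge0.
    - exact: emeasurable_funD.
    - by move=> y _; rewrite -EFinD lee_fin powR_le1D//; lra.
  rewrite ge0_integralD//; last by move=> y _; rewrite lee_fin powR_ge0.
  rewrite -/(weight_moment r) GE integral_prob_cst.
  by rewrite -EFinD ltry.
have G'0 : 0 <= G' by rewrite -lee_fin -GE'.
have C0 : 0 <= C by rewrite -lee_fin; apply: le_trans (moment_ge0 (r - 1) 0) (HC 0%N).
have c0 : 0 <= 2 `^ r - 1 :> R by rewrite subr_ge0 (le_trans _ (le1r_powR _ (ltW r1))) ?ler1n.
pose K := (2 `^ r - 1) * (G' * C * 2^-1 + G' * C * 2^-1).
have K0 : 0 <= K by rewrite mulr_ge0// addr_ge0// !mulr_ge0.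
have G2 : 0 < 1 - (G + G) by lra.
(* The recursion reads M_{m+1} <= 2G M_m + K with 2G < 1. The bound is its fixed point, raised by 1
   to dominate the initial value M_0 = 1. *)
exists (1 + K / (1 - (G + G))) => m; elim: m => [|m IHm].
  rewrite /moment /=; under eq_integral do rewrite powR1.
  by rewrite integral_prob_cst lee_fin lerDl divr_ge0// ltW.
apply: (le_trans (moment_rec m (ltW r1))); rewrite GE GE'.
apply: (@le_trans _ _ ((G%:E * (1 + K / (1 - (G + G)))%:E + G%:E * (1 + K / (1 - (G + G)))%:E + K%:E)))%E.
  apply: leeD; first by apply: leeD; apply: lee_wpmul2l.
  rewrite /K EFinM; apply: lee_wpmul2l => //.
  rewrite EFinD !EFinM; apply: leeD; apply: lee_wpmul2r => //; rewrite ?lee_fin//; exact: lee_wpmul2l.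
rewrite -!EFinM -!EFinD lee_fin.
have -> : K = K / (1 - (G + G)) * (1 - (G + G)) by rewrite divfK// gt_eqF.
rewrite mulfK ?gt_eqF//; move: (K / _) => k'; nra.
Qed.

End moments.

(** * Large nodes of the cascade *)

(** Step [k] sits at the prefix of length k + 1, as the root carries no variable. *)
Definition path_steps {R : realType} (s : seq bool) (x : seq bool -> R) (k : nat) : R :=
  x (take k.+1 s).

Section spine.
Context {R : realType} (nu0 nu : probability R R).
Hypothesis nuE : forall B, measurable B -> (nu B = \int[nu0]_(y in B) (2 * expR y)%:E)%E.
Context d (T : measurableType d) (P : probability T R) (X : seq bool -> T -> R).
Hypothesis iX : iid_on nu0 P X nonroot.

Let e2 (y : R) := 2 * expR y.
Let e20 y : 0 <= e2 y. Proof. by rewrite mulr_ge0// expR_ge0. Qed.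
Let me2 : measurable_fun [set: R] e2.
Proof. by apply: measurable_funM => //; exact: measurable_expR. Qed.
Let e21 : (\int[nu0]_y (e2 y)%:E = 1)%E.
Proof. by rewrite -nuE//; exact: (probability_setT nu). Qed.

Lemma iid_path s : iid_on nu0 P (fun k w => X (take k.+1 s) w) `I_(size s).
Proof.
apply: iid_reindex iX _ _ => [k /= ks|i j /= iks jks /(congr1 size)].
  by rewrite /nonroot /= -size_eq0 size_takel.
by rewrite !size_takel// => -[].
Qed.

(** Along any node of length n the steps have the same law as along this one ray, so a single tilted
    walk serves all nodes. *)
Definition spine (k : nat) : T -> R := X (nseq k.+1 true).

Lemma iid_spine N : iid_on nu0 P spine `I_N.
Proof.
apply: iid_reindex iX _ _ => [k /= ks|i j /= iks jks /(congr1 size)] //.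
by rewrite /= !size_nseq => -[].
Qed.

Definition spine_tilt N : probability T R := tilt e20 me2 e21 (iid_spine N).

Lemma iid_spine_tilt N : iid_on nu (spine_tilt N) spine `I_N.
Proof. exact: tilt_iid. Qed.

(** Stated node by node: the product of the densities 2 e^xi along the ray is 2^n e^{S_n}. The sum
    over the nodes of a generation is taken later, where it cancels the factor 2^n. *)
Lemma many_to_one s (F : env R `I_(size s) -> \bar R) :
  measurable_fun [set: env R `I_(size s)] F -> (forall x, 0 <= F x)%E ->
  (\int[P]_w (F (path_steps s (X ^~ w)) * (expR (psum (path_steps s (X ^~ w)) (size s)))%:E)
    * (2 ^+ size s)%:E = \int[spine_tilt (size s)]_w F (spine ^~ w))%E.
Proof.
move=> mF F0; set n := size s.
have mS : measurable_fun [set: env R `I_n] (fun x : env R `I_n => (expR (psum x n))%:E).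
  have H : measurable_fun [set: env R `I_n] (fun x : env R `I_n => psum x n) by exact: measurable_psum.
  by apply/measurable_EFinP; exact: (measurableT_comp (@measurable_expR R) H).
have mG : measurable_fun [set: env R `I_n] (fun x : env R `I_n => F x * (expR (psum x n))%:E)%E.
  exact: emeasurable_funM.
have G0 (x : nat -> R) : (0 <= F x * (expR (psum x n))%:E)%E.
  by rewrite mule_ge0// lee_fin expR_ge0.
rewrite (iid_integral (iid_path s) (iid_spine n) mG G0).
rewrite (@ge0_integral_density _ _ _ P (spine_tilt n)
  (fun w => \prod_(k < n) e2 (spine k w)) (fun w => F (spine ^~ w))); last 5 first.
- by move=> w; apply: prodr_ge0 => k _; exact: e20.
- by apply: measurable_prod => k _; apply: (measurableT_comp me2); exact: iX.1.
- by [].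
- exact: measurableT_comp mF (measurable_sample _ (iid_spine n).1).
- by move=> w.
rewrite -ge0_integralZr//; last exact: (measurableT_comp mG (measurable_sample `I_n (iid_spine n).1)).
apply: eq_integral => w _; rewrite -muleA -EFinM; congr (_ * _%:E)%E.
by rewrite /e2 big_split /= prodr_const card_ord -expR_sum mulrC.
Qed.

End spine.

Section pointwise.
Context {R : realType}.

(* When S < - A L, the mass W has to be so large that W ^ p compensates for the
   factor expR S, because p * beta > 1. *)
Lemma bad_term_ge1 (L S W beta gamma A p : R) : 0 <= L -> 0 <= W -> 0 <= p ->
  1 < p * beta -> gamma <= A ->
  expR (- (gamma * beta * L)) < expR (beta * S) * W ->
  1 <= expR (gamma * L) * (((- (A * L) <= S)%R%:R + expR (- ((p * beta - 1) * (A - gamma) * L)))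
     * expR S * (1 + W `^ p)).
Proof.
move=> L0 W0 p0 b1 gA H.
have W00 : 0 < W.
  rewrite lt_neqAle W0 andbT eq_sym; apply/eqP => W00; move: H.
  by rewrite W00 mulr0 ltNge expR_ge0.
have b0 : 0 < p * beta - 1 by lra.
have AgL : 0 <= (A - gamma) * L by rewrite mulr_ge0// subr_ge0.
have Wp : expR (- (p * beta * (S + gamma * L))) <= W `^ p.
  rewrite /powR gt_eqF// ler_expR.
  have : - (gamma * beta * L) < beta * S + ln W.
    by rewrite -ltr_expR expRD lnK.
  by move=> /ltW /(ler_wpM2l p0) h; lra.
have d0 := expR_ge0 (- ((p * beta - 1) * (A - gamma) * L)).
have -> : expR (gamma * L) * (((- (A * L) <= S)%R%:R + expR (- ((p * beta - 1) * (A - gamma) * L)))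
     * expR S * (1 + W `^ p)) = ((- (A * L) <= S)%R%:R + expR (- ((p * beta - 1) * (A - gamma) * L)))
     * (expR (S + gamma * L) * (1 + W `^ p)) by rewrite expRD; ring.
have Wp0 := powR_ge0 W p.
have e0 := expR_ge0 (S + gamma * L).
have [SA|SA] := leP (- (A * L)) S => /=; last first.
  rewrite add0r; set y := S + gamma * L.
  have yA : y <= - ((A - gamma) * L) by rewrite /y mulrBl; lra.
  apply: (@le_trans _ _ (expR (- ((p * beta - 1) * (A - gamma) * L)) * (expR y * expR (- (p * beta * y))))).
    rewrite -!expRD -[leLHS]expR0 ler_expR.
    have /(ler_wpM2l (ltW b0)) : (A - gamma) * L <= - y by lra.
    by lra.
  apply: ler_wpM2l => //; apply: ler_wpM2l => //; rewrite /y; lra.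
apply: (@le_trans _ _ (1 * (expR (S + gamma * L) * (1 + W `^ p)))); last first.
  by apply: ler_wpM2r; [rewrite mulr_ge0//; lra|lra].
(* In 1 + W^p the summand 1 serves S + gamma L >= 0, and W^p serves the opposite sign, where p beta
   > 1 compensates for e^{S + gamma L}. *)
rewrite mul1r; have [y0|y0] := leP 0 (S + gamma * L).
  apply: (@le_trans _ _ (1 * 1)); first by rewrite mulr1.
  by apply: ler_pM => //; [rewrite -[leLHS]expR0 ler_expR|lra].
apply: (@le_trans _ _ (expR (S + gamma * L) * expR (- (p * beta * (S + gamma * L))))).
  rewrite -expRD -[leLHS]expR0 ler_expR.
  by move: y0 b0; move: (S + gamma * L) (p * beta) => y b; nra.
by apply: ler_wpM2l => //; lra.
Qed.

End pointwise.

Section bad.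
Context {R : realType} (nu0 nu : probability R R).
Hypothesis nuE : forall B, measurable B -> (nu B = \int[nu0]_(y in B) (2 * expR y)%:E)%E.
Context d (T : measurableType d) (P : probability T R) (X : seq bool -> T -> R).
Hypothesis iX : iid_on nu0 P X nonroot.
Variable g : R -> R.
Hypotheses (g0 : forall y, 0 <= g y) (mg : measurable_fun [set: R] g).

(** The mass below a node is cut at depth [m], where it is a finite sum; [bad_decay] is uniform in
    [m]. *)
Definition bad (theta beta : R) n m : set T :=
  [set w | exists2 s : seq bool, size s = n &
     theta < expR (beta * psum (path_steps s (X ^~ w)) n) * mass g m (fun t => X (s ++ t) w)].

Lemma integral_path_mass s m (F : env R `I_(size s) -> \bar R) (h : R -> \bar R) :
  measurable_fun [set: env R `I_(size s)] F -> (forall x, 0 <= F x)%E ->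
  measurable_fun [set: R] h -> (forall y, 0 <= h y)%E ->
  (\int[P]_w (F (path_steps s (X ^~ w)) * (expR (psum (path_steps s (X ^~ w)) (size s)))%:E *
     h (mass g m (fun t => X (s ++ t) w))) * (2 ^+ size s)%:E =
   (\int[spine_tilt nuE iX (size s)]_w F (spine X ^~ w)) * \int[P]_w h (mass g m (X ^~ w)))%E.
Proof.
move=> mF F0 mh h0; rewrite -many_to_one// -(@integral_mass_below _ nu0 _ mg _ _ P X iX s m h)//.
rewrite muleAC; congr (_ * _)%E.
pose A : set (seq bool) := [set t | exists2 k, (k < size s)%N & t = take k.+1 s].
have iX' : iid_on nu0 P X (A `|` below_node s).
  apply: iid_onS iX => _ [[k ks ->]|[t t0 ->]]; rewrite /nonroot /= -size_eq0.
    by rewrite size_takel.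
  by rewrite size_cat addn_eq0 negb_and !size_eq0 (t0 : t != [::]) orbT.
have mpath : measurable_fun [set: env R A] (path_steps s : env R A -> env R `I_(size s)).
  by apply: measurable_envP => k ks; apply: measurable_coord; exists k.
apply: (iid_integralM iX' _
  (f := fun x => (F (path_steps s x) * (expR (psum (path_steps s x) (size s)))%:E)%E)
  (g := fun x => h (mass g m (fun t => x (s ++ t))))).
- apply/seteqP; split=> //= t [[k ks ->] [u u0 /(congr1 size)]].
  rewrite size_takel// size_cat => ksE; move: ks; rewrite ksE -[X in (_ <= X)%N]addn0 leq_add2l leqn0 size_eq0.
  by move=> /eqP uE; move: u0; rewrite uE.
- apply: emeasurable_funM; first exact: measurableT_comp mF mpath.
  have H : measurable_fun [set: env R `I_(size s)] (fun x : env R `I_(size s) => psum x (size s)).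
    exact: measurable_psum.
  by apply/measurable_EFinP; apply: (measurableT_comp (@measurable_expR R)); exact: (measurableT_comp H mpath).
- by apply: (measurableT_comp mh); exact: (measurable_mass_below mg m (u := s)).
- by move=> x; rewrite mule_ge0// lee_fin expR_ge0.
- by move=> x.
Qed.

Lemma measurable_path_psum s k : measurable_fun [set: T] (fun w => psum (path_steps s (X ^~ w)) k).
Proof. by apply: measurable_sum => i; exact: iX.1. Qed.

Lemma measurable_bad theta beta n m : measurable (bad theta beta n m).
Proof.
have -> : bad theta beta n m = \bigcup_s (if size s == n then
    [set w | theta < expR (beta * psum (path_steps s (X ^~ w)) n) * mass g m (fun t => X (s ++ t) w)]
    else set0).
  apply/seteqP; split=> w /= [s]; first by move=> sn H; exists s; rewrite // sn eqxx.
  by move=> _; case: eqP => // sn H; exists s.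
apply: countable_bigcupT_measurable => [|s]; first exact: countableP.
case: ifP => // _.
apply: measurable_gt_set; apply: measurable_funM.
  apply: (measurableT_comp (@measurable_expR R)); apply: measurable_funM => //.
  exact: measurable_path_psum.
exact: (measurable_mass_sample mg iX).
Qed.

Lemma integral_path_expR s : (\int[P]_w (expR (psum (path_steps s (X ^~ w)) (size s)))%:E = (2 ^- size s)%:E)%E.
Proof.
have := @many_to_one _ _ _ nuE _ _ P X iX s (fun=> 1%E) (measurable_cst _) (fun=> lee01).
rewrite integral_prob_cst.
under eq_integral do rewrite mul1e.
move=> H.
have := congr1 (fun z => z * (2 ^- size s)%:E)%E H.
by rewrite -muleA -EFinM divff ?mule1 ?mul1e// expf_neq0.
Qed.

Variables (n m : nat) (beta gamma p A C K L : R).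
Hypotheses (L0 : 0 <= L) (p0 : 0 <= p) (b1 : 1 < p * beta) (gA : gamma <= A).
Hypothesis HC : (moment g P X p m <= C%:E)%E.

Let D : set (nat -> R) := first_below n K `&` [set x | - (A * L) <= psum x n].
Let delta := expR (- ((p * beta - 1) * (A - gamma) * L)).

Let mD : @measurable _ (env R `I_n) D.
Proof.
by apply: measurableI; [exact: measurable_first_below|exact: measurable_psum_gt].
Qed.

Let S s w := psum (path_steps s (X ^~ w)) (size s).
Let W s w := mass g m (fun t => X (s ++ t) w).

(** On the bad event [high] and [low] add up to at least 1. If the path to the bad node exceeds K at
    time k + 1, its prefix of that length contributes at least 1 to [high k]; otherwise the node
    itself contributes at least 1 to [low], by [bad_term_ge1]. *)
Let high (k : 'I_n) w := \sum_(s : k.+1.-tuple bool) expR (S s w) * expR (- K).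
Let low w := \sum_(s : n.-tuple bool)
  expR (gamma * L) * ((\1_D (path_steps s (X ^~ w)) + delta) * expR (S s w) * (1 + W s w `^ p)).

Lemma bad_le_terms w : bad (expR (- (gamma * beta * L))) beta n m w ->
  1 <= (\sum_(k < n) high k w) + low w.
Proof.
move=> [s sn H].
have high0 k : 0 <= high k w by apply: sumr_ge0 => t _; rewrite mulr_ge0// expR_ge0.
have low0 (t : n.-tuple bool) : 0 <= expR (gamma * L) * ((\1_D (path_steps t (X ^~ w)) + delta) * expR (S t w) * (1 + W t w `^ p)).
  by rewrite mulr_ge0 ?expR_ge0// mulr_ge0 ?addr_ge0 ?powR_ge0// mulr_ge0 ?expR_ge0// addr_ge0// expR_ge0.
have [|/existsNP[k /not_implyP[/andP[k0 kn] /negP]]] := pselect (first_below n K (path_steps s (X ^~ w))).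
  move=> fb; apply: ler_wpDl; first by apply: sumr_ge0.
  pose t : n.-tuple bool := tcast sn (in_tuple s).
  have ts : tval t = s by rewrite val_tcast.
  rewrite /low (bigD1 t)//=; apply: ler_wpDr; first by apply: sumr_ge0.
  rewrite ts.
  have -> : \1_D (path_steps s (X ^~ w)) = (- (A * L) <= S s w)%R%:R :> R.
    rewrite indicE; congr (_%:R)%R; rewrite /S sn; congr nat_of_bool.
    apply/idP/idP => [/set_mem[]//|h]; exact/mem_set.
  apply: bad_term_ge1 => //; first exact: mass_ge0.
  by rewrite /S sn.
rewrite -ltNge => Kk; apply: ler_wpDr; first by apply: sumr_ge0.
case: k k0 kn Kk => // k _ kn Kk.
rewrite (bigD1 (Ordinal kn))//=; apply: ler_wpDr; first by apply: sumr_ge0.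
have sk : size (take k.+1 s) == k.+1 by rewrite size_takel// sn.
rewrite /high (bigD1 (Tuple sk))//=; apply: ler_wpDr.
  by apply: sumr_ge0 => t _; rewrite mulr_ge0// expR_ge0.
rewrite -expRD -[leLHS]expR0 ler_expR subr_ge0 ltW// (lt_le_trans Kk)// /S.
rewrite (eqP sk) /psum le_eqVlt; apply/orP; left; apply/eqP; apply: eq_bigr => i _.
by rewrite /path_steps take_takel// ltn_ord.
Qed.

(** In each generation the sum of e^{S_s} has mean 1, so every [high k] has mean e^{-K}. In [low]
    the mass below a node is independent of the path to it, and its factor has mean at most 1 +
    C. *)
Lemma bad_prob_le : (P (bad (expR (- (gamma * beta * L))) beta n m) <=
  (n%:R * expR (- K) +
   expR (gamma * L) * ((prob (spine X) (spine_tilt nuE iX) n D + delta) * (1 + C)))%:E)%E.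
Proof.
have mb := measurable_bad (expR (- (gamma * beta * L))) beta n m.
have mS s : measurable_fun [set: T] (S s) by exact: measurable_path_psum.
have meS s : measurable_fun [set: T] (fun w => expR (S s w)) by exact: measurableT_comp.
have mW s : measurable_fun [set: T] (W s) by exact: (measurable_mass_sample mg iX).
have mterm (s : n.-tuple bool) : measurable_fun [set: T]
    (fun w => (\1_D (path_steps s (X ^~ w)) + delta) * expR (S s w) * (1 + W s w `^ p)).
  apply: measurable_funM.
    apply: measurable_funM => //; apply: measurable_funD => //.
    have iXs : iid_on nu0 P (fun k w => X (take k.+1 s) w) `I_n.
      by have := iid_path iX s; rewrite size_tuple.
    have m1 : measurable_fun [set: env R `I_n] (\1_D : env R `I_n -> R) by exact: measurable_indic.
    exact: (measurableT_comp m1 (measurable_sample _ iXs.1)).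
  by apply: measurable_funD => //; exact: (measurableT_comp (measurable_powR p)).
have high0 k w : 0 <= high k w by apply: sumr_ge0 => t _; rewrite mulr_ge0// expR_ge0.
have d0 : 0 <= delta by exact: expR_ge0.
have term0 (t : seq bool) w : 0 <= (\1_D (path_steps t (X ^~ w)) + delta) * expR (S t w) * (1 + W t w `^ p).
  by rewrite mulr_ge0 ?addr_ge0 ?powR_ge0// mulr_ge0 ?expR_ge0// addr_ge0.
have mhigh k : measurable_fun [set: T] (high k).
  by apply: measurable_sum => s; exact: measurable_funM.
have mlow : measurable_fun [set: T] low.
  by apply: measurable_sum => s; exact: measurable_funM.
have low0 w : 0 <= low w by apply: sumr_ge0 => t _; rewrite mulr_ge0// expR_ge0.
have Ehigh (k : 'I_n) : (\int[P]_w (high k w)%:E = (expR (- K))%:E)%E.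
  under eq_integral do rewrite -sumEFin.
  rewrite ge0_integral_sum//; last by move=> s; apply/measurable_EFinP; exact: measurable_funM.
  rewrite (eq_bigr (fun=> (2 ^- k.+1 * expR (- K))%:E)); last first.
    move=> s _; under eq_integral do rewrite EFinM.
    rewrite ge0_integralZr//; last exact/measurable_EFinP.
    by rewrite integral_path_expR size_tuple -EFinM.
  rewrite sumEFin sumr_const card_tuple card_bool; congr (_%:E).
  rewrite -[LHS]mulr_natl natrX mulrA divff ?mul1r//.
have Elow (s : n.-tuple bool) : (\int[P]_w ((\1_D (path_steps s (X ^~ w)) + delta) * expR (S s w) * (1 + W s w `^ p))%:E
    <= (2 ^- n * ((prob (spine X) (spine_tilt nuE iX) n D + delta) * (1 + C)))%:E)%E.
  have sn := size_tuple s.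
  pose F (x : nat -> R) := (\1_D x + delta)%:E.
  have mF k : k = n -> measurable_fun [set: env R `I_k] F.
    have mI : measurable_fun [set: env R `I_n] (\1_D : env R `I_n -> R) by exact: measurable_indic.
    by move=> ->; apply/measurable_EFinP; apply: (measurable_funD mI).
  have F0 x : (0 <= F x)%E by rewrite lee_fin addr_ge0.
  have mh : measurable_fun [set: R] (fun y : R => (1 + y `^ p)%:E).
    by apply/measurable_EFinP; apply: measurable_funD => //; exact: measurable_powR.
  have h0 (y : R) : (0 <= (1 + y `^ p)%:E)%E by rewrite lee_fin addr_ge0// powR_ge0.
  have := @integral_path_mass s m F (fun y => (1 + y `^ p)%:E) (mF _ sn) F0 mh h0.
  rewrite sn; set I1 := (\int[P]_w _)%E; set I2 := (\int[_]_w _)%E; set I3 := (\int[P]_w _)%E => H.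
  have -> : (\int[P]_w ((\1_D (path_steps s (X ^~ w)) + delta) * expR (S s w) * (1 + W s w `^ p))%:E = I1)%E.
    by apply: eq_integral => w _; rewrite /S sn.
  have I2E : I2 = (prob (spine X) (spine_tilt nuE iX) n D + delta)%:E.
    have mDs : measurable [set w | D (spine X ^~ w)].
      exact: (measurable_event (iid_spine_tilt nuE iX) (D := `I_n)).
    rewrite /I2 /F; under eq_integral do rewrite EFinD.
    rewrite ge0_integralD//; last by apply/measurable_EFinP; exact: measurable_indic mDs.
    rewrite integral_prob_cst (integral_indic _ measurableT mDs) setIT EFinD; congr (_ + _)%E.
    exact: EFin_prob.
  have I3E : (I3 <= (1 + C)%:E)%E.
    rewrite /I3; under eq_integral do rewrite EFinD.
    rewrite ge0_integralD//; last 2 first.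
    - by move=> w _; rewrite lee_fin powR_ge0.
    - apply/measurable_EFinP; apply: (measurableT_comp (measurable_powR p)).
      exact: (measurable_mass_sample mg iX [::]).
    rewrite integral_prob_cst EFinD.
    exact: leeD.
  have -> : (I1 = I1 * (2 ^+ n)%:E * (2 ^- n)%:E)%E.
    by rewrite -muleA -EFinM divff ?mule1// expf_neq0.
  rewrite H I2E [in leRHS]mulrC EFinM; apply: lee_wpmul2r; first by rewrite lee_fin invr_ge0 exprn_ge0.
  rewrite EFinM; apply: lee_wpmul2l => //.
  by rewrite lee_fin addr_ge0// prob_ge0.
have step : (P (bad (expR (- (gamma * beta * L))) beta n m) <=
    \int[P]_w (\sum_(k < n) (high k w)%:E + (low w)%:E))%E.
  rewrite -[in leLHS](setIT (bad _ _ _ _)) -integral_indic//.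
  apply: ge0_le_integral => //.
  - apply/measurable_EFinP; exact: measurable_indic.
  - by apply: emeasurable_funD; [apply: emeasurable_sum => k|]; exact/measurable_EFinP.
  - move=> w _; rewrite sumEFin -EFinD lee_fin indicE.
    have [/set_mem bw|_] := boolP (w \in _); first exact: bad_le_terms.
    by rewrite addr_ge0// sumr_ge0.
apply: (le_trans step); rewrite ge0_integralD//; last 4 first.
- by move=> w _; apply: sume_ge0 => k _; rewrite lee_fin.
- by apply: emeasurable_sum => k; exact/measurable_EFinP.
- by move=> w _; rewrite lee_fin.
- exact/measurable_EFinP.
rewrite EFinD; apply: leeD.
  rewrite ge0_integral_sum//; last 2 first.
  - by move=> k; exact/measurable_EFinP.
  - by move=> k w _; rewrite lee_fin.
  rewrite (eq_bigr _ (fun k _ => Ehigh k)) sumEFin sumr_const card_ord lee_fin -[leLHS]mulr_natl.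
  exact: lexx.
under eq_integral do rewrite -sumEFin.
rewrite ge0_integral_sum//; last 2 first.
- by move=> s; apply/measurable_EFinP; exact: measurable_funM.
- by move=> s w _; rewrite lee_fin mulr_ge0// expR_ge0.
apply: (@le_trans _ _ (\sum_(s : n.-tuple bool) (expR (gamma * L) *
  (2 ^- n * ((prob (spine X) (spine_tilt nuE iX) n D + delta) * (1 + C))))%:E)%E).
  apply: lee_sum => s _; under eq_integral do rewrite EFinM.
  rewrite ge0_integralZl//; [|exact/measurable_EFinP|by move=> w _; rewrite lee_fin].
  by rewrite EFinM; apply: lee_wpmul2l => //; rewrite lee_fin expR_ge0.
rewrite sumEFin sumr_const card_tuple card_bool lee_fin -[leLHS]mulr_natl natrX.
rewrite mulrCA [2 ^+ n * _]mulrA divff ?mul1r// ?expf_neq0//.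
Qed.

End bad.

Section bad_decay.
Context {R : realType} (nu0 nu : probability R R).
Hypothesis nuE : forall B, measurable B -> (nu B = \int[nu0]_(y in B) (2 * expR y)%:E)%E.
Hypothesis nu_int : nu.-integrable [set: R] (EFin \o @id R).
Hypothesis nu_center : \int[nu]_x x = 0.
Variables (c B q : R).
Hypotheses (c0 : 0 < c) (cB : c <= B) (q0 : 0 < q).
Hypothesis nu_right : (q%:E <= nu `[c, B]%classic)%E.
Hypothesis nu_left : (q%:E <= nu `[(- B)%R, (- c)%R]%classic)%E.
Context d (T : measurableType d) (P : probability T R) (X : seq bool -> T -> R).
Hypothesis iX : iid_on nu0 P X nonroot.
Variable g : R -> R.
Hypotheses (g0 : forall y, 0 <= g y) (mg : measurable_fun [set: R] g).
Variables (beta gamma p C : R).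
Hypotheses (gamma0 : 0 < gamma) (gamma1 : gamma < 2^-1) (p0 : 0 <= p) (b1 : 1 < p * beta).
Hypothesis HC : forall m, (moment g P X p m <= C%:E)%E.

Lemma bad_decay : exists s C', [/\ 1 < s, 0 <= C' & forall n m, (0 < n)%N ->
  (P (bad X g (expR (- (gamma * beta * ln n%:R))) beta n m) <= (C' * n%:R `^ (- s))%:E)%E].
Proof.
move: gamma0 gamma1 b1 => g00 g11 b11.
(* Half of the gap: then gamma + eps - 3/2 = -(1 + eps), a summable power of n. *)
pose eps := (2^-1 - gamma) / 2.
have eps0 : 0 < eps by rewrite /eps divr_gt0// subr_gt0.
(* Makes (p beta - 1)(A - gamma) = 2, so [delta] becomes n^{-2}, summable even after the factor
   n^gamma. The barrier 3 ln n makes n e^{-K} equal to n^{-2} as well. *)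
pose A := gamma + 2 / (p * beta - 1).
have gA : gamma <= A by rewrite lerDl divr_ge0// subr_ge0 ltW.
have A0 : 0 <= A by apply: le_trans gA; exact: ltW.
have C0 : 0 <= C by rewrite -lee_fin; apply: le_trans (HC 0%N); exact: moment_ge0.
have iQ := iid_spine_tilt nuE iX.
have [C1 C10 H1] := low_barrier iQ nu_int nu_center c0 cB q0 nu_right nu_left A0 (ler0n R 3) eps0.
exists (1 + eps), (1 + (C1 + 1) * (1 + C)); split.
- by rewrite ltrDl.
- by rewrite addr_ge0// mulr_ge0// addr_ge0// ltW.
move=> n m n0; have nR0 : 0 < n%:R :> R by rewrite ltr0n.
have L0 : 0 <= ln n%:R :> R by rewrite ln_ge0// ler1n.
have powE x : n%:R `^ x = expR (x * ln n%:R) :> R by rewrite /powR gt_eqF.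
have nE : n%:R = expR (ln n%:R) :> R by rewrite lnK.
have hh := bad_prob_le nuE iX g0 mg n (3 * ln n%:R) L0 p0 b1 gA (HC m).
apply: (le_trans hh).
rewrite lee_fin {1}nE -expRD powE.
have -> : (p * beta - 1) * (A - gamma) * ln n%:R = 2 * ln n%:R.
  by congr (_ * _); rewrite /A addrAC subrr add0r mulrC divfK// gt_eqF// subr_gt0.
have h1 : expR (ln n%:R + - (3 * ln n%:R)) <= expR (- (1 + eps) * ln n%:R) :> R.
  rewrite ler_expR -subr_ge0 (_ : _ - _ = (1 - eps) * ln n%:R); last by ring.
  by rewrite mulr_ge0// /eps; lra.
have h2 : expR (gamma * ln n%:R) * expR (- (2 * ln n%:R)) <= expR (- (1 + eps) * ln n%:R) :> R.
  rewrite -expRD ler_expR -subr_ge0 (_ : _ - _ = (1 - eps - gamma) * ln n%:R); last by ring.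
  by rewrite mulr_ge0// /eps; lra.
have h3 : expR (gamma * ln n%:R) * n%:R `^ (eps - 3 / 2) = expR (- (1 + eps) * ln n%:R) :> R.
  by rewrite powE -expRD; congr expR; rewrite /eps; field.
have h4 := H1 n n0.
rewrite [leRHS]mulrDl mul1r; apply: lerD => //.
rewrite mulrA [leRHS]mulrAC; apply: ler_wpM2r; first by rewrite addr_ge0.
rewrite mulrDr [leRHS]mulrDl mul1r; apply: lerD => //.
by rewrite -h3 [leRHS]mulrCA; apply: ler_wpM2l; [exact: expR_ge0|].
Qed.

End bad_decay.

(** * Laplace transform of the step *)

Section nondegenerate.
Context {R : realType}.

(** The intervals [1/(n+1), n+1] exhaust the positive reals. If all were null, |x| = -x almost
    everywhere, and the vanishing mean would give a vanishing integral of |x|. *)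
Lemma right_tail (nu : probability R R) :
  nu.-integrable [set: R] (EFin \o @id R) -> \int[nu]_x x = 0 ->
  ~ {ae nu, forall x : R, x = 0} -> exists n, (0 < nu `[(n.+1%:R^-1)%R, n.+1%:R%R]%classic)%E.
Proof.
move=> nu_int nu_c ndeg; apply: contrapT => H; apply: ndeg.
have n0 n : nu.-negligible `[(n.+1%:R^-1)%R, n.+1%:R%R]%classic.
  apply/negligibleP => //; apply/eqP; rewrite eq_le measure_ge0 andbT leNgt.
  by apply/negP => h; apply: H; exists n.
have pos0 : nu.-negligible [set x : R | 0 < x].
  apply: negligibleS (negligible_bigcup n0) => x /= x0.
  have [k [xk kx]] : exists k, k.+1%:R^-1 <= x /\ x <= k.+1%:R.
    pose k := Num.trunc (x + x^-1); exists k.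
    have /ltW kx : x + x^-1 < k.+1%:R by apply: truncnS_gt.
    have xi0 : 0 < x^-1 by rewrite invr_gt0.
    split; last by apply: le_trans kx; rewrite lerDl ltW.
    by rewrite -[leRHS]invrK lef_pV2 ?posrE// (le_trans _ kx)// lerDr ltW.
  by exists k => //=; rewrite in_itv /= xk kx.
have aeN : {ae nu, forall x : R, `|x| = - x}.
  apply: negligibleS pos0 => x /= h; rewrite ltNge; apply/negP => x0; apply: h.
  by rewrite ler0_norm.
have mN : measurable_fun [set: R] (fun x : R => (- x)%:E).
  by apply/measurable_EFinP; exact: oppr_measurable.
have mA : measurable_fun [set: R] (fun x : R => `|x|%:E).
  by apply/measurable_EFinP; exact: normr_measurable.
have E : (\int[nu]_x (`|x|)%:E = 0)%E.
  rewrite (ae_eq_integral (fun x : R => (- x)%:E))//; last first.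
    by apply: filterS aeN => x h _; rewrite h.
  rewrite (eq_integral (fun x : R => (-1)%:E * x%:E)%E); last first.
    by move=> x _; rewrite -EFinM mulN1r.
  by rewrite integralZl// EFin_Rintegral// nu_c mule0.
have /ae_eq_integral_abs : (\int[nu]_x `|x%:E| = 0)%E by [].
have mE : measurable_fun [set: R] (EFin : R -> \bar R) by exact/measurable_EFinP.
move=> /(_ measurableT mE) H0.
by apply: filterS H0 => x /(_ I) [].
Qed.

End nondegenerate.

(** * Convexity of the Laplace transform and the root q_beta *)

Section mgf.
Context {R : realType} (nu0 : probability R R).

Definition mgf (s : R) : \bar R := (\int[nu0]_x (expR (s * x))%:E)%E.

Let measurable_expRs s : measurable_fun [set: R] (fun x : R => (expR (s * x))%:E).
Proof.
by apply/measurable_EFinP; exact: measurable_expRM.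
Qed.

(** Hölder's inequality obtained from convexity of exp alone: it is applied pointwise to a x - ma
    and b x - mb, whose exponentials have integral 1. *)
Lemma mgf_logconvex (a b ma mb t : R) : 0 <= t -> t <= 1 ->
  mgf a = (expR ma)%:E -> mgf b = (expR mb)%:E ->
  (mgf ((1 - t) * a + t * b) <= (expR ((1 - t) * ma + t * mb))%:E)%E.
Proof.
move=> t0 t1 ha hb; pose m := (1 - t) * ma + t * mb.
have t10 : 0 <= 1 - t by rewrite subr_ge0.
have pw x : expR (((1 - t) * a + t * b) * x) <=
    expR m * ((1 - t) * (expR (- ma) * expR (a * x)) + t * (expR (- mb) * expR (b * x))).
  have -> : ((1 - t) * a + t * b) * x = m + (t * (b * x - mb) + (1 - t) * (a * x - ma)).
    by rewrite /m; ring.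
  rewrite expRD; apply: ler_wpM2l; first exact: expR_ge0.
  pose t' : {i01 R} := Itv01 t0 t1.
  have H : expR (t * (b * x - mb) + (1 - t) * (a * x - ma)) <=
      t * expR (b * x - mb) + (1 - t) * expR (a * x - ma) := convex_expR t' _ _.
  by rewrite -!expRD ![- _ + _]addrC [leRHS]addrC.
apply: (@le_trans _ _ (\int[nu0]_x ((expR m * (1 - t) * expR (- ma))%:E * (expR (a * x))%:E +
    (expR m * t * expR (- mb))%:E * (expR (b * x))%:E))%E).
  apply: ge0_le_integral => //.
  - by apply: emeasurable_funD; exact: emeasurable_funM.
  - move=> x _; rewrite -!EFinM -EFinD lee_fin; apply: le_trans (pw x) _.
    by rewrite le_eqVlt; apply/orP; left; apply/eqP; ring.
have c0 u v : 0 <= u -> 0 <= expR m * u * expR v by move=> u0; rewrite !mulr_ge0 ?expR_ge0.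
rewrite ge0_integralD//; last 4 first.
- by move=> x _; rewrite -EFinM lee_fin mulr_ge0 ?expR_ge0// c0.
- exact: emeasurable_funM.
- by move=> x _; rewrite -EFinM lee_fin mulr_ge0 ?expR_ge0// c0.
- exact: emeasurable_funM.
rewrite !ge0_integralZl//; last 2 first.
- by rewrite lee_fin c0.
- by rewrite lee_fin c0.
rewrite -/(mgf a) -/(mgf b) ha hb -!EFinM -EFinD lee_fin -!mulrA -!expRD !addNr !expR0 -/m.
by rewrite le_eqVlt; apply/orP; left; apply/eqP; ring.
Qed.

Variables (beta u : R).
Hypotheses (beta0 : 0 < beta) (beta1 : beta < 1) (u0 : 0 < u).
Hypotheses (mgf1 : mgf 1 = (expR (- ln 2))%:E) (mgfb : mgf beta = (expR (u - ln 2))%:E).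

(** Put F(p) = ln (2 mgf(beta p)) - p u. It is convex, F(1) = 0 and F(1/beta) = -u/beta < 0, so F <
    0 on (1, 1/beta]. A root beyond 1 thus lies beyond 1/beta, and interpolating between 1/beta and
    the root gives F < 0 up to the root, whence uniqueness. *)
Let ltb p : 1 < p -> p * beta <= 1 -> (mgf (beta * p) < (expR (p * u - ln 2))%:E)%E.
Proof.
move: beta0 beta1 u0 => b0 b1 u00 p1 pb; pose t := (p * beta - beta) / (1 - beta).
have b10 : 0 < 1 - beta by rewrite subr_gt0.
have t0 : 0 <= t by rewrite divr_ge0 ?(ltW b10)// subr_ge0 ler_peMl ?ltW.
have t1 : t <= 1 by rewrite ler_pdivrMr// mul1r lerD2r.
have := mgf_logconvex t0 t1 mgfb mgf1.
have -> : (1 - t) * beta + t * 1 = beta * p by rewrite /t; field; rewrite gt_eqF.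
move=> /le_lt_trans; apply; rewrite lte_fin ltr_expR.
rewrite -subr_gt0 (_ : _ - _ = (p - 1 + t) * u); last by ring.
by rewrite mulr_gt0// ltr_pwDl// subr_gt0.
Qed.

Lemma root_mgf_gt q : 1 < q -> mgf (beta * q) = (expR (q * u - ln 2))%:E -> 1 < q * beta.
Proof. by move=> q1 hq; rewrite ltNge; apply/negP => /(ltb q1); rewrite hq ltxx. Qed.

Lemma mgf_lt_root q p : 1 < q -> mgf (beta * q) = (expR (q * u - ln 2))%:E ->
  1 < p -> p < q -> (mgf (beta * p) < (expR (p * u - ln 2))%:E)%E.
Proof.
move=> q1 hq p1 pq; have qb := root_mgf_gt q1 hq.
have [|pb] := leP (p * beta) 1; first exact: ltb.
move: beta0 u0 => b0 u00; pose t := (p * beta - 1) / (q * beta - 1).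
have q10 : 0 < q * beta - 1 by rewrite subr_gt0.
have t0 : 0 <= t by rewrite divr_ge0 ?(ltW q10)// subr_ge0 ltW.
have pqb : p * beta < q * beta by rewrite ltr_pM2r.
have t1 : t <= 1 by rewrite ler_pdivrMr// mul1r lerD2r ltW.
have := mgf_logconvex t0 t1 mgf1 hq.
have -> : (1 - t) * 1 + t * (beta * q) = beta * p by rewrite /t; field; rewrite gt_eqF.
move=> /le_lt_trans; apply; rewrite lte_fin ltr_expR.
rewrite -subr_gt0 (_ : _ - _ = (p - t * q) * u); last by ring.
rewrite mulr_gt0// subr_gt0 /t mulrAC ltr_pdivrMr//.
by rewrite mulrBl mulrBr mul1r mulr1 mulrAC -mulrA ler_ltB.
Qed.

Lemma root_mgf_unique q q' : 1 < q -> 1 < q' ->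
  mgf (beta * q) = (expR (q * u - ln 2))%:E ->
  mgf (beta * q') = (expR (q' * u - ln 2))%:E -> q' = q.
Proof.
move=> q1 q'1 hq hq'; case: (ltgtP q' q) => // [/(mgf_lt_root q1 hq q'1)|/(mgf_lt_root q'1 hq' q1)].
- by rewrite hq' ltxx.
- by rewrite hq ltxx.
Qed.

End mgf.

(** * The tilted step: centring, non-degeneracy, tails *)

Section tilted_law.
Context {R : realType} d0 (T0 : measurableType d0) (P0 : probability T0 R) (xi : {RV P0 >-> R}).
Hypothesis crit : critical_normalization xi.

Definition law : probability R R := distribution P0 xi.

Lemma integral_law (f : R -> \bar R) : measurable_fun [set: R] f -> (forall x, 0 <= f x)%E ->
  (\int[law]_x f x = \int[P0]_t f (xi t))%E.
Proof. by move=> mf f0; rewrite (@ge0_integral_distribution _ _ _ _ _ P0 xi f). Qed.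

Lemma mgfE s : mgf law s = ('E_P0[fun t => expR (s * xi t)])%E.
Proof.
rewrite /mgf unlock integral_law//.
by apply/measurable_EFinP; exact: measurable_expRM.
Qed.

Let e2 (y : R) := 2 * expR y.
Let e20 y : 0 <= e2 y. Proof. by rewrite mulr_ge0// expR_ge0. Qed.
Let me2 : measurable_fun [set: R] e2.
Proof. by apply: measurable_funM => //; exact: measurable_expR. Qed.

Lemma mgf_law1 : mgf law 1 = (2^-1)%:E.
Proof.
case: crit => <- _ _; rewrite mgfE; congr ('E_P0[ _ ])%E.
by apply/funext => t; rewrite mul1r.
Qed.

Let e21 : (\int[law]_y (e2 y)%:E = 1)%E.
Proof.
under eq_integral do rewrite EFinM.
rewrite ge0_integralZl//; last by apply/measurable_EFinP; exact: measurable_expR.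
have -> : (\int[law]_x (expR x)%:E = (2^-1)%:E)%E.
  by rewrite -mgf_law1 /mgf; apply: eq_integral => x _; rewrite mul1r.
by rewrite -EFinM mulfV.
Qed.

Definition tilted_law : probability R R := density_prob e20 me2 e21.

Lemma tilted_lawE B : measurable B -> (tilted_law B = \int[law]_(y in B) (2 * expR y)%:E)%E.
Proof. by []. Qed.

Lemma ge0_integral_tilted (f : R -> \bar R) :
  measurable_fun [set: R] f -> (forall x, 0 <= f x)%E ->
  (\int[tilted_law]_x f x = \int[P0]_t (f (xi t) * (2 * expR (xi t))%:E))%E.
Proof.
move=> mf f0.
rewrite (@ge0_integral_density _ _ _ law tilted_law e2 f)//.
apply: (@integral_law (fun x => f x * (e2 x)%:E)%E).
- by apply: emeasurable_funM => //; exact/measurable_EFinP.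
- by move=> x; rewrite mule_ge0// lee_fin; exact: e20.
Qed.

Lemma integral_tilted (f : R -> R) : measurable_fun [set: R] f ->
  (\int[tilted_law]_x (f x)%:E = \int[P0]_t (f (xi t) * (2 * expR (xi t)))%:E)%E.
Proof.
move=> mf; have mEf : measurable_fun [set: R] (EFin \o f) by exact/measurable_EFinP.
rewrite integralE [RHS]integralE; congr (_ - _)%E.
- rewrite ge0_integral_tilted//; last exact: measurable_funepos.
  apply: eq_integral => t _; rewrite !funeposE /= -[X in _ = maxe _ X](mul0e (2 * expR (xi t))%:E).
  by rewrite EFinM maxe_pMl// lee_fin e20.
- rewrite ge0_integral_tilted//; last exact: measurable_funeneg.
  apply: eq_integral => t _; rewrite !funenegE /= -[X in _ = maxe _ X](mul0e (2 * expR (xi t))%:E).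
  by rewrite -mulNr EFinM maxe_pMl// lee_fin e20.
Qed.

Lemma integrable_tilted_law : tilted_law.-integrable [set: R] (EFin \o @id R).
Proof.
apply/integrableP; split; first exact/measurable_EFinP.
have mA : measurable_fun [set: R] (fun x : R => (`|x| ^+ 3)%:E).
  by apply/measurable_EFinP; apply: measurable_funX; exact: normr_measurable.
apply: (@le_lt_trans _ _ (\int[tilted_law]_x (1 + (`|x| ^+ 3)%:E))%E).
  apply: ge0_le_integral => //.
  - by apply/measurable_EFinP; exact: normr_measurable.
  - exact: emeasurable_funD.
  - move=> x _; rewrite /= -EFinD lee_fin.
    suff H (y : R) : 0 <= y -> y <= 1 + y ^+ 3 by exact: H.
    by move=> y0; have y3 := exprn_ge0 3 y0; have [y1|y1] := leP y 1; [lra|nra].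
rewrite ge0_integralD//.
rewrite integral_prob_cst.
rewrite ge0_integral_tilted//.
case: crit => _ _; rewrite unlock => h3.
rewrite lte_add_pinfty ?ltry//.
have -> : (\int[P0]_t ((`|xi t| ^+ 3)%:E * (2 * expR (xi t))%:E) =
   2%:E * \int[P0]_t (`|xi t| ^+ 3 * expR (xi t))%:E)%E.
  rewrite -ge0_integralZl//; last first.
    apply/measurable_EFinP; apply: measurable_funM; last exact: measurableT_comp.
    by apply: measurable_funX; exact: measurableT_comp.
  by apply: eq_integral => t _; rewrite -!EFinM mulrCA.
by rewrite lte_mul_pinfty.
Qed.

Lemma Rintegral_tilted_law : \int[tilted_law]_x x = 0.
Proof.
rewrite /Rintegral integral_tilted//.
case: crit => _; rewrite unlock => h _.
have i1 : P0.-integrable [set: T0] (fun t => (xi t * expR (xi t))%:E).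
  apply/integrableP; split.
    by apply/measurable_EFinP; apply: measurable_funM => //; exact: measurableT_comp.
  have /integrableP[_] := integrable_tilted_law.
  rewrite ge0_integral_tilted//; last by apply: measurableT_comp => //; exact/measurable_EFinP.
  apply: le_lt_trans; apply: ge0_le_integral => //.
  - apply/measurable_EFinP; apply: measurableT_comp => //.
    by apply: measurable_funM => //; exact: measurableT_comp.
  - apply: emeasurable_funM; first by apply/measurable_EFinP; exact: measurableT_comp.
    apply/measurable_EFinP; apply: measurable_funM => //; exact: measurableT_comp.
  - move=> t _; rewrite /= -EFinM lee_fin normrM (ger0_norm (expR_ge0 _)).
    by apply: ler_wpM2l => //; rewrite ler_peMl ?expR_ge0// ler1n.
have -> : (\int[P0]_t (xi t * (2 * expR (xi t)))%:E = 2%:E * \int[P0]_t (xi t * expR (xi t))%:E)%E.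
  by rewrite -integralZl//; apply: eq_integral => t _; rewrite -EFinM mulrCA.
by rewrite h mule0.
Qed.

(** The tilted mean of e^{-x} is 2, because the density 2 e^x cancels the integrand; it would be 1
    if the step vanished. *)
Lemma tilted_law_ndeg : ~ {ae tilted_law, forall x : R, x = 0}.
Proof.
move=> H.
have mN : measurable_fun [set: R] (fun x : R => (expR (- x))%:E).
  by apply/measurable_EFinP; apply: (measurableT_comp (@measurable_expR R)); exact: oppr_measurable.
have : (\int[tilted_law]_x (expR (- x))%:E = 1)%E.
  rewrite (ae_eq_integral (cst 1%E))//; last first.
    by apply: filterS H => x -> _; rewrite oppr0 expR0.
  exact: integral_prob_cst.
rewrite ge0_integral_tilted//.
rewrite (eq_integral (cst 2%:E)); last first.
  by move=> t _; rewrite -EFinM mulrCA -expRD addNr expR0 mulr1.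
rewrite integral_prob_cst.
move=> /(congr1 fine) /= /eqP; rewrite (_ : 2 = 1 + 1 :> R)//; have := @ltr01 R; lra.
Qed.

(** [right_tail] is applied to the law and to its reflection; minima and maxima give a window and a
    mass common to both sides. *)
Lemma tilted_law_tails : exists c B p, [/\ 0 < c, c <= B, 0 < p,
  (p%:E <= tilted_law `[c, B]%classic)%E & (p%:E <= tilted_law `[(- B)%R, (- c)%R]%classic)%E].
Proof.
have [n hn] := right_tail integrable_tilted_law Rintegral_tilted_law tilted_law_ndeg.
have ndeg' : ~ {ae opp_law tilted_law, forall x : R, x = 0}.
  move=> [A [mA A0 hA]]; apply: tilted_law_ndeg; exists (opp_fun @^-1` A); split => //.
    by rewrite -[X in measurable X]setTI; exact: measurable_opp_fun.
  move=> x /= hx; apply: hA => /= h; apply: hx; apply/eqP; rewrite -oppr_eq0; apply/eqP; exact: h.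
have [k hk] := right_tail (integrable_opp_law integrable_tilted_law)
  (integral_opp_law integrable_tilted_law Rintegral_tilted_law) ndeg'.
pose c : R := minr n.+1%:R^-1 k.+1%:R^-1; pose B : R := maxr n.+1%:R k.+1%:R.
have cn : c <= n.+1%:R^-1 by rewrite ge_min lexx.
have ck : c <= k.+1%:R^-1 by rewrite ge_min lexx orbT.
have Bn : n.+1%:R <= B by rewrite le_max lexx.
have Bk : k.+1%:R <= B by rewrite le_max lexx orbT.
pose p1 := fine (tilted_law `[c, B]%classic).
pose p2 := fine (tilted_law `[(- B)%R, (- c)%R]%classic).
have h1 : 0 < p1.
  rewrite -lte_fin /p1 fineK ?fin_num_measure//; apply: lt_le_trans hn _.
  apply: le_measure; rewrite ?inE// => x /=; rewrite !in_itv /= => /andP[a b].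
  by rewrite (le_trans cn a) (le_trans b Bn).
have h2 : 0 < p2.
  rewrite -lte_fin /p2 fineK ?fin_num_measure//; apply: lt_le_trans hk _.
  change (tilted_law (opp_fun @^-1` `[(k.+1%:R^-1)%R, k.+1%:R%R]) <=
    tilted_law `[(- B)%R, (- c)%R]%classic)%E.
  apply: le_measure; rewrite ?inE//.
    by rewrite -[X in measurable X]setTI; exact: measurable_opp_fun.
  move=> x /=; rewrite !in_itv /= /opp_fun => /andP[a b].
  by rewrite lerNl (le_trans b Bk) lerNr (le_trans ck a).
exists c, B, (minr p1 p2); split.
- by rewrite lt_min !invr_gt0 !ltr0n.
- apply: (le_trans cn); apply: le_trans Bn; apply: (@le_trans _ _ 1); last by rewrite ler1n.
  by rewrite invf_le1 ?ler1n.
- by rewrite lt_min h1 h2.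
- rewrite -[leRHS]fineK ?fin_num_measure// lee_fin ge_min.
  by rewrite /p1 lexx.
- rewrite -[leRHS]fineK ?fin_num_measure// lee_fin ge_min.
  by rewrite /p2 lexx orbT.
Qed.

(** Strict Jensen inequality: 2 mgf(beta) is the tilted mean of e^{-(1 - beta)x}, and e^{-y} >= 1 -
    y with equality only at y = 0. [u] is the logarithm of that mean, so that phi_tilde(beta) = u /
    ln 2 is positive. *)
Lemma mgf_beta_gt beta : 0 < beta -> beta < 1 ->
  exists2 u, 0 < u & mgf law beta = (expR (u - ln 2))%:E.
Proof.
move=> b0 b1.
have fin : (mgf law beta < +oo)%E.
  apply: (@le_lt_trans _ _ (\int[law]_x (1 + (expR (1 * x))%:E))%E).
    apply: ge0_le_integral => //.
    - by apply/measurable_EFinP; exact: measurable_expRM.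
    - by apply: emeasurable_funD => //; apply/measurable_EFinP; exact: measurable_expRM.
    - move=> x _; rewrite -EFinD lee_fin mul1r.
      have [x0|x0] := leP 0 x.
        apply: (@le_trans _ _ (expR x)); last by rewrite lerDr.
        by rewrite ler_expR ler_piMl// ltW.
      apply: (@le_trans _ _ 1); last by rewrite lerDl expR_ge0.
      by rewrite -[leRHS]expR0 ler_expR; nra.
  rewrite ge0_integralD//; last by apply/measurable_EFinP; exact: measurable_expRM.
  rewrite -/(mgf law 1) mgf_law1 integral_prob_cst.
  by rewrite -EFinD ltry.
have M0 : (0 <= mgf law beta)%E by apply: integral_ge0 => x _; rewrite lee_fin expR_ge0.
pose M := fine (mgf law beta).
have ME : mgf law beta = M%:E by rewrite fineK// ge0_fin_numE.
pose a := 1 - beta; have a0 : 0 < a by rewrite subr_gt0.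
have E2 : (\int[tilted_law]_x (expR (- (a * x)))%:E = (2 * M)%:E)%E.
  rewrite ge0_integral_tilted//; last first.
    by apply/measurable_EFinP; under eq_fun do rewrite -mulNr; exact: measurable_expRM.
  rewrite EFinM -ME mgfE unlock -ge0_integralZl//; last first.
    by apply/measurable_EFinP; apply: (measurableT_comp (measurable_expRM beta)).
  apply: eq_integral => t _; rewrite -!EFinM mulrCA -expRD; congr (_ * expR _)%:E.
  by rewrite /a; ring.
have me : measurable_fun [set: R] (fun x : R => expR (- (a * x))).
  by under eq_fun do rewrite -mulNr; exact: measurable_expRM.
have i1 : tilted_law.-integrable [set: R] (EFin \o (fun x : R => expR (- (a * x)))).
  apply/integrableP; split; first exact/measurable_EFinP.
  rewrite (eq_integral (fun x : R => (expR (- (a * x)))%:E)) ?E2 ?ltry//.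
  by move=> x _; rewrite /= ger0_norm ?expR_ge0.
have i2 : tilted_law.-integrable [set: R] (EFin \o (fun x : R => a * x - 1)).
  have /(integrableZl measurableT a) h1 := integrable_tilted_law.
  have := integrableB measurableT h1 (finite_measure_integrable_cst tilted_law 1 measurableT : tilted_law.-integrable setT (EFin \o cst 1)).
  by apply: eq_integrable => // x _.
pose h x := expR (- (a * x)) - 1 + a * x.
have h0 x : 0 <= h x by have := expR_ge1Dx (- (a * x)); rewrite /h; lra.
have mh : measurable_fun [set: R] (EFin \o h).
  by apply/measurable_EFinP; apply: measurable_funD; [exact: measurable_funB|exact: measurable_funM].
have hE : (\int[tilted_law]_x (h x)%:E = (2 * M - 1)%:E)%E.
  rewrite (eq_integral (fun x : R => (expR (- (a * x)) + (a * x - 1))%:E)); last first.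
    by move=> x _; congr EFin; rewrite /h; lra.
  under eq_integral do rewrite EFinD.
  rewrite integralD// E2 EFinB; congr (_ + _)%E.
  rewrite EFin_Rintegral//.
  have /(integrableZl measurableT a) h1 := integrable_tilted_law.
  rewrite RintegralB//; last exact: (finite_measure_integrable_cst tilted_law 1 measurableT).
  by rewrite Rintegral_cst1 RintegralZl// ?Rintegral_tilted_law ?mulr0 ?sub0r//; exact: integrable_tilted_law.
have : 1 < 2 * M.
  rewrite ltNge; apply/negP => M1; apply: tilted_law_ndeg.
  have /(ae_eq_integral_abs tilted_law measurableT mh) : (\int[tilted_law]_x `|(EFin \o h) x| = 0)%E.
    under eq_integral do rewrite gee0_abs ?lee_fin ?h0//.
    rewrite hE; congr EFin; apply/eqP; rewrite eq_le subr_le0 M1/= -lee_fin -hE.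
    by apply: integral_ge0 => x _; rewrite lee_fin.
  apply: filterS => x /(_ I) [hx]; apply: contrapT => /eqP x0.
  have /expR_gt1Dx : - (a * x) != 0 by rewrite oppr_eq0 mulf_neq0// gt_eqF.
  by move: hx; rewrite /h; lra.
move=> M1; have Mp : 0 < M by lra.
exists (ln (2 * M)); first by rewrite ln_gt0.
by rewrite ME lnM ?posrE// addrAC subrr add0r lnK.
Qed.

End tilted_law.

Section exponent_facts.
Context {R : realType} d0 (T0 : measurableType d0) (P0 : probability T0 R) (xi : {RV P0 >-> R}).

Let ln2 : 0 < ln 2 :> R. Proof. by rewrite ln_gt0// ltr1n. Qed.

Lemma phi_tilde_expR s v : mgf (law xi) s = (expR v)%:E -> phi_tilde xi s = (1 + v / ln 2)%:E.
Proof. by move=> h; rewrite /phi_tilde -mgfE h lne_EFin ?expR_gt0// expRK. Qed.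

(** The equation itself excludes the values +oo and 0 of the Laplace transform: there [lne] is
    infinite while the other term is finite. *)
Lemma mgf_root beta u q : phi_tilde xi beta = (u / ln 2)%:E -> is_q_beta xi beta q ->
  mgf (law xi) (beta * q) = (expR (q * u - ln 2))%:E.
Proof.
move=> hb [q1]; rewrite hb /phi_tilde -mgfE; set M := mgf _ _.
have : (0 <= M)%E by apply: integral_ge0 => x _; rewrite lee_fin expR_ge0.
case: M => [r| |]//; last by rewrite /= mulyr gtr0_sg ?invr_gt0// mul1e.
rewrite lee_fin le_eqVlt => /orP[/eqP <-|r0].
  by rewrite le0_lneNy// mulNyr gtr0_sg ?invr_gt0// mul1e.
rewrite lne_EFin// => /(congr1 fine) /= h.
rewrite -[r]lnK//; congr (expR _)%:E.
have l0 : ln 2 != 0 :> R by rewrite gt_eqF.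
have -> : ln r = (1 + ln r / ln 2 - q * (u / ln 2)) * ln 2 + q * u - ln 2 by field.
by rewrite h mul0r add0r.
Qed.

End exponent_facts.

Section lebesgue_transfer.
Context {R : realType}.

(* [lebesgue_measure] lives on [measurableTypeR R], whose display differs from
   the one of the canonical measurable structure of [R]. *)
Let idR : measurableTypeR R -> R := idfun.
Let midR : measurable_fun [set: measurableTypeR R] idR.
Proof. by move=> _ Y mY; rewrite setTI. Qed.

Definition lebesgue_onR : {measure set R -> \bar R}.
Proof.
refine [the measure _ _ of pushforward (@lebesgue_measure R : {measure set (measurableTypeR R) -> \bar R}) idR].
exact: midR.
Defined.

Lemma ge0_integral_lebesgue_onR (D : set R) (f : R -> \bar R) : measurable D ->
  measurable_fun D f -> (forall x, 0 <= f x)%E ->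
  (\int[lebesgue_onR]_(x in D) f x = \int[@lebesgue_measure R]_(x in D) f x)%E.
Proof.
by move=> mD mf f0; rewrite (ge0_integral_pushforward midR).
Qed.

End lebesgue_transfer.

(** * The Gaussian case *)

Section gaussian.
Context {R : realType} d0 (T0 : measurableType d0) (P0 : probability T0 R) (xi : {RV P0 >-> R}).
Hypothesis gauss : gaussian_case xi.

Let ln2 : 0 < ln 2 :> R. Proof. by rewrite ln_gt0// ltr1n. Qed.

Lemma gaussian_mgf (s : R) : (mgf (law xi) s = (expR (s * (- 2 * ln 2) + s ^+ 2 * ln 2))%:E)%E.
Proof.
set m := - 2 * ln 2; pose sigma : R := Num.sqrt (2 * ln 2).
have s0 : sigma != 0 by rewrite gt_eqF// sqrtr_gt0 mulr_gt0.
have s2 : ln 2 = sigma ^+ 2 / 2 :> R.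
  by rewrite sqr_sqrtr; [field|rewrite mulr_ge0// ltW].
have mp : measurable_fun [set: R] (normal_pdf m sigma) by exact: measurable_normal_pdf.
rewrite [in RHS]s2 mulrA /mgf (@ge0_integral_density _ _ _ lebesgue_onR (law xi) (normal_pdf m sigma))//; last 3 first.
- by move=> x; exact: normal_pdf_ge0.
- move=> A mA; rewrite ge0_integral_lebesgue_onR//; first exact: gauss.
    by apply: measurable_funTS; exact/measurable_EFinP.
  by move=> x; rewrite lee_fin normal_pdf_ge0.
- by apply/measurable_EFinP; exact: measurable_expRM.
rewrite ge0_integral_lebesgue_onR//; last 2 first.
- apply: emeasurable_funM; apply/measurable_EFinP => //.
  exact: measurable_expRM.
- by move=> x; rewrite -EFinM lee_fin mulr_ge0 ?expR_ge0 ?normal_pdf_ge0.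
(* Completing the square: e^{s x} times the normal density of mean m is a constant times the normal
   density of mean m + s sigma^2. *)
rewrite (eq_integral (fun x : measurableTypeR R => (expR (s * m + s ^+ 2 * sigma ^+ 2 / 2))%:E *
  (normal_pdf (m + s * sigma ^+ 2) sigma x)%:E)%E).
  rewrite ge0_integralZl//.
  - by rewrite integral_normal_pdf mule1.
  - by apply/measurable_EFinP; exact: measurable_normal_pdf.
  - by move=> x _; rewrite lee_fin normal_pdf_ge0.
move=> x _; rewrite -!EFinM !normal_pdfE// /normal_fun; congr _%:E.
rewrite mulrCA [RHS]mulrCA -!expRD; congr (_ * expR _); field.
by [].
Qed.

Lemma gaussian_phi_tilde s : phi_tilde xi s = ((1 - s) ^+ 2)%:E.
Proof.
rewrite (phi_tilde_expR (gaussian_mgf s)); congr EFin; field; by rewrite gt_eqF.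
Qed.

Lemma gaussian_q_beta beta q : 0 < beta -> beta < 1 -> is_q_beta xi beta q <-> q = (beta ^+ 2)^-1.
Proof.
move=> b0 b1; rewrite /is_q_beta !gaussian_phi_tilde -EFinM -EFinB.
have b20 : beta ^+ 2 != 0 by rewrite expf_neq0// gt_eqF.
have -> : (1 - beta * q) ^+ 2 - q * (1 - beta) ^+ 2 = (1 - q) * (1 - beta ^+ 2 * q) by ring.
split=> [[q1 [/eqP]]|->].
  rewrite mulf_eq0 subr_eq0 lt_eqF//= subr_eq0 => /eqP h.
  by rewrite -[LHS](mulKf b20) -h mulr1.
split; last by rewrite mulfV// subrr mulr0.
by rewrite invf_gt1 ?exprn_gt0// expr_lt1// ltW.
Qed.

End gaussian.

(** * Borel-Cantelli *)

Section borel_cantelli.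
Context {R : realType}.

(** Compares the series of n^{-(1+e)} with a telescoping one; ln (n/(n+1)) <= -1/(n+1) plays the
    part of the integral test. *)
Lemma powR_telescope (e : R) n : 0 < e -> (0 < n)%N ->
  e * n.+1%:R `^ (- (1 + e)) <= n%:R `^ (- e) - n.+1%:R `^ (- e).
Proof.
move=> e0 n0; have n00 : 0 < n%:R :> R by rewrite ltr0n.
have n10 : 0 < n.+1%:R :> R by rewrite ltr0n.
have x0 : 0 < n%:R / n.+1%:R :> R by rewrite divr_gt0.
have h : ln (n%:R / n.+1%:R) <= - n.+1%:R^-1 :> R.
  have -> : n%:R / n.+1%:R = 1 + - n.+1%:R^-1 :> R by rewrite -natr1; field; rewrite natr1 gt_eqF.
  apply: le_ln1Dx; rewrite ltrN2 invf_lt1// ltr1n.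
  by rewrite ltnS.
have -> : n%:R `^ (- e) = n.+1%:R `^ (- e) * expR (- e * ln (n%:R / n.+1%:R)) :> R.
  rewrite /powR !gt_eqF// -expRD lnM ?posrE ?invr_gt0// lnV ?posrE//; congr expR; ring.
have -> : n.+1%:R `^ (- (1 + e)) = n.+1%:R `^ (- e) * n.+1%:R^-1 :> R.
  by rewrite opprD addrC powRD ?(gt_eqF n10) ?implybT// powR_inv1 ?ler0n.
rewrite mulrCA -[X in _ - X]mulr1 -mulrBr; apply: ler_wpM2l; first exact: powR_ge0.
have := expR_ge1Dx (- e * ln (n%:R / n.+1%:R)).
have := ler_wpM2l (ltW e0) h; move: (ln (n%:R / n.+1%:R)) => y.
move: (n.+1%:R^-1) => z hy.
move: (expR _) => E; rewrite mulNr; move: hy; rewrite mulrN; lra.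
Qed.

Lemma sum_powR_le (s : R) N : 1 < s ->
  \sum_(0 <= n < N) n.+1%:R `^ (- s) <= 1 + (s - 1)^-1.
Proof.
move=> s1; have e0 : 0 < s - 1 by rewrite subr_gt0.
have ei0 : 0 < (s - 1)^-1 by rewrite invr_gt0.
case: N => [|N]; first by rewrite big_geq// addr_ge0// ltW.
suff : \sum_(0 <= n < N.+1) n.+1%:R `^ (- s) <= 1 + (s - 1)^-1 * (1 - N.+1%:R `^ (- (s - 1))).
  move=> /le_trans; apply; rewrite lerD2l ler_piMr ?(ltW ei0)//.
elim: N => [|N IH].
  by rewrite big_nat1 !powR1 subrr mulr0 addr0.
rewrite big_nat_recr//=.
have := powR_telescope e0 (ltn0Sn N).
have -> : 1 + (s - 1) = s by ring.
move=> h.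
have {}h : N.+2%:R `^ (- s) <= (s - 1)^-1 * (N.+1%:R `^ (- (s - 1)) - N.+2%:R `^ (- (s - 1))).
  by rewrite ler_pdivlMl.
by rewrite mulrBr in h; rewrite mulrBr; rewrite mulrBr in IH; lra.
Qed.

(** For fixed n the event that [B n m] holds for all large m is an increasing union of events each
    contained in a single [B n m], so it inherits the bound although the [B n m] are unrelated for
    different m. Borel-Cantelli is then applied in n. *)
Lemma borel_cantelli_liminf d (T : measurableType d) (P : probability T R)
    (B : nat -> nat -> set T) (C s : R) : 1 < s -> 0 <= C ->
  (forall n m, measurable (B n m)) ->
  (forall n m, (0 < n)%N -> P (B n m) <= (C * n%:R `^ (- s))%:E)%E ->
  {ae P, forall w, exists N, forall n, (N <= n)%N -> forall M, exists2 m, (M <= m)%N & ~ B n m w}.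
Proof.
move=> s1 C0 mB PB.
pose G n M := \bigcap_(m in [set m | (M <= m)%N]) B n m.
(* The shift by one skips n = 0, where no bound is assumed. *)
pose F n := \bigcup_M G n.+1 M.
have mG n M : measurable (G n M) by exact: bigcap_measurableType.
have mF n : measurable (F n) by exact: bigcupT_measurable.
have PF n : (P (F n) <= (C * n.+1%:R `^ (- s))%:E)%E.
  have hcv := @nondecreasing_cvg_mu _ _ _ P (G n.+1) (mG n.+1) (mF n).
  have cv : (P \o G n.+1) x @[x --> \oo] --> P (F n).
    apply: hcv => a b ab; apply/subsetPset => w Gw m /= bm; apply: Gw => /=; exact: leq_trans bm.
  rewrite -(cvg_lim _ cv)//; apply: lime_le; first by apply/cvg_ex; exists (P (F n)).
  apply: nearW => M /=; apply: le_trans (PB n.+1 M (ltn0Sn n)).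
  by apply: le_measure; rewrite ?inE// => w; apply => /=.
have H := @lim_sup_set_cvg0 _ _ _ P F mF.
have fin : (\sum_(0 <= n <oo) P (F n) < +oo)%E.
  apply: (@le_lt_trans _ _ (C * (1 + (s - 1)^-1))%:E); last exact: ltry.
  apply: lime_le; first by apply: is_cvg_nneseries => n _ _; exact: measure_ge0.
  apply: nearW => N; apply: (@le_trans _ _ (\sum_(0 <= n < N) (C * n.+1%:R `^ (- s))%:E)%E).
    exact: lee_sum.
  rewrite sumEFin lee_fin -big_distrr/=; apply: ler_wpM2l => //; exact: sum_powR_le.
exists (lim_sup_set F); split.
- by apply: bigcapT_measurable => n; apply: bigcup_measurable.
- exact: H.
- move=> w /= hw n _ /=; apply: contrapT => h; apply: hw; exists n.+1 => k nk M.
  apply: contrapT => h'; apply: h; exists k.-1; first by rewrite /= -ltnS prednK// (leq_trans _ nk).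
  rewrite /F; case: k nk h' => // k nk h'; exists M => //= m Mm; apply: contrapT => h''; apply: h'.
  by exists m.
Qed.

End borel_cantelli.

(** * Dyadic cells *)

Section dyadic_numerals.
Context {R : realType}.

Fixpoint numeral (s : seq bool) : nat :=
  if s is b :: s' then b * 2 ^ size s' + numeral s' else 0.

Lemma numeral_lt s : (numeral s < 2 ^ size s)%N.
Proof.
elim: s => [|b s IH] //=; rewrite expnS mul2n -addnn.
case: b; first by rewrite mul1n ltn_add2l.
by rewrite mul0n add0n (leq_trans IH)// leq_addr.
Qed.

Lemma numeral_cat s t : numeral (s ++ t) = (numeral s * 2 ^ size t + numeral t)%N.
Proof. by elim: s => [|b s IH] //=; rewrite IH size_cat expnD mulnDl mulnA addnA. Qed.

Lemma numeral_inj s t : size s = size t -> numeral s = numeral t -> s = t.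
Proof.
elim: s t => [|b s IH] [|b' t] //= [st]; rewrite st => h.
have hs := numeral_lt s; have ht := numeral_lt t; rewrite st in hs.
have bb : b = b'.
  case: b b' h => [] [] //=; rewrite ?mul1n ?mul0n ?add0n => h.
    by move: ht; rewrite -h ltnNge leq_addr.
  by move: hs; rewrite h ltnNge leq_addr.
rewrite -bb in h *; congr (_ :: _); apply: IH => //.
exact: addnI h.
Qed.

Lemma dyadic_leftE s : dyadic_left R s = (numeral s)%:R * 2 ^- size s.
Proof.
rewrite /dyadic_left; elim: s => [|b s IH]; first by rewrite big_ord0 mul0r.
rewrite big_ord_recl /= expr1.
transitivity (b%:R / 2 + 2^-1 * \sum_(k < size s) (nth false s k)%:R * 2 ^- k.+1 :> R).
  congr (_ + _); rewrite big_distrr/=; apply: eq_bigr => k _.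
  by rewrite [2 ^+ k.+2]exprS invfM mulrCA.
rewrite IH natrD natrM natrX exprS invfM mulrDl; congr (_ + _).
  by rewrite mulrACA divff ?mulr1// expf_neq0.
by rewrite mulrCA.
Qed.

Lemma dyadic_cellE s (x : R) :
  dyadic_cell R s x <-> (numeral s)%:R <= x * 2 ^+ size s < (numeral s).+1%:R.
Proof.
have p0 : 0 < 2 ^+ size s :> R by rewrite exprn_gt0.
rewrite /dyadic_cell /= in_itv /= dyadic_leftE -[(numeral s).+1%:R]natr1 ler_pdivrMr//.
by rewrite -[X in _ < _ + X]mul1r -mulrDl ltr_pdivlMr.
Qed.

Lemma dyadic_cell_cat s t : dyadic_cell R (s ++ t) `<=` dyadic_cell R s.
Proof.
move=> x /dyadic_cellE; rewrite numeral_cat size_cat exprD mulrA => /andP[h1 h2].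
have p0 : 0 < 2 ^+ size t :> R by rewrite exprn_gt0.
apply/dyadic_cellE/andP; split.
  rewrite -(ler_pM2r p0); apply: le_trans h1.
  by rewrite natrD natrM natrX lerDl.
rewrite -(ltr_pM2r p0); apply: (lt_le_trans h2).
by rewrite -natrX -natrM ler_nat mulSn addnC -addSn leq_add2r numeral_lt.
Qed.

Lemma numeral_window_card n a j :
  (#|[pred s : n.-tuple bool | (a <= numeral s < a + j)%N]| <= j)%N.
Proof.
rewrite cardE -(size_map (fun s : n.-tuple bool => numeral s)) -[leqRHS](size_iota a).
apply: uniq_leq_size => [|i /mapP[s]].
  rewrite map_inj_uniq ?enum_uniq// => s t h; apply: val_inj.
  by apply: numeral_inj h; rewrite !size_tuple.
by rewrite mem_enum inE => h ->; rewrite mem_iota.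
Qed.

(** A trapezoid in the variable x 2^n: 1 on [k, k + 2], 0 outside (k - 1, k + 3). Continuity makes
    it a test function for weak convergence, and its support meets at most four dyadic cells of
    level n. For k = 0 the predecessor [k.-1] in [bump_window] is 0, which is harmless as numerals
    are nonnegative. *)
Definition bump_fun (n k : nat) (x : R) : R :=
  maxr 0 (minr 1 (2 - `|x * 2 ^+ n - k.+1%:R|)).

Lemma bump_ge0 n k x : 0 <= bump_fun n k x.
Proof. by rewrite /bump_fun le_max lexx. Qed.

Lemma bump_le1 n k x : bump_fun n k x <= 1.
Proof. by rewrite /bump_fun ge_max ler01 ge_min lexx. Qed.

Lemma bump_continuous n k : continuous (bump_fun n k).
Proof.
apply: (@max_fun_continuous _ _ R (cst 0)); first by move=> x; exact: cvg_cst.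
apply: (@min_fun_continuous _ _ R (cst 1)); first by move=> x; exact: cvg_cst.
move=> x; apply: cvgB; first exact: cvg_cst.
apply: cvg_norm; apply: cvgB; last exact: cvg_cst.
by apply: cvgM; [exact: cvg_id|exact: cvg_cst].
Qed.

Lemma bump_eq1 n k x : k%:R * 2 ^- n <= x <= k.+2%:R * 2 ^- n -> bump_fun n k x = 1.
Proof.
have p0 : 0 < 2 ^+ n :> R by rewrite exprn_gt0.
have k1 : k.+1%:R = k%:R + 1 :> R by rewrite natr1.
have k2 : k.+2%:R = k%:R + 1 + 1 :> R by rewrite !natr1.
rewrite ler_pdivrMr// ler_pdivlMr// k2 => /andP[h1 h2].
have h : 1 <= 2 - `|x * 2 ^+ n - k.+1%:R|.
  by rewrite lerBrDr -lerBrDl ler_norml k1; apply/andP; split; lra.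
rewrite /bump_fun (min_idPl h) (max_idPr _)//; exact: ler01.
Qed.

Lemma bump_window n k s x : size s = n -> dyadic_cell R s x -> bump_fun n k x != 0 ->
  (k.-1 <= numeral s < k.-1 + 4)%N.
Proof.
move=> sn /dyadic_cellE; rewrite sn => /andP[h1 h2] b0.
have k1 : k.+1%:R = k%:R + 1 :> R by rewrite natr1.
have : `|x * 2 ^+ n - k.+1%:R| < 2.
  rewrite ltNge; apply/negP => h; move: b0; rewrite /bump_fun => /eqP; apply.
  by apply/max_idPl; rewrite ge_min subr_le0 h orbT.
rewrite ltr_norml => /andP[h3 h4].
have h5 : (numeral s < k + 3)%N.
  rewrite -(ltr_nat R); apply: (le_lt_trans h1).
  by rewrite natrD; move: h4; rewrite k1; lra.
have h6 : (k < numeral s + 2)%N.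
  rewrite -(ltr_nat R) natrD; move: h2 h3; rewrite k1 -[(numeral s).+1%:R]natr1; lra.
rewrite -subn1 leq_subLR addnC -ltnS -addnS h6 (leq_trans h5)//.
by case: (k) => // j; rewrite subn1 /= addSnnS.
Qed.

End dyadic_numerals.

(** * From node masses to integrals of test functions *)

Section cascade_mass.
Context {R : realType} d (T : measurableType d) (P : probability T R).
Variables (Xi : seq bool -> {RV P >-> R}) (nu0 : probability R R) (beta u : R).
Hypothesis iX : iid_on nu0 P Xi nonroot.
Hypothesis hu : mgf nu0 beta = (expR (u - ln 2))%:E.

(** By [hu], e^u = 2 E e^{beta xi}; the weight has mean 1/2, and [mass weight m] is the partition
    function divided by its mean. *)
Definition weight (y : R) : R := expR (beta * y) * expR (- u).

Lemma weight_ge0 y : 0 <= weight y. Proof. by rewrite mulr_ge0// expR_ge0. Qed.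

Lemma measurable_weight : measurable_fun [set: R] weight.
Proof.
by apply: measurable_funM => //; exact: measurable_expRM.
Qed.

Lemma integral_weight : (\int[nu0]_y (weight y)%:E = (2^-1)%:E)%E.
Proof.
under eq_integral do rewrite EFinM.
rewrite ge0_integralZr//; last first.
  by apply/measurable_EFinP; exact: measurable_expRM.
rewrite -/(mgf nu0 beta) hu -EFinM -expRD addrAC subrr add0r expRN lnK//.
by rewrite posrE.
Qed.

Lemma walkE s w : walk Xi s w = psum (path_steps s (Xi ^~ w)) (size s).
Proof. by rewrite /walk big_add1 /= big_mkord. Qed.

Lemma prod_weight m (F : nat -> R) :
  \prod_(k < m) weight (F k) = expR (beta * \sum_(k < m) F k) * expR (- (m%:R * u)).
Proof.
rewrite big_split /= prodr_const card_ord -expRM_natl mulrN big_distrr /=.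
by rewrite expR_sum.
Qed.

Lemma sum_expR_walk s m w :
  \sum_(t : m.-tuple bool) expR (beta * walk Xi (s ++ t) w) =
  expR (beta * walk Xi s w) * (expR (m%:R * u) * mass weight m (fun t => Xi (s ++ t) w)).
Proof.
rewrite massE mulrA big_distrr/=; apply: eq_bigr => t _.
rewrite (prod_weight m (fun k => Xi (s ++ take k.+1 t) w)).
rewrite -mulrA mulrCA -!expRD; congr expR.
transitivity (beta * (walk Xi s w + \sum_(k < m) Xi (s ++ take k.+1 t) w)); last by ring.
congr (_ * _).
rewrite !walkE size_cat size_tuple psumD; congr (_ + _).
  by apply: eq_bigr => i _; rewrite /path_steps takel_cat.
apply: eq_bigr => i _; rewrite /path_steps -addnS takeD take_size_cat// drop_size_cat//.
Qed.

Lemma partition_functionE n w :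
  partition_function Xi beta n w = expR (n%:R * u) * mass weight n (Xi ^~ w).
Proof.
have := sum_expR_walk [::] n w.
by rewrite /walk /= big_geq// mulr0 expR0 mul1r.
Qed.

Lemma expectation_partition n : ('E_P[partition_function Xi beta n] = (expR (n%:R * u))%:E)%E.
Proof.
rewrite unlock; under eq_integral do rewrite partition_functionE EFinM.
rewrite ge0_integralZl//; last 2 first.
- apply/measurable_EFinP; exact: (measurable_mass_sample measurable_weight iX [::]).
- by move=> w _; rewrite lee_fin mass_ge0//; exact: weight_ge0.
by rewrite (integral_mass weight_ge0 measurable_weight integral_weight iX) mule1.
Qed.

Definition window k : pred (seq bool) := fun s => (k.-1 <= numeral s < k.-1 + 4)%N.

(** The bump is at most 1 and meets at most 4 cells of level n; by the branching structure each has
    mass e^{-n u} times the product bounded by [theta], whatever the depth m. *)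
Lemma cascade_window n m k w (theta : R) : 0 <= theta ->
  (forall s : seq bool, size s = n ->
    expR (beta * walk Xi s w) * mass weight m (fun t => Xi (s ++ t) w) <= theta) ->
  (\int[(cascade_measure Xi beta (n + m) w : {measure set R -> \bar R})]_x (bump_fun n k x)%:E <=
   (4 * expR (- (n%:R * u)) * theta)%:E)%E.
Proof.
move=> th0 H.
have mb : measurable_fun [set: R] (@bump_fun R n k).
  by apply: continuous_measurable_fun; exact: bump_continuous.
set N := (n + m)%N; pose c (s : seq bool) := expR (- (N%:R * u)) * expR (beta * walk Xi s w).
have c0 s : 0 <= c s by rewrite mulr_ge0// expR_ge0.
rewrite (@ge0_integral_density _ R _ lebesgue_onR (cascade_measure Xi beta N w)
  (cascade_density Xi beta N w))//; last 3 first.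
- move=> A mA; rewrite ge0_integral_lebesgue_onR//.
    by apply: measurable_funTS; apply/measurable_EFinP; exact: measurable_cascade_density.
  by move=> x; rewrite lee_fin cascade_density_ge0.
- exact/measurable_EFinP.
- by move=> x; rewrite lee_fin bump_ge0.
(* The density on the cell of [s], with the bump replaced by 1 if the ancestor of [s] at level n
   lies in the window and by 0 otherwise. *)
pose a (s : seq bool) := 2 ^+ N * c s * (window k (take n s))%:R.
have a0 s : 0 <= a s by rewrite !mulr_ge0// exprn_ge0.
have mcell s : measurable (dyadic_cell R s) by exact: measurable_itv.
have mi s : measurable_fun [set: R] (fun x : R => (a s * \1_(dyadic_cell R s) x)%:E).
  by apply/measurable_EFinP; apply: measurable_funM => //; exact: measurable_indic.
apply: (@le_trans _ _ (\int[lebesgue_onR]_x \sum_(s : N.-tuple bool) (a s * \1_(dyadic_cell R s) x)%:E)%E).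
  apply: ge0_le_integral => //.
  - by move=> x _; rewrite -EFinM lee_fin mulr_ge0 ?bump_ge0 ?cascade_density_ge0.
  - apply: emeasurable_funM; first exact/measurable_EFinP.
    by apply/measurable_EFinP; exact: measurable_cascade_density.
  - by apply: emeasurable_sum => s; exact: mi.
  - move=> x _; rewrite -EFinM sumEFin lee_fin /cascade_density expectation_partition /= -expRN big_distrr/=.
    apply: ler_sum => s _; rewrite /a indicE.
    have [/set_mem xs|_] := boolP (x \in dyadic_cell R s); last by rewrite !mulr0.
    rewrite !mulr1 -/(c s) mulrC; apply: ler_wpM2l; first by rewrite mulr_ge0// exprn_ge0.
    have [->|b0] := eqVneq (bump_fun n k x) 0; first exact: ler0n.
    rewrite (_ : window k (take n s) = true) ?bump_le1//.
    apply: (@bump_window R n k _ x _ _ b0); first by rewrite size_takel// size_tuple leq_addr.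
    by apply: (@dyadic_cell_cat R _ (drop n s)); rewrite cat_take_drop.
rewrite ge0_integral_sum//; last by move=> s x _; rewrite lee_fin mulr_ge0.
have cellE (s : N.-tuple bool) : lebesgue_onR (dyadic_cell R s) = (2 ^- N)%:E.
  rewrite [LHS](_ : _ = lebesgue_measure (dyadic_cell R s : set (measurableTypeR R)))//.
  rewrite lebesgue_measure_itv /= lte_fin ltrDl invr_gt0 exprn_gt0// size_tuple.
  by rewrite -EFinD addrAC subrr add0r.
have Ei (s : N.-tuple bool) : (\int[lebesgue_onR]_x (a s * \1_(dyadic_cell R s) x)%:E =
    (c s * (window k (take n s))%:R)%:E)%E.
  under eq_integral do rewrite EFinM.
  rewrite ge0_integralZl ?lee_fin//; last by apply/measurable_EFinP; exact: measurable_indic.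
  rewrite integral_indic// setIT cellE -EFinM /a -mulrA mulrAC; congr EFin.
  by rewrite mulfV ?mul1r// expf_neq0.
rewrite (eq_bigr _ (fun s _ => Ei s)) sumEFin lee_fin.
rewrite (@sum_tupleD _ n m (fun s => c s * (window k (take n s))%:R)).
apply: (@le_trans _ _ (\sum_(s : n.-tuple bool | window k s) expR (- (n%:R * u)) * theta)).
  rewrite [leRHS]big_mkcond; apply: ler_sum => s _.
  under eq_bigr do rewrite take_size_cat ?size_tuple//.
  rewrite -big_distrl/=; case: ifP => _; last by rewrite mulr0.
  rewrite mulr1 /c -big_distrr/= sum_expR_walk.
  have -> : - (n%:R * u) = - (N%:R * u) + m%:R * u by rewrite /N natrD; ring.
  rewrite expRD -[leRHS]mulrA; apply: ler_wpM2l; first exact: expR_ge0.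
  rewrite mulrCA; apply: ler_wpM2l; first exact: expR_ge0.
  by apply: H; rewrite size_tuple.
rewrite sumr_const -[leRHS]mulrA -[leLHS]mulr_natl; apply: ler_wpM2r; first by rewrite mulr_ge0// expR_ge0.
- by rewrite ler_nat; exact: numeral_window_card.
- by move=> x; exact: cascade_density_ge0.
- exact: measurable_cascade_density.
Qed.

End cascade_mass.

(** * The modulus of continuity *)

Section covering.
Context {R : realType}.

Definition cover_cell (n k : nat) : set R := `[k%:R * 2 ^- n, k.+2%:R * 2 ^- n]%classic.

(** The bump dominates the indicator of the closed cell, and its integrals converge along the full
    sequence; a bound along infinitely many indices therefore passes to the limit. *)
Lemma weak_limit_cell_le (m_ : nat -> {measure set R -> \bar R}) (m : {measure set R -> \bar R})
    n k (c : R) : weak_cvg m_ m ->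
  (forall M, exists2 N, (M <= N)%N & (\int[m_ N]_x (bump_fun n k x)%:E <= c%:E)%E) ->
  (m (cover_cell n k) <= c%:E)%E.
Proof.
move=> wc H; have mcell : measurable (cover_cell n k) by exact: measurable_itv.
have mb : measurable_fun [set: R] (@bump_fun R n k).
  by apply: continuous_measurable_fun; exact: bump_continuous.
apply: (@le_trans _ _ (\int[m]_x (bump_fun n k x)%:E)%E).
  rewrite -[in leLHS](setIT (cover_cell _ _)) -integral_indic//.
  apply: ge0_le_integral => //.
  - by apply/measurable_EFinP; exact: measurable_indic.
  - exact/measurable_EFinP.
  - move=> x _; rewrite lee_fin indicE.
    have [/set_mem|_] := boolP (x \in cover_cell n k); last exact: bump_ge0.
    by rewrite /cover_cell /= in_itv /= => h; rewrite bump_eq1.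
rewrite leNgt; apply/negP => cl.
have cv : (\int[m_ N]_x (bump_fun n k x)%:E)%E @[N --> \oo] --> (\int[m]_x (bump_fun n k x)%:E)%E.
  apply: wc; first exact: bump_continuous.
  by exists 1 => x; rewrite ger0_norm ?bump_ge0 ?bump_le1.
have := cv [set y | (c%:E < y)%E] (open_nbhs_nbhs (conj (@open_ereal_gt_ereal R c%:E) cl)).
move=> [N0 _ hN]; have [N MN hc] := H N0.
by have := hN N MN; rewrite /= ltNge hc.
Qed.

Lemma itv_in01 (I : interval R) : [set` I] `<=` `[0, 1] -> 0 < itv_length I ->
  exists a, [/\ 0 <= a, itv_length I <= 1 & [set` I] `<=` `[a, a + itv_length I]].
Proof.
move=> sub; rewrite /itv_length => L0.
have L1 : (@lebesgue_measure R [set` I] <= 1)%E.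
  have <- : (@lebesgue_measure R `[0%R, 1%R]%classic = 1)%E.
    by rewrite lebesgue_measure_itv /= lte_fin ltr01 -EFinD subr0.
  by apply: le_measure; rewrite ?inE//; exact: measurable_itv.
have Lle1 : fine (@lebesgue_measure R [set` I]) <= 1.
  by rewrite -lee_fin fineK// ge0_fin_numE// (le_lt_trans L1)// ltry.
case: I => l r in sub L0 L1 Lle1 *.
move: L0 Lle1; rewrite lebesgue_measure_itv /=; case: ifPn => [lr|_]; last by rewrite ltxx.
have in01 x : x \in Interval l r -> 0 <= x <= 1 by move=> /sub /=; rewrite in_itv.
case: l r lr in01 {sub L1} => [ba a|[]] [bb b|[]] //=.
- rewrite lte_fin => ab in01 L0 Lle1.
  have mem x : a < x -> x < b -> x \in Interval (BSide ba a) (BSide bb b).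
    by move=> ax xb; rewrite in_itv /=; case: (ba) (bb) => [] []; rewrite /= ?ax ?xb ?(ltW ax) ?(ltW xb).
  exists a; split=> //.
    rewrite leNgt; apply/negP => a0.
    (* If a < 0, the midpoint of a and min(b, 0) is a negative point of the interval. *)
    have am : a < minr b 0 by rewrite lt_min ab.
    have [mb m0] : minr b 0 <= b /\ minr b 0 <= 0 by rewrite !ge_min !lexx orbT.
    have /andP[] : 0 <= (a + minr b 0) / 2 <= 1 by apply/in01/mem; lra.
    by lra.
  move=> x /=; rewrite !in_itv /= (_ : a + (b - a) = b); last by ring.
  by case: (ba) (bb) => [] [] /= /andP[h1 h2]; rewrite ?h1 ?h2 ?(ltW h1) ?(ltW h2).
(* The unbounded cases: the length is then [fine +oo], which is 0, against its positivity. *)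
- by rewrite ltxx.
- by rewrite ltxx.
- by rewrite ltxx.
Qed.

Lemma cover_cell_subset (a L : R) : 0 <= a -> 0 < L -> L <= 1 ->
  exists n k, [/\ 2 ^- n.+1 < L, L <= 2 ^- n & `[a, a + L] `<=` cover_cell n k].
Proof.
move=> a0 L0 L1.
have exn : exists n : nat, 2 ^- n.+1 < L.
  exists (Num.trunc L^-1).
  rewrite -[ltRHS]invrK ltf_pV2 ?posrE ?invr_gt0 ?exprn_gt0//.
  apply: (@lt_trans _ _ (Num.trunc L^-1).+1%:R); first exact: truncnS_gt.
  by rewrite -natrX ltr_nat ltn_expl.
have [n hn minn] := ex_minnP exn.
have Ln : L <= 2 ^- n.
  case: n minn {hn} => [|n] minn; first by rewrite expr0 invr1.
  by rewrite leNgt; apply/negP => /minn; rewrite ltnn.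
have p0 : 0 < 2 ^+ n :> R by rewrite exprn_gt0.
exists n, (Num.trunc (a * 2 ^+ n)); split=> //.
have /andP[h1 h2] : (Num.trunc (a * 2 ^+ n))%:R <= a * 2 ^+ n < (Num.trunc (a * 2 ^+ n)).+1%:R.
  by rewrite truncn_itv// mulr_ge0// ltW.
move=> x /=; rewrite /cover_cell /= !in_itv /= => /andP[ax xb]; apply/andP; split.
  by rewrite ler_pdivrMr// (le_trans h1)// ler_pM2r.
rewrite ler_pdivlMr// -[X in _ <= X]natr1; apply: (@le_trans _ _ (a * 2 ^+ n + L * 2 ^+ n)).
  by rewrite -mulrDl ler_pM2r.
by apply: lerD; [exact: ltW|rewrite -ler_pdivlMr// div1r].
Qed.

Variables (phi t : R).
Hypotheses (phi0 : 0 <= phi) (t0 : 0 <= t).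

Definition gauge (L : R) : R := L `^ phi * ln (1 + L^-1) `^ (- t).

(** The gauge at 2^{-(n+1)}, the lower end of the scale of lengths covered at level n; as the gauge
    increases with the length, it bounds all of them from below. *)
Definition cell_gauge (n : nat) : R := (2 ^- n.+1) `^ phi * ln (1 + 2 ^+ n.+1) `^ (- t).

Let ln_pos (y : R) : 0 < y -> 0 < ln (1 + y).
Proof. by move=> y0; rewrite ln_gt0// ltrDl. Qed.

Lemma cell_gauge_gt0 n : 0 < cell_gauge n.
Proof.
by rewrite mulr_gt0// powR_gt0 ?invr_gt0 ?exprn_gt0//; apply: ln_pos; rewrite exprn_gt0.
Qed.

Lemma cell_gauge_le n L : 2 ^- n.+1 < L -> cell_gauge n <= gauge L.
Proof.
move=> nL; have p0 : 0 < 2 ^- n.+1 :> R by rewrite invr_gt0 exprn_gt0.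
have L0 : 0 < L by exact: lt_trans nL.
apply: ler_pM; rewrite ?powR_ge0//.
  by apply: ge0_ler_powR; rewrite ?nnegrE ?(ltW p0) ?(ltW L0) ?(ltW nL).
have l1 : 0 < ln (1 + L^-1) by apply: ln_pos; rewrite invr_gt0.
have l2 : 0 < ln (1 + 2 ^+ n.+1) :> R by apply: ln_pos; rewrite exprn_gt0.
rewrite !powRN lef_pV2 ?posrE ?powR_gt0//; apply: ge0_ler_powR; rewrite ?nnegrE ?(ltW l1) ?(ltW l2)//.
rewrite ler_ln ?posrE ?addr_gt0 ?invr_gt0 ?exprn_gt0// lerD2l.
by rewrite -[leRHS]invrK lef_pV2 ?posrE ?(ltW nL).
Qed.

Lemma ln_cell_le n : (0 < n)%N -> ln (1 + 2 ^+ n.+1) <= 3 * n%:R :> R.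
Proof.
move=> n0; have p1 : 1 <= 2 ^+ n.+1 :> R by rewrite exprn_ege1// ler1n.
apply: (@le_trans _ _ (ln (2 ^+ n.+2))).
  rewrite ler_ln ?posrE ?exprn_gt0 ?addr_gt0 ?exprn_gt0//.
  by rewrite [leRHS]exprS; lra.
rewrite lnXn// -[leLHS]mulr_natl.
have l2 : ln 2 <= 1 :> R by have := @le_ln1Dx R 1 _; apply; lra.
apply: (@le_trans _ _ (n.+2%:R * 1)); first by rewrite ler_wpM2l.
rewrite mulr1 -natrM ler_nat.
by rewrite -addn2 (mulnDl 1 2) mul1n leq_add2l leq_pmulr.
Qed.

(** The factor e^u pays for n + 1 in place of n in 2^{-(n+1) phi} = e^{-(n+1) u}, and 3^t pays for
    ln (1 + 2^{n+1}) <= 3n. *)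
Lemma cell_gauge_asymp n u : (0 < n)%N -> phi = u / ln 2 ->
  expR (- (n%:R * u)) * expR (- (t * ln n%:R)) <= expR u * 3 `^ t * cell_gauge n.
Proof.
move=> n0 phiE; have ln2 : 0 < ln 2 :> R by rewrite ln_gt0// ltr1n.
have p0 : 0 < 2 ^- n.+1 :> R by rewrite invr_gt0 exprn_gt0.
have n00 : 0 < n%:R :> R by rewrite ltr0n.
have l2 : 0 < ln (1 + 2 ^+ n.+1) :> R by apply: ln_pos; rewrite exprn_gt0.
have -> : cell_gauge n = expR (- (n.+1%:R * u)) * expR (- (t * ln (ln (1 + 2 ^+ n.+1)))).
  rewrite /cell_gauge /powR !gt_eqF// mulNr; congr (expR _ * _).
  by rewrite lnV ?posrE ?exprn_gt0// lnXn// -[ln 2 *+ _]mulr_natl phiE; field; rewrite gt_eqF.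
rewrite {1}/powR gt_eqF// -!expRD ler_expR -[n.+1%:R]natr1.
have h : ln (ln (1 + 2 ^+ n.+1)) <= ln 3 + ln n%:R :> R.
  by rewrite -lnM ?posrE// ler_ln ?posrE ?mulr_gt0//; exact: ln_cell_le.
by have := ler_wpM2l t0 h; lra.
Qed.

End covering.

(** * The random constant *)

Section random_constant.
Context {R : realType} d (T : measurableType d) (mu : R.-ftker T ~> R).
Variable r : nat -> R.
Hypothesis r0 : forall n, 0 < r n.

(** Pairs (n, k) are enumerated by their codes, so that the constant is a supremum of a sequence and
    hence measurable. A number coding no pair gives 0, which is neutral among nonnegative ratios. *)
Definition cell_ratio (j : nat) (w : T) : \bar R :=
  if unpickle j is Some (n, k) then (mu w (cover_cell n k) * ((r n)^-1)%:E)%E else 0%E.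

Definition holder_constant (w : T) : \bar R := esups (cell_ratio ^~ w) 0.

Lemma measurable_holder_constant : measurable_fun [set: T] holder_constant.
Proof.
apply: measurable_fun_esups => j; rewrite /cell_ratio.
case: (unpickle j) => [[n k]|//]; apply: emeasurable_funM => //.
by apply: measurable_kernel; exact: measurable_itv.
Qed.

Lemma cell_le_holder_constant w n k :
  (mu w (cover_cell n k) <= holder_constant w * (r n)%:E)%E.
Proof.
rewrite -[leLHS]mule1 (_ : 1%E = ((r n)^-1)%:E * (r n)%:E)%E; last by rewrite -EFinM mulVf// gt_eqF.
rewrite muleA; apply: lee_wpmul2r; first by rewrite lee_fin ltW.
apply: ereal_sup_ubound; exists (pickle (n, k)) => //=.
by rewrite /cell_ratio pickleK.
Qed.

Lemma holder_constant_ge0 w : (0 <= holder_constant w)%E.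
Proof.
apply: (@le_trans _ _ (cell_ratio (pickle (0%N, 0%N)) w)).
  by rewrite /cell_ratio pickleK mule_ge0// lee_fin invr_ge0 ltW.
by apply: ereal_sup_ubound; exists (pickle (0%N, 0%N)).
Qed.

(** Levels from N on are bounded by assumption. On each of the finitely many levels below N the
    finite total mass bounds all cells at once, whatever k. *)
Lemma holder_constant_fin w (K : R) N :
  (forall n k, (N <= n)%N -> mu w (cover_cell n k) <= (K * r n)%:E)%E ->
  holder_constant w \is a fin_num.
Proof.
move=> H; rewrite ge0_fin_numE ?holder_constant_ge0//.
have muT : (mu w [set: R] < +oo)%E by apply: fin_num_fun_lty; exact: kernel_finite_transition.
pose t := fine (mu w [set: R]).
have tE : mu w [set: R] = t%:E by rewrite fineK// ge0_fin_numE.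
have t0 : 0 <= t by exact: fine_ge0.
pose K' := `|K| + \sum_(i < N) t / r i.
have s0 (Q : pred 'I_N) : 0 <= \sum_(i < N | Q i) t / r i.
  by apply: sumr_ge0 => i _; rewrite divr_ge0// ltW.
apply: (@le_lt_trans _ _ K'%:E); last exact: ltry.
apply: ge_ereal_sup => _ [j _ <-]; rewrite /cell_ratio.
case: (unpickle j) => [[n k]|]; last by rewrite lee_fin addr_ge0.
have [nN|Nn] := leqP N n.
  apply: (@le_trans _ _ ((K * r n)%:E * ((r n)^-1)%:E)%E).
    by apply: lee_wpmul2r; [rewrite lee_fin invr_ge0 ltW|exact: H].
  rewrite -EFinM mulfK ?gt_eqF// lee_fin; apply: (le_trans (ler_norm _)).
  by rewrite lerDl.
apply: (@le_trans _ _ (t%:E * ((r n)^-1)%:E)%E).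
  apply: lee_wpmul2r; first by rewrite lee_fin invr_ge0 ltW.
  by rewrite -tE; apply: le_measure; rewrite ?inE//; exact: measurable_itv.
rewrite -EFinM lee_fin /K' (bigD1 (Ordinal Nn))//= addrCA lerDl.
by rewrite addr_ge0.
Qed.

End random_constant.

Section cascade_modulus.
Context {R : realType} d0 (T0 : measurableType d0) (P0 : probability T0 R) (xi : {RV P0 >-> R}).
Context d (T : measurableType d) (P : probability T R).
Variables (Xi : seq bool -> {RV P >-> R}) (beta gamma : R) (mu : R.-ftker T ~> R).
Hypotheses (hbeta : 0 < beta < 1) (hgamma : 0 < gamma < 2^-1).
Hypothesis hXi : independent_copies xi Xi.
Hypothesis hmu : is_subcritical_cascade Xi beta mu.
Hypothesis crit : critical_normalization xi.

Lemma iid_copies : iid_on (law xi) P Xi nonroot.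
Proof.
split=> [s|r B ur rD mB]; first by [].
have -> : [set w | forall j, j \in r -> B j (Xi j w)] = \bigcap_(j in [set` r]) (Xi j @^-1` B j).
  by apply/seteqP; split.
rewrite hXi.2//; last by apply/allP => s /rD.
by apply: eq_big_seq => s /rD sn; exact: (hXi.1 s _ sn (mB s)).
Qed.

(** The inequality holds for every w, because the constant is a supremum of ratios; probability
    enters only in the finiteness of that constant. *)
Lemma cascade_modulus q : is_q_beta xi beta q ->
  (forall q', is_q_beta xi beta q' -> q' = q) /\
  exists C : T -> \bar R,
    [/\ measurable_fun [set: T] C, {ae P, forall w, C w \is a fin_num} &
      forall w (I : interval R), [set` I] `<=` `[0, 1] -> 0 < itv_length I ->
        (mu w [set` I] <=
         C w * (gauge (fine (phi_tilde xi beta)) (gamma * beta) (itv_length I))%:E)%E].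
Proof.
move=> hq; have /andP[b0 b1] := hbeta; have /andP[g0 g1] := hgamma.
have ln2 : 0 < ln 2 :> R by rewrite ln_gt0// ltr1n.
have [u u0 hu] := mgf_beta_gt crit b0 b1.
have phiE : phi_tilde xi beta = (u / ln 2)%:E.
  by rewrite (phi_tilde_expR hu); congr EFin; field; rewrite gt_eqF.
have m1 : mgf (law xi) 1 = (expR (- ln 2))%:E by rewrite (mgf_law1 crit) expRN lnK ?posrE.
have qE := mgf_root phiE hq.
rewrite phiE /=; split.
  move=> q' hq'; apply: (root_mgf_unique b0 b1 u0 m1 hu hq.1 hq'.1 qE).
  exact: mgf_root phiE hq'.
have qb := root_mgf_gt b0 b1 u0 m1 hu hq.1 qE.
(* The midpoint of 1/beta and q: p beta > 1 is what [bad_decay] asks, and p < q keeps the moments of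
   order p bounded. *)
pose p := (beta^-1 + q) / 2.
have bq : beta^-1 < q by rewrite -div1r ltr_pdivrMr.
have pb : 1 < p * beta.
  by rewrite -ltr_pdivrMr// div1r /p; lra.
have pq : p < q by rewrite /p; lra.
have iX := iid_copies.
have p0 : 0 <= p by rewrite /p divr_ge0// addr_ge0 ?invr_ge0 ?(ltW b0)//; have := hq.1; lra.
have wm r : 1 < r -> r <= p ->
    (weight_moment (law xi) (weight beta u) r + weight_moment (law xi) (weight beta u) r < 1)%E.
  move=> r1 rp.
  have := mgf_lt_root b0 b1 u0 m1 hu hq.1 qE r1 (le_lt_trans rp pq).
  have -> : weight_moment (law xi) (weight beta u) r = (mgf (law xi) (beta * r) * (expR (- (r * u)))%:E)%E.
    rewrite /weight_moment /mgf -ge0_integralZr//; last by apply/measurable_EFinP; exact: measurable_expRM.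
    apply: eq_integral => y _; rewrite /weight -expRD -EFinM -expRD /powR gt_eqF ?expR_gt0// expRK.
    by congr (expR _)%:E; ring.
  have : (0 <= mgf (law xi) (beta * r))%E by apply: integral_ge0 => y _; rewrite lee_fin expR_ge0.
  case: (mgf _ _) => [v| |]//; rewrite lee_fin lte_fin => v0 vr; rewrite -EFinM -EFinD lte_fin.
  have : v * expR (- (r * u)) < 2^-1.
    have -> : 2^-1 = expR (r * u - ln 2) * expR (- (r * u)) :> R.
      by rewrite -expRD addrAC subrr add0r expRN lnK ?posrE.
    by rewrite ltr_pM2r ?expR_gt0.
  by lra.
have [C HC] := mass_moments_bounded (@weight_ge0 _ beta u) (@measurable_weight _ beta u) (integral_weight hu) iX p0 wm.
have [c [B [p' [c0 cB p'0 hr hl]]]] := tilted_law_tails crit.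
have [s [C' [s1 C'0 hbad]]] := bad_decay (tilted_lawE crit) (integrable_tilted_law crit)
  (Rintegral_tilted_law crit) c0 cB p'0 hr hl iX (@weight_ge0 _ beta u) (@measurable_weight _ beta u) g0 g1 p0 pb HC.
have ae_good := borel_cantelli_liminf s1 C'0 (fun n m =>
  measurable_bad iX (@measurable_weight _ beta u) (expR (- (gamma * beta * ln n%:R))) beta n m) hbad.
have phi0 : 0 <= u / ln 2 by rewrite divr_ge0// ltW.
have t0 : 0 <= gamma * beta by rewrite mulr_ge0// ltW.
pose r := cell_gauge (u / ln 2) (gamma * beta).
have r0 n : 0 < r n by exact: cell_gauge_gt0.
exists (holder_constant mu r); split.
- exact: measurable_holder_constant.
- apply: filterS2 ae_good hmu => w [N hN] wc.
  (* The constant multiplies the 4 of [cascade_window] by the factor of [cell_gauge_asymp]; the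
     latter holds for n > 0, whence [maxn N 1]. *)
  apply: (@holder_constant_fin _ _ _ mu r r0 w (4 * (expR u * 3 `^ (gamma * beta))) (maxn N 1)) => n k.
  rewrite geq_max => /andP[Nn n0].
  apply: (@le_trans _ _ (4 * expR (- (n%:R * u)) * expR (- (gamma * beta * ln n%:R)))%:E).
    apply: weak_limit_cell_le wc _ => M.
    have [m Mm hm] := hN n Nn M.
    exists (n + m)%N; first exact: leq_trans (leq_addl _ _).
    apply: (@cascade_window _ _ _ P Xi (law xi) beta u iX hu n m k w _ (expR_ge0 _)) => s' sn.
    rewrite leNgt; apply/negP => h; apply: hm; exists s' => //.
    by move: h; rewrite walkE sn.
  have h := cell_gauge_asymp t0 n0 (erefl (u / ln 2)).
  rewrite lee_fin -[leLHS]mulrA -[leRHS]mulrA.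
  by apply: ler_wpM2l; [exact: ler0n|exact: h].
move=> w I I01 L0; have [a [a0 L1 Isub]] := itv_in01 I01 L0.
have [n [k [nL Ln cov]]] := cover_cell_subset a0 L0 L1.
apply: (@le_trans _ _ (mu w (cover_cell n k))).
  by apply: le_measure; rewrite ?inE; [exact: measurable_itv|exact: measurable_itv|exact: subset_trans cov].
apply: le_trans (cell_le_holder_constant mu r0 w n k) _.
apply: lee_wpmul2l; first exact: holder_constant_ge0.
by rewrite lee_fin; exact: cell_gauge_le.
Qed.

End cascade_modulus.

Theorem theorem4 (R : realType)
  (d0 : measure_display) (T0 : measurableType d0) (P0 : probability T0 R)
  (xi : {RV P0 >-> R})
  (d : measure_display) (T : measurableType d) (P : probability T R)
  (Xi : seq bool -> {RV P >-> R})
  (beta gamma : R) (mu : R.-ftker T ~> R)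
  (hbeta : 0 < beta < 1) (hgamma : 0 < gamma < 2^-1)
  (hXi : independent_copies xi Xi)
  (hmu : is_subcritical_cascade Xi beta mu) :
  (critical_normalization xi ->
   forall q : R, is_q_beta xi beta q ->
     (forall q' : R, is_q_beta xi beta q' -> q' = q) /\
     (('E_P0[(fun t => Num.max 0 (xi t) * expR (beta * q * xi t))%R] < +oo)%E ->
      exists C : T -> \bar R,
        [/\ measurable_fun [set: T] C,
            {ae P, forall w, C w \is a fin_num} &
            {ae P, forall w, forall I : interval R,
               [set` I] `<=` `[0, 1] -> 0 < itv_length I ->
               (mu w [set` I] <=
                C w * (itv_length I `^ fine (phi_tilde xi beta) *
                       ln (1 + (itv_length I)^-1) `^ (- (gamma * beta)))%:E)%E}])) /\
  (gaussian_case xi ->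
   phi_tilde xi beta = ((1 - beta) ^+ 2)%:E /\
   forall q : R, is_q_beta xi beta q <-> q = (beta ^+ 2)^-1).
Proof.
have /andP[b0 b1] := hbeta; split=> [crit q hq|gauss]; last first.
  split; first exact: gaussian_phi_tilde.
  by move=> q; exact: gaussian_q_beta.
have [uniq_q [C [mC finC HC]]] := cascade_modulus hbeta hgamma hXi hmu crit hq.
split=> // _; exists C; split=> //.
by apply: aeW => w I I01 L0; exact: HC.
Qed.
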